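(* Let $D\subset\mathbb{R}^n$ be a domain, let $E=D\times\mathbb{R}^r$ be the trivial real vector bundle over $D$, and let $g:D\to\mathrm{Sym}^+_r(\mathbb{R})$ be a $C^2$ Riemannian metric on $E$. Fix an integer $1\le q\le n$. Suppose that for every smooth strictly convex function $\psi$ on $\mathbb{R}^n$ and every $d$-closed $E$-valued $q$-form with compact support $f\in\wedge^q_c(D,E)$, $df=0$, there exists $u\in L^2_{q-1}(D,E)$ with $du=f$ (in the sense of distributions) and $$\int_D\langle u,u\rangle_g\,e^{-\psi}\,d\lambda\le\int_D\langle \mathrm{Hess}_\psi^{-1}f,f\rangle_g\,e^{-\psi}\,d\lambda,$$ whenever the right-hand side is finite. Then $(E,g)$ is Nakano $q$-semipositive.
   Context: An $E$-valued $q$-form is written $\alpha=\sum_{\tau=1}^r\big(\sum_{|I|=q}\alpha_{I,\tau}dx_I\big)\otimes e_\tau$, where $e_1,\dots,e_r$ is the standard frame of $E$ with $\langle e_\tau,e_\xi\rangle=g_{\tau\xi}$; the pointwise inner product is $\langle\alpha,\beta\rangle_g=\sum_{\tau,\xi}\sum_I\alpha_{I,\tau}\beta_{I,\xi}g_{\tau\xi}$, and $L^2_{q-1}(D,E)$ is the completion of the space of smooth $E$-valued $(q-1)$-forms with respect to $\int_D\langle\cdot,\cdot\rangle_g\,d\lambda$ ($d\lambda$ Lebesgue measure). For a smooth function $\psi$, $\mathrm{Hess}_\psi=\sum_{i,j=1}^n\frac{\partial^2\psi}{\partial x_i\partial x_j}\,dx_i\wedge\big(\frac{\partial}{\partial x_j}\lrcorner\,\cdot\big)$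 acting on $E$-valued $q$-forms (positive definite, hence invertible, when $\psi$ is strictly convex). The curvature operator of $g$ is $\Theta_E=-\sum_{i,j=1}^n\frac{\partial}{\partial x_i}\big(g^{-1}\frac{\partial g}{\partial x_j}\big)\,dx_i\wedge\big(\frac{\partial}{\partial x_j}\lrcorner\,\cdot\big)$, the matrix $\frac{\partial}{\partial x_i}(g^{-1}\partial_{x_j}g)$ acting on the fiber coefficients. $(E,g)$ is Nakano $q$-semipositive if $\langle\Theta_E\alpha,\alpha\rangle_g\ge0$ at every point of $D$ for every $E$-valued $q$-form $\alpha$. *)

(* Defs.v *)
From HB Require Import structures.
From Stdlib Require Import ClassicalEpsilon.
From mathcomp Require Import all_boot all_order all_algebra.
From mathcomp Require Import all_classical all_reals all_analysis.
Set Implicit Arguments. Unset Strict Implicit. Unset Printing Implicit Defensive.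
Import Order.TTheory GRing.Theory Num.Theory.
Import numFieldNormedType.Exports.
Local Open Scope classical_set_scope.
Local Open Scope ring_scope.

Definition evec (R : realType) (n : nat) (i : 'I_n) : 'rV[R]_n := delta_mx 0 i.

Definition pd (R : realType) (n : nat) (i : 'I_n) (f : 'rV[R]_n -> R) (x : 'rV[R]_n) : R :=
  derive1 (fun t : R => f (x + t *: evec R i)) 0.

Definition pds (R : realType) (n : nat) (s : seq 'I_n) (f : 'rV[R]_n -> R) : 'rV[R]_n -> R :=
  foldr (fun i h => pd i h) f s.

Definition Ck (R : realType) (n : nat) (k : nat) (A : set 'rV[R]_n) (f : 'rV[R]_n -> R) : Prop :=
  forall s : seq 'I_n, (size s <= k)%N -> forall x, A x ->
    {for x, continuous (pds s f)} /\
    ((size s < k)%N -> forall i : 'I_n,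
        derivable (fun t : R => pds s f (x + t *: evec R i)) 0 1).

Definition smooth_on (R : realType) (n : nat) (A : set 'rV[R]_n) (f : 'rV[R]_n -> R) : Prop :=
  forall k, Ck k A f.

Definition compact_support_in (R : realType) (n : nat) (D : set 'rV[R]_n) (f : 'rV[R]_n -> R) : Prop :=
  exists K : set 'rV[R]_n, [/\ compact K, K `<=` D & forall x, ~ K x -> f x = 0].

Definition borel_meas (R : realType) (n : nat) (f : 'rV[R]_n -> R) : Prop :=
  forall B : set R, open B -> (<<s (@open 'rV[R]_n) >>) (f @^-1` B).

(* Integral w.r.t. Lebesgue measure on R^n, defined as the iterated integral of
   one-dimensional Lebesgue integrals (equal to the product-measure integral by
   Tonelli for the nonnegative measurable integrands it is applied to). *)
Fixpoint iint (R : realType) (n : nat) : ('rV[R]_n -> \bar R) -> \bar R :=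
  match n with
  | 0 => fun F => F 0
  | n'.+1 => fun F =>
      (\int[@lebesgue_measure R]_(t in setT)
         iint (fun y : 'rV[R]_n' => F (row_mx (t%:M : 'rV[R]_1) y)))%E
  end.

Definition iintD (R : realType) (n : nat) (D : set 'rV[R]_n) (F : 'rV[R]_n -> \bar R) : \bar R :=
  iint (fun x => if `[< D x >] then F x else 0%E).

Definition sintD (R : realType) (n : nat) (D : set 'rV[R]_n) (F : 'rV[R]_n -> R) : \bar R :=
  (iintD D (fun x => (Num.max (F x) 0)%:E) - iintD D (fun x => (Num.max (- F x) 0)%:E))%E.

(* Fiber of E-valued forms over a point: coefficients alpha_{I,tau},
   I ranging over subsets of {0..n-1} (increasing multi-indices), tau in 'I_r. *)
Definition fform (R : realType) (n r : nat) := {set 'I_n} -> 'I_r -> R.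

Definition is_qform (R : realType) (n r q : nat) (a : fform R n r) : Prop :=
  forall (I : {set 'I_n}) (t : 'I_r), #|I| != q -> a I t = 0.

Definition wedge (R : realType) (n r : nat) (i : 'I_n) (a : fform R n r) : fform R n r :=
  fun J t => if i \in J then (-1) ^+ #|[set k in J | (k < i)%N]| * a (J :\ i) t else 0.

Definition inter (R : realType) (n r : nat) (j : 'I_n) (a : fform R n r) : fform R n r :=
  fun K t => if j \in K then 0 else (-1) ^+ #|[set k in K | (k < j)%N]| * a (j |: K) t.

Definition fib (R : realType) (n r : nat) (M : 'M[R]_r) (a : fform R n r) : fform R n r :=
  fun I s => \sum_(t < r) M s t * a I t.

Definition ip (R : realType) (n r : nat) (q : nat) (G : 'M[R]_r) (a b : fform R n r) : R :=
  \sum_(I : {set 'I_n} | #|I| == q) \sum_(t < r) \sum_(x < r) a I t * b I x * G t x.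

Definition hessM (R : realType) (n : nat) (psi : 'rV[R]_n -> R) (x : 'rV[R]_n) : 'M[R]_n :=
  \matrix_(i, j) pd i (pd j psi) x.

Definition HessOp (R : realType) (n r : nat) (H : 'M[R]_n) (a : fform R n r) : fform R n r :=
  fun I s => \sum_(i < n) \sum_(j < n) H i j * wedge i (inter j a) I s.

(* Hess^{-1} f: the q-form v with Hess v = f (unique when Hess is positive definite) *)
Definition HessInv (R : realType) (n r q : nat) (H : 'M[R]_n) (f : fform R n r) : fform R n r :=
  epsilon (inhabits (fun _ _ => 0)) (fun v => is_qform q v /\ HessOp H v = f).

Definition pdM (R : realType) (n r : nat) (i : 'I_n) (G : 'rV[R]_n -> 'M[R]_r) (x : 'rV[R]_n) : 'M[R]_r :=
  \matrix_(a, b) pd i (fun y => G y a b) x.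

Definition Theta (R : realType) (n r : nat) (g : 'rV[R]_n -> 'M[R]_r) (x : 'rV[R]_n)
    (a : fform R n r) : fform R n r :=
  fun I s => - \sum_(i < n) \sum_(j < n)
     wedge i (inter j (fib (pdM i (fun y => invmx (g y) *m pdM j g y) x) a)) I s.

Definition nakano_q_semipositive (R : realType) (n r q : nat) (D : set 'rV[R]_n)
    (g : 'rV[R]_n -> 'M[R]_r) : Prop :=
  forall x, D x -> forall a : fform R n r, is_qform q a -> 0 <= ip q (g x) (Theta g x a) a.

Definition extd (R : realType) (n r : nat) (u : 'rV[R]_n -> fform R n r) (x : 'rV[R]_n) : fform R n r :=
  fun J t => \sum_(i < n) wedge i (fun I s => pd i (fun y => u y I s) x) J t.

Definition weak_d (R : realType) (n r : nat) (D : set 'rV[R]_n)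
    (u f : 'rV[R]_n -> fform R n r) : Prop :=
  forall chi : 'rV[R]_n -> R, smooth_on setT chi -> compact_support_in D chi ->
  forall J t,
    sintD D (fun x => f x J t * chi x) =
    (- sintD D (fun x => (\sum_(i < n) wedge i (fun I s => u x I s * pd i chi x) J t)%R))%E.

Definition pos_def (R : realType) (m : nat) (M : 'M[R]_m) : Prop :=
  forall v : 'rV[R]_m, v != 0 -> 0 < (v *m M *m v^T) 0 0.

(* Main.v *)
(** Suppose that the curvature form is negative on some q-form [xi] at some [x0], write
    [y = x - x0], and let [H] be the second order Taylor polynomial of [g] at [x0].  Take for [f]
    a closed form with small compact support that is equal to [xi] near [x0], and
    [psi = (s - e) |y|^2], so that [Hess_psi^-1 f = f / (2 (s - e) q)].  Test [du = f] against
    the smooth form [H f exp (- s |y|^2)]; the spare factor [exp (- e |y|^2)] absorbs the error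
    between [H] and the merely C^2 metric [g].  Completing the square and inserting the
    L^2 estimate removes [u], and integrating by parts in the Gaussian cancels all terms of
    order [s^2] and, where [f] is constant, of order [s].  What remains is [0 <= int B exp (- s |y|^2)]
    up to a term supported away from [x0], with [B (x0) = <Theta xi, xi> + O(e) < 0].
    As [s] grows the Gaussian concentrates at [x0], a contradiction. *)

Require Import Defs.
From HB Require Import structures.
From mathcomp Require Import all_boot all_order all_algebra.
From mathcomp Require Import all_classical all_reals all_analysis measurable_realfun.
From mathcomp Require Import ring lra.
Import Order.TTheory GRing.Theory Num.Theory.
Import numFieldNormedType.Exports.
Local Open Scope classical_set_scope.
Local Open Scope ring_scope.
Set Implicit Arguments. Unset Strict Implicit. Unset Printing Implicit Defensive.

(** * Lebesgue measure on row vectors *)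

(** The hypothesis controls [u] only through weighted square integrals, so [u] is paired linearly
    with a known smooth form and then eliminated by a square. Test forms have to be smooth while [g]
    is only C^2, which forces the polynomial [H]. Second order is just enough: the relative error e
    |y|^2 between the two metrics meets energies carrying a factor s, and s |y|^2 has size one under
    the Gaussian, so the loss is O(e), which a fixed negative curvature value beats. The weight has
    s - e where the test has s because 1 + e |y|^2 <= exp (e |y|^2) then pays for replacing [g] by
    [H] in the term quadratic in [u]. In the square, the inverse of [H] is replaced by the constant
    inverse of [g x0] at the price of a factor 1 + e, so that no variable inverse enters the
    integrations by parts. The choices are made in the order: e from the curvature, the radius and
    [f] from e, s from all of these, and last the weight and [u]. *)

Notation borelT R n := (g_sigma_algebraType (@open 'rV[R]_n)).

Section borel_rV.
Context {R : realType}.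

(** A countable base of the topology: through it every open set is a countable union of boxes, and
    measurability into the Borel sigma-algebra can be checked coordinatewise. *)
Definition rat_box n (c : 'rV[rat]_n * nat) : set 'rV[R]_n :=
  [set x | forall i, `|x 0 i - ratr (c.1 0 i)| < c.2.+1%:R^-1].

Lemma open_bigcup_box n (A : set 'rV[R]_n) : open A ->
  A = \bigcup_(c in [set c | rat_box c `<=` A]) rat_box c.
Proof.
move=> oA; apply/seteqP; split => [x Ax|x [c /= cA cx]]; last exact: cA.
have /nbhs_ballP [e /= e0 eA] : nbhs x A by exact: open_nbhs_nbhs.
have [N [d [dE d0 de]]] : exists N d, [/\ N.+1%:R^-1 = d :> R, 0 < d & 2 * d < e].
  have e2 : 0 < e / 2 by rewrite divr_gt0.
  have [N _ /(_ N (leqnn _))] := near_infty_natSinv_lt (PosNum e2).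
  move=> /= h; exists N, N.+1%:R^-1; split => //.
  by rewrite mulrC -ltr_pdivlMr.
have /choice [c cP] : forall i, exists q : rat, `|x 0 i - ratr q| < d.
  move=> i; have [q] : exists q : rat, ratr q \in `]x 0 i - d, x 0 i + d[.
    by apply: rat_in_itvoo; lra.
  rewrite in_itv /= => /andP[h1 h2]; exists q; rewrite ltr_norml; apply/andP; split; lra.
exists (\row_i c i, N) => /=; last by move=> i; rewrite mxE dE; exact: cP.
move=> y yb; apply: eA; rewrite /ball /=; split => // i j; rewrite (ord1 i).
have := yb j; have := cP j; rewrite /= mxE dE /ball /= => h1 h2.
rewrite (_ : _ - _ = (x 0 j - ratr (c j)) - (y 0 j - ratr (c j))); last by ring.
apply: le_lt_trans (ler_normB _ _) _; apply: lt_trans de; lra.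
Qed.

Lemma countType_bigcup_measurable d (T : measurableType d) (C : countType)
    (P : set C) (F : C -> set T) :
  (forall c, P c -> measurable (F c)) -> measurable (\bigcup_(c in P) F c).
Proof.
move=> mF.
pose G k := if unpickle k is Some c then if `[< P c >] then F c else set0 else set0.
suff -> : \bigcup_(c in P) F c = \bigcup_k G k.
  apply: bigcupT_measurable => k; rewrite /G; case: unpickle => // c.
  by case: asboolP => // /mF.
apply/seteqP; split => [x [c Pc Fc]|x [k _]]; rewrite /G.
  by exists (pickle c) => //; rewrite pickleK; case: asboolP.
by case: unpickle => // c; case: asboolP => // Pc Fx; exists c.
Qed.

Lemma measurable_rV d (T : measurableType d) n (F : T -> borelT R n) :
  (forall i, measurable_fun setT (fun t => (F t : 'rV[R]_n) 0 i)) ->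
  measurable_fun setT F.
Proof.
move=> mF; apply: (@measurability _ _ T (borelT R n) setT F (@open 'rV[R]_n)) => //.
move=> _ [A oA <-]; rewrite setTI (open_bigcup_box oA) preimage_bigcup.
apply: countType_bigcup_measurable => c _.
have -> : F @^-1` rat_box c = \bigcap_(i in [set: 'I_n])
   ((fun t => (F t : 'rV[R]_n) 0 i) @^-1` [set z | `|z - ratr (c.1 0 i)| < c.2.+1%:R^-1]).
  by apply/seteqP; split => x /= h i; [move=> _; exact: h|exact: h].
apply: fin_bigcap_measurable; first exact: finite_finset.
move=> i _; rewrite -[X in measurable X]setTI; apply: mF => //.
apply: open_measurable.
have -> : [set z | `|z - ratr (c.1 0 i)| < c.2.+1%:R^-1] = ball (ratr (c.1 0 i) : R) c.2.+1%:R^-1.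
  by apply/seteqP; split => z; rewrite /ball /= distrC.
by apply: ball_open; rewrite invr_gt0 ltr0n.
Qed.

Lemma borel_open_measurable n (A : set 'rV[R]_n) : open A -> measurable (A : set (borelT R n)).
Proof. by move=> oA; apply: sub_sigma_algebra. Qed.

Lemma borel_measP n (f : 'rV[R]_n -> R) :
  borel_meas f -> measurable_fun (setT : set (borelT R n)) f.
Proof.
move=> bf; apply: (measurability _ (RGenOpens.measurableE R)).
move=> _ [_ [a [b ->] <-]]; rewrite setTI; apply: bf; exact: interval_open.
Qed.

Lemma continuous_borel_fun n (f : 'rV[R]_n -> R) : continuous f ->
  measurable_fun (setT : set (borelT R n)) f.
Proof.
move=> cf; apply: borel_measP => B oB; apply: sub_sigma_algebra.
by move/continuousP : cf; apply.
Qed.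

(** The extension by zero may jump at the boundary of [D] but stays Borel: the preimage of an open
    set is an open part of [D] together with all or nothing of the complement. This serves the
    metric, whose continuity is known on [D] only. *)
Lemma continuous_patch_borel_fun n (D : set 'rV[R]_n) (f : 'rV[R]_n -> R) : open D ->
  (forall x, D x -> {for x, continuous f}) ->
  measurable_fun (setT : set (borelT R n)) (fun x => if `[< D x >] then f x else 0).
Proof.
move=> oD cf; apply: borel_measP => B oB.
have mD : measurable (D : set (borelT R n)) by exact: borel_open_measurable.
have mDB : measurable (D `&` f @^-1` B : set (borelT R n)).
  apply: borel_open_measurable; rewrite openE => x [Dx Bx].
  apply: filterI; first exact: open_nbhs_nbhs.
  by apply: (cf _ Dx); exact: open_nbhs_nbhs.
have -> : (fun x => if `[< D x >] then f x else 0) @^-1` B =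
    (D `&` f @^-1` B) `|` (~` D `&` (if `[< B 0 >] then setT else set0)).
  apply/seteqP; split => x /=.
    case: (asboolP (D x)) => Dx H; first by left.
    by right; split => //; case: (asboolP (B 0)).
  case=> -[Dx H]; first by case: (asboolP (D x)).
  by case: (asboolP (D x)) => // _; case: (asboolP (B 0)) H.
apply: (@measurableU _ (borelT R n)) => //; apply: measurableI; first exact: measurableC.
by case: asboolP.
Qed.

Definition rV_cons n (t : R) (y : 'rV[R]_n) : 'rV[R]_n.+1 := row_mx (t%:M : 'rV[R]_1) y.

Lemma rV_cons0 n t (y : 'rV[R]_n) : rV_cons t y 0 ord0 = t.
Proof.
have tE : (t%:M : 'rV[R]_1) 0 0 = t by rewrite mxE eqxx mulr1n.
rewrite -[RHS]tE -(@row_mxEl R 1 1 n t%:M y 0 0).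
by congr (row_mx _ _ _ _); exact/val_inj.
Qed.

Lemma rV_consS n t (y : 'rV[R]_n) j : rV_cons t y 0 (lift ord0 j) = y 0 j.
Proof.
rewrite -(@row_mxEr R 1 1 n t%:M y 0 j).
by congr (row_mx _ _ _ _); exact/val_inj.
Qed.

Lemma measurable_coord n i : measurable_fun setT (fun y : borelT R n => (y : 'rV[R]_n) 0 i).
Proof. by apply: continuous_borel_fun => x; exact: coord_continuous. Qed.

Lemma measurable_rV_cons n : measurable_fun setT
  (fun z : measurableTypeR R * borelT R n => rV_cons z.1 z.2 : borelT R n.+1).
Proof.
apply: measurable_rV => i; case: (unliftP ord0 i) => [j|] ->.
  rewrite (_ : (fun _ => _) = (fun y : borelT R n => (y : 'rV_n) 0 j) \o snd).
    exact: measurableT_comp (measurable_coord j) measurable_snd.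
  by apply/funext => z; rewrite rV_consS.
rewrite (_ : (fun _ => _) = fst); first exact: measurable_fst.
by apply/funext => z; rewrite rV_cons0.
Qed.

Lemma product_sigma_finite d1 d2 (T1 : measurableType d1) (T2 : measurableType d2)
  (m1 : {sigma_finite_measure set T1 -> \bar R}) (m2 : {sigma_finite_measure set T2 -> \bar R}) :
  sigma_finite setT (m1 \x m2)%E.
Proof.
have /sigma_finiteP[F [TF ndF Foo]] := sigma_finiteT m1.
have /sigma_finiteP[G [TG ndG Goo]] := sigma_finiteT m2.
exists (fun n => F n `*` G n); last first.
  move=> k; have [? ?] := Foo k; have [? ?] := Goo k; split; first exact: measurableX.
  by rewrite product_measure1E // lte_mul_pinfty // ge0_fin_numE.
apply/seteqP; split => // -[x y] _.
have [i _ Fx] : (\bigcup_i F i) x by rewrite -TF.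
have [j _ Gy] : (\bigcup_j G j) y by rewrite -TG.
exists (maxn i j) => //; split.
  by have /subsetPset := ndF _ _ (leq_maxl i j); apply.
by have /subsetPset := ndG _ _ (leq_maxr i j); apply.
Qed.

(** * Adjoining one coordinate to a measure *)

Section next_measure.
Local Open Scope ereal_scope.
Context n (mu : {sigma_finite_measure set (borelT R n) -> \bar R}).
Let row (z : measurableTypeR R * borelT R n) : borelT R n.+1 := rV_cons z.1 z.2.
Let leb : {sigma_finite_measure set (measurableTypeR R) -> \bar R} := @lebesgue_measure R.

(** The pushforward of the product measure along [row]: row vectors carry the Borel sigma-algebra of
    their own topology, so the product measure has to be transported. *)
Definition next_measure (A : set (borelT R n.+1)) := (leb \x mu) (row @^-1` A).

Let mrow (A : set (borelT R n.+1)) : measurable A -> measurable (row @^-1` A).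
Proof. by move=> mA; rewrite -[X in measurable X]setTI; exact: measurable_rV_cons. Qed.

Let next0 : next_measure set0 = 0.
Proof. by rewrite /next_measure preimage_set0 measure0. Qed.

Let next_ge0 A : 0 <= next_measure A.
Proof. exact: measure_ge0. Qed.

Let next_sigma_additive : semi_sigma_additive next_measure.
Proof.
move=> F mF tF mUF; rewrite /next_measure preimage_bigcup.
apply: measure_semi_sigma_additive.
- by move=> k; exact: mrow.
- apply/trivIsetP => /= i j _ _ ij; rewrite -preimage_setI.
  by move/trivIsetP : tF => /(_ _ _ _ _ ij) ->//; rewrite preimage_set0.
- by rewrite -preimage_bigcup; exact: mrow.
Qed.

HB.instance Definition _ := isMeasure.Build _ _ _ next_measure next0 next_ge0 next_sigma_additive.

Let next_sigma_finite : sigma_finite setT next_measure.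
Proof.
have [F FT Foo] : sigma_finite setT (leb \x mu).
  exact: product_sigma_finite.
(* [un] is a measurable left inverse of [row]; pulling an exhaustion of the product back along it
   gives an exhaustion by sets of finite measure. *)
pose un (x : borelT R n.+1) : measurableTypeR R * borelT R n :=
  ((x : 'rV_n.+1) 0%R ord0, \row_j ((x : 'rV_n.+1) 0%R (lift ord0 j))).
have unK x : un (row x) = x.
  case: x => t y; rewrite /un /row /= rV_cons0; congr pair.
  by apply/rowP => j; rewrite mxE rV_consS.
have mun : measurable_fun setT un.
  apply: measurable_fun_pair; first exact: measurable_coord.
  apply: measurable_rV => i; rewrite (_ : (fun _ => _) =
    (fun y : borelT R n.+1 => (y : 'rV_n.+1) 0%R (lift ord0 i))); first exact: measurable_coord.
  by apply/funext => z; rewrite mxE.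
exists (fun i => un @^-1` F i).
  by rewrite -preimage_bigcup -FT preimage_setT.
move=> i; split; first by rewrite -[X in measurable X]setTI; apply: mun => //; exact: (Foo i).1.
rewrite /next_measure -comp_preimage (_ : un \o row = id); last by apply/funext => z; exact: unK.
exact: (Foo i).2.
Qed.

HB.instance Definition _ := Measure_isSigmaFinite.Build _ _ _ next_measure next_sigma_finite.

Lemma ge0_integral_next (F : borelT R n.+1 -> \bar R) : measurable_fun setT F -> (forall x, 0 <= F x) ->
  \int[next_measure]_x F x = \int[leb]_t \int[mu]_y F (row (t, y)).
Proof.
move=> mF F0; have mFr : measurable_fun setT (F \o row).
  exact: (measurableT_comp mF (@measurable_rV_cons n)).
have <- := @fubini_tonelli1 _ _ _ _ R leb mu (F \o row) mFr (fun x => F0 _).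
have := @ge0_integral_pushforward _ _ _ _ R _ (@measurable_rV_cons n) (leb \x mu)%E setT F measurableT mF.
by move=> -> //; rewrite preimage_setT.
Qed.

End next_measure.

(** A bare iterated integral has no linearity, domination or exchange of variables. On nonnegative
    Borel integrands it is integration against one sigma-finite measure, which supplies all of
    them. *)
Lemma iint_measure n : exists mu : {sigma_finite_measure set (borelT R n) -> \bar R},
  forall F : 'rV[R]_n -> \bar R, measurable_fun (setT : set (borelT R n)) F ->
    (forall x, 0 <= F x)%E -> iint F = (\int[mu]_x F x)%E.
Proof.
elim: n => [|n [mu muE]].
  exists (dirac (0 : borelT R 0)) => F mF F0.
  by rewrite integral_dirac // diracT mul1e.
exists (next_measure mu) => F mF F0.
rewrite ge0_integral_next //=; apply: eq_integral => t _; rewrite muE //.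
apply: (measurableT_comp mF).
exact: (measurableT_comp (@measurable_rV_cons n) (measurable_pair1 t)).
Qed.

End borel_rV.

(** * Differential calculus in coordinates *)

Section partial_derivatives.
Context {R : realType} {n : nat}.
Implicit Types (f g : 'rV[R]_n -> R) (x : 'rV[R]_n) (i j : 'I_n).

(** [pd] is total and carries no information where the derivative fails to exist; the relation
    records existence together with the value. *)
Definition isPd i f x (d : R) : Prop :=
  is_derive (0 : R) (1 : R) (fun t : R => f (x + t *: evec R i)) d.

Lemma isPdE i f x d : isPd i f x d -> pd i f x = d.
Proof. by move=> h; rewrite /pd derive1E (@derive_val _ _ _ _ _ _ _ h). Qed.

Lemma derivable_isPd i f x :
  derivable (fun t : R => f (x + t *: evec R i)) 0 1 -> isPd i f x (pd i f x).
Proof. by move=> h; rewrite /isPd /pd derive1E; exact: derivableP. Qed.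

Lemma isPd_derivable i f x d : isPd i f x d ->
  derivable (fun t : R => f (x + t *: evec R i)) 0 1.
Proof. by move=> h; exact: (@ex_derive _ _ _ _ _ _ _ h). Qed.

Lemma isPd_eq i f x d d' : isPd i f x d -> d = d' -> isPd i f x d'.
Proof. by move=> h <-. Qed.

Lemma line_continuous x i : continuous (fun t : R => x + t *: evec R i).
Proof.
move=> t; apply: cvgD; first exact: cvg_cst.
by apply: cvgZr_tmp; exact: cvg_id.
Qed.

Lemma line_near x i (A : set 'rV[R]_n) : nbhs x A -> \forall t \near (0:R), A (x + t *: evec R i).
Proof.
move=> xA; have := @line_continuous x i 0 A; rewrite scale0r addr0; exact.
Qed.

Lemma isPd_near i f g x d : (\forall y \near x, f y = g y) -> isPd i f x d -> isPd i g x d.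
Proof. by move=> fg; apply: near_eq_is_derive; exact: (line_near i fg). Qed.

Lemma pd_near i f g x : (\forall y \near x, f y = g y) -> pd i f x = pd i g x.
Proof.
by move=> fg; rewrite /pd !derive1E; apply: near_eq_derive; exact: (line_near i fg).
Qed.

Lemma isPd_cst i (c : R) x : isPd i (fun _ => c) x 0.
Proof. exact: is_derive_cst. Qed.

Lemma isPdD i f g x df dg : isPd i f x df -> isPd i g x dg ->
  isPd i (fun y => f y + g y) x (df + dg).
Proof. by move=> hf hg; exact: is_deriveD. Qed.

Lemma isPdN i f x df : isPd i f x df -> isPd i (fun y => - f y) x (- df).
Proof. by move=> hf; exact: is_deriveN. Qed.

Lemma isPdB i f g x df dg : isPd i f x df -> isPd i g x dg ->
  isPd i (fun y => f y - g y) x (df - dg).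
Proof. by move=> hf hg; exact: isPdD hf (isPdN hg). Qed.

Lemma isPdM i f g x df dg : isPd i f x df -> isPd i g x dg ->
  isPd i (fun y => f y * g y) x (df * g x + f x * dg).
Proof.
move=> hf hg; have h := @is_deriveM _ _ _ _ _ _ _ _ hf hg.
apply: isPd_eq h _; rewrite scale0r addr0 addrC; congr (_ + _).
by rewrite /GRing.scale /= mulrC.
Qed.

Lemma isPdZ i c f x df : isPd i f x df -> isPd i (fun y => c * f y) x (c * df).
Proof.
by move=> hf; apply: isPd_eq (isPdM (isPd_cst i c x) hf) _; rewrite mul0r add0r.
Qed.

Lemma isPd_sum (I : Type) (s : seq I) (P : pred I) i (F : I -> 'rV[R]_n -> R) x dF :
  (forall k, P k -> isPd i (F k) x (dF k)) ->
  isPd i (fun y => \sum_(k <- s | P k) F k y) x (\sum_(k <- s | P k) dF k).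
Proof.
move=> h; elim: s => [|k s IH].
  by rewrite big_nil; under [X in isPd _ X]funext do rewrite big_nil; exact: isPd_cst.
rewrite big_cons; under [X in isPd _ X]funext do rewrite big_cons.
by case: ifPn => Pk //; apply: isPdD => //; exact: h.
Qed.

Lemma isPd_comp i (phi : R -> R) f x dphi df :
  is_derive (f x) (1:R) phi dphi -> isPd i f x df ->
  isPd i (fun y => phi (f y)) x (dphi * df).
Proof.
move=> hphi hf; rewrite /isPd.
apply: (@is_derive1_comp _ phi (fun t => f (x + t *: evec R i))) => //.
by rewrite scale0r addr0.
Qed.

Lemma coordE x i j (t : R) : (x + t *: evec R i) 0 j = x 0 j + t * (i == j)%:R.
Proof. by rewrite /evec !mxE eqxx /= eq_sym. Qed.

Lemma isPd_coord i j x : isPd i (fun y => y 0 j) x (i == j)%:R.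
Proof.
rewrite /isPd; under [X in is_derive _ _ X]funext do rewrite coordE.
have h := @is_deriveM _ _ _ _ (0:R) 1 _ _ (@is_derive_id R R 0 1)
  (@is_derive_cst R R R (i == j)%:R 0 1).
have := @is_deriveD _ _ _ _ _ (0:R) 1 _ _ (@is_derive_cst R R R (x 0 j) 0 1) h.
move/is_derive_eq; apply; rewrite /GRing.scale /=; ring.
Qed.

Lemma isPd_line i f x t d : isPd i f (x + t *: evec R i) d ->
  is_derive (t : R) (1 : R) (fun s : R => f (x + s *: evec R i)) d.
Proof.
move=> h.
have -> : (fun s : R => f (x + s *: evec R i)) =
    (fun s => f (x + t *: evec R i + s *: evec R i)) \o (fun s => s - t).
  by apply/funext => s /=; rewrite -addrA -scalerDl [t + _]addrC subrK.
rewrite -[d]mulr1; apply: is_derive1_comp; first by rewrite subrr.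
have := @is_deriveB R R R id (cst t) t 1 1 0 (is_derive_id _ _) (is_derive_cst _ _ _).
by rewrite subr0.
Qed.

Lemma MVT_line i f x (df : 'rV[R]_n -> R) (a : R) :
  (forall t, `|t| <= `|a| -> isPd i f (x + t *: evec R i) (df (x + t *: evec R i))) ->
  exists2 t, `|t| <= `|a| & f (x + a *: evec R i) - f x = df (x + t *: evec R i) * a.
Proof.
move=> h; pose F (t : R) := f (x + t *: evec R i).
pose dF (t : R) := df (x + t *: evec R i).
have hF (t : R) : `|t| <= `|a| -> is_derive t (1:R) F (dF t) by move=> ta; exact/isPd_line/h.
have F0 : F 0 = f x by rewrite /F scale0r addr0.
have cF (u v : R) : {in `[u, v], forall t, `|t| <= `|a|} -> {within `[u, v], continuous F}.
  move=> uv; apply: derivable_within_continuous => t /uv /hF ?; exact: ex_derive.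
have [a0|a0] := leP 0 a.
  have aa : {in `[0, a], forall t, `|t| <= `|a|}.
    by move=> t; rewrite in_itv /= => /andP[? ?]; rewrite !ger0_norm.
  have [|c ca e] := @MVT_segment _ F dF 0 a a0 _ (cF _ _ aa).
    by move=> t /subset_itv_oo_cc /aa /hF.
  by exists c; [exact: aa|move: e; rewrite F0 subr0].
have aa : {in `[a, 0], forall t, `|t| <= `|a|}.
  by move=> t; rewrite in_itv /= => /andP[? ?]; rewrite !ler0_norm ?lerN2 // ltW.
have [|c ca e] := @MVT_segment _ F dF a 0 (ltW a0) _ (cF _ _ aa).
  by move=> t /subset_itv_oo_cc /aa /hF.
exists c; first exact: aa.
by move: e; rewrite F0 /F /dF => e; rewrite -opprB e; ring.
Qed.

End partial_derivatives.

(** * Functions of class C^k on the whole space *)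

Section global_Ck.
Context {R : realType} {n : nat}.
Implicit Types (f g : 'rV[R]_n -> R) (x : 'rV[R]_n) (i j : 'I_n).

(** [Ck] quantifies over lists of derivatives; here the innermost derivative is peeled off instead,
    so that closure properties follow by induction on [k]. *)
Fixpoint CkT k f : Prop := continuous f /\
  if k is k'.+1 then forall i, (forall x, isPd i f x (pd i f x)) /\ CkT k' (pd i f) else True.

Lemma pds_rcons (s : seq 'I_n) i f : pds (rcons s i) f = pds s (pd i f).
Proof. by rewrite /pds -cats1 foldr_cat. Qed.

Lemma CkTP k f : Ck k setT f <-> CkT k f.
Proof.
elim: k f => [|k IH] f; split.
- by move=> h; split=> // x; have [] := h [::] isT x I.
- by move=> [cf _] [|//] _ x _; split => //; exact: cf.
- move=> h; split; first by move=> x; have [] := h [::] isT x I.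
  move=> i; split.
    by move=> x; apply: derivable_isPd; have [_ ] := h [::] isT x I; apply.
  apply/IH => s sk x _; have := h (rcons s i); rewrite size_rcons ltnS => /(_ sk x I).
  by rewrite pds_rcons.
move=> [cf h] s; case: (lastP s) => [|s' i].
  move=> _ x _; split; first exact: cf.
  by move=> _ i; apply: isPd_derivable; exact: ((h i).1 x).
rewrite size_rcons ltnS => sk x _; rewrite pds_rcons ltnS.
by have /IH := (h i).2; apply.
Qed.

Lemma CkT_continuous k f : CkT k f -> continuous f.
Proof. by case: k => [|k] []. Qed.

Lemma CkT_isPd k f i x : CkT k.+1 f -> isPd i f x (pd i f x).
Proof. by case=> _ /(_ i) []. Qed.

Lemma CkT_pd k f i : CkT k.+1 f -> CkT k (pd i f).
Proof. by case=> _ /(_ i) []. Qed.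

Lemma CkTW k f : CkT k.+1 f -> CkT k f.
Proof.
elim: k f => [|k IH] f [cf h]; first by split.
split => // i; split; first exact: (h i).1.
by apply: IH; exact: (h i).2.
Qed.

Lemma CkT_cst k (c : R) : CkT k (fun _ => c).
Proof.
elim: k c => [|k IH] c; split; try exact: cst_continuous; first by [].
move=> i; have E : pd i (fun _ : 'rV[R]_n => c) = fun _ => 0.
  by apply/funext => x; apply: isPdE; exact: isPd_cst.
by rewrite E; split => // x; exact: isPd_cst.
Qed.

Lemma CkT_coord k j : CkT k (fun x => x 0 j).
Proof.
case: k => [|k]; split; try exact: coord_continuous; first by [].
move=> i; have E : pd i (fun x => x 0 j) = fun _ => (i == j)%:R :> R.
  by apply/funext => x; apply: isPdE; exact: isPd_coord.
by rewrite E; split; [move=> x; exact: isPd_coord|exact: CkT_cst].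
Qed.

Lemma CkTD k f g : CkT k f -> CkT k g -> CkT k (fun x => f x + g x).
Proof.
elim: k f g => [|k IH] f g [cf hf] [cg hg]; split => //.
1,2: by move=> x; exact: (cvgD (cf x) (cg x)).
move=> i; have [df cdf] := hf i; have [dg cdg] := hg i.
have E x := isPdD (df x) (dg x).
have -> : pd i (fun x => f x + g x) = fun x => pd i f x + pd i g x.
  by apply/funext => x; exact: isPdE.
by split=> //; exact: IH.
Qed.

Lemma CkTM k f g : CkT k f -> CkT k g -> CkT k (fun x => f x * g x).
Proof.
elim: k f g => [|k IH] f g hhf hhg; have [cf hf] := hhf; have [cg hg] := hhg; split => //.
1,2: by move=> x; exact: (cvgM (cf x) (cg x)).
move=> i; have [df cdf] := hf i; have [dg cdg] := hg i.
have E x := isPdM (df x) (dg x).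
have -> : pd i (fun x => f x * g x) = fun x => pd i f x * g x + f x * pd i g x.
  by apply/funext => x; exact: isPdE.
by split=> //; apply: CkTD; apply: IH => //; exact: CkTW.
Qed.

Lemma CkTZ k c f : CkT k f -> CkT k (fun x => c * f x).
Proof. by move=> hf; apply: CkTM => //; exact: CkT_cst. Qed.

Lemma CkTN k f : CkT k f -> CkT k (fun x => - f x).
Proof.
by move=> /(CkTZ (-1)); under [X in CkT _ X -> _]funext do rewrite mulN1r.
Qed.

Lemma CkTB k f g : CkT k f -> CkT k g -> CkT k (fun x => f x - g x).
Proof. by move=> hf hg; apply: CkTD => //; exact: CkTN. Qed.

Lemma CkT_sum k (I : Type) (s : seq I) (P : pred I) (F : I -> 'rV[R]_n -> R) :
  (forall a, P a -> CkT k (F a)) -> CkT k (fun x => \sum_(a <- s | P a) F a x).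
Proof.
move=> h; elim: s => [|a s IH].
  by under [X in CkT _ X]funext do rewrite big_nil; exact: CkT_cst.
rewrite (_ : (fun _ => _) = if P a then (fun x => F a x + \sum_(b <- s | P b) F b x)
  else fun x => \sum_(b <- s | P b) F b x).
  by case: ifPn => Pa; [apply: CkTD => //; exact: h|].
by apply/funext => x; rewrite big_cons; case: ifP.
Qed.

(* Stated for a family so that the induction on [k] closes: the derivative of [flat m] is a
   combination of [flat m.+1] and [flat m.+2]. *)
Lemma CkT_comp (phi : nat -> R -> R) (c1 c2 : nat -> R) (m1 m2 : nat -> nat) :
  (forall m t, is_derive t (1:R) (phi m) (c1 m * phi (m1 m) t + c2 m * phi (m2 m) t)) ->
  forall k m f, CkT k f -> CkT k (fun x => phi m (f x)).
Proof.
move=> dphi; have cphi m : continuous (phi m).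
  move=> t; apply: differentiable_continuous; apply/derivable1_diffP.
  by have := dphi m t => ?; exact: ex_derive.
elim=> [|k IH] m f hhf; have [cf hf] := hhf; split => //.
1,2: by move=> x; apply: continuous_comp; [exact: cf|exact: cphi].
move=> i; have [df cdf] := hf i.
have E x := isPd_comp (dphi m (f x)) (df x).
have -> : pd i (fun x => phi m (f x)) =
   fun x => (c1 m * phi (m1 m) (f x) + c2 m * phi (m2 m) (f x)) * pd i f x.
  by apply/funext => x; exact: isPdE.
split=> //; apply: CkTM => //; apply: CkTD; apply: CkTZ; apply: IH; exact: CkTW.
Qed.

Lemma CkT_expR k f : CkT k f -> CkT k (fun x => expR (f x)).
Proof.
apply: (@CkT_comp (fun=> expR) (fun=> 1) (fun=> 0) (fun=> 0%N) (fun=> 0%N) _ k 0%N).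
by move=> _ t; rewrite mul1r mul0r addr0; exact: is_derive_expR.
Qed.

End global_Ck.

(** * Smooth functions flat at zero *)

Section flat_function.
Context {R : realType}.

Definition flat (k : nat) (t : R) : R := if 0 < t then t^-1 ^+ k * expR (- t^-1) else 0.

(** The [m]-th power of y / m <= exp (y / m). *)
Lemma expR_ge_pow (m : nat) (y : R) : 0 <= y -> y ^+ m <= m%:R ^+ m * expR y.
Proof.
case: m => [|m] y0; first by rewrite !expr0 mul1r; apply: le_trans (expR_ge1Dx y); lra.
set M : R := m.+1%:R; have M0 : 0 < M by rewrite ltr0n.
have -> : expR y = expR (y / M) ^+ m.+1.
  by rewrite -expRM_natl mulrC divfK // gt_eqF.
rewrite -exprMn.
apply: lerXn2r; rewrite ?nnegrE //; first by rewrite mulr_ge0 ?expR_ge0 // ltW.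
by rewrite -ler_pdivrMl // mulrC; apply: le_trans (expR_ge1Dx _); rewrite lerDr.
Qed.

(** Obtained from [expR_ge_pow] at 1 / t. Used with [k.+1]: for h > 0 the difference quotient of
    [flat k] at 0 is [flat k.+1 h], which therefore tends to 0. *)
Lemma flat_le k : exists2 C : R, 0 < C & forall t, `|flat k t| <= C * `|t|.
Proof.
exists (k.+1%:R ^+ k.+1) => [|t]; first by rewrite exprn_gt0 // ltr0n.
rewrite /flat; case: (ltP 0 t) => t0; last by rewrite normr0 mulr_ge0 // exprn_ge0.
rewrite ger0_norm; last by rewrite mulr_ge0 ?exprn_ge0 ?expR_ge0 ?invr_ge0 ?(ltW t0).
rewrite (gtr0_norm t0) expRN ler_pdivrMr ?expR_gt0 //.
have := @expR_ge_pow k.+1 t^-1; rewrite invr_ge0 (ltW t0) => /(_ isT).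
by rewrite exprSr ler_pdivrMr // mulrAC.
Qed.

Lemma is_derive_flat k (t : R) :
  is_derive t (1:R) (flat k) (1 * flat k.+2 t + (- k%:R) * flat k.+1 t).
Proof.
have [t0|t0|->] := ltgtP t 0.
- have -> : 1 * flat k.+2 t + (- k%:R) * flat k.+1 t = 0.
    by rewrite /flat ltNge (ltW t0) /= !mulr0 addr0.
  apply: near_eq_is_derive (@is_derive_cst R R R 0 t 1).
  near=> u; rewrite /flat /cst; case: ifPn => // u0.
  suff: u < 0 by rewrite ltNge (ltW u0).
  by near: u; exact: lt_nbhsl.
- pose F (u : R) := u^-1 ^+ k * expR (- u^-1).
  have tn0 : t != 0 by rewrite gt_eqF.
  have dI : is_derive t (1:R) (fun u : R => u^-1) (- t ^- 2 *: 1).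
    by apply: is_deriveV => //; exact: is_derive_id.
  have dX := @is_deriveX _ _ _ k _ _ _ dI; rewrite exprfctE in dX.
  have dE : is_derive t (1:R) (fun u => expR (- u^-1)) (expR (- t^-1) * (- (- t ^- 2 *: 1))).
    apply: (@is_derive1_comp _ expR (fun u => - u^-1)); exact: is_deriveN.
  have dF := is_deriveM dX dE.
  have -> : 1 * flat k.+2 t + (- k%:R) * flat k.+1 t =
    (t^-1 ^+ k *: (expR (- t^-1) * (- (- t ^- 2 *: 1)))
     + expR (- t^-1) *: ((k%:R * t^-1 ^+ k.-1) *: (- t ^- 2 *: 1))).
    rewrite /flat t0 /GRing.scale /= -exprVn !mulr1 !exprS expr0 mulr1.
    by case: (k) => [|k'] /=; rewrite ?mul0r ?mulr0 ?exprS; ring.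
  apply: near_eq_is_derive dF.
  near=> u; rewrite /flat /F ifT //.
  by near: u; exact: lt_nbhsr.
have -> : 1 * flat k.+2 0 + (- k%:R) * flat k.+1 0 = 0 :> R.
  by rewrite /flat ltxx !mulr0 addr0.
have [C C0 hC] := flat_le k.+1.
have h : h^-1 *: (flat k (h *: 1 + 0) - flat k 0) @[h --> (0:R)^'] --> (0:R).
  apply/cvgr0Pnorm_lt => e e0; near=> h.
  have E : `|h^-1 *: (flat k (h *: 1 + 0) - flat k 0)| <= C * `|h|.
    apply: le_trans (hC h); rewrite addr0 /flat ltxx subr0 /GRing.scale /= mulr1.
    case: (ltP 0 h) => h0; last by rewrite mulr0 normr0.
    by rewrite exprS mulrA.
  apply: le_lt_trans E _; rewrite -ltr_pdivlMl // mulrC.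
  near: h; apply: dnbhs0_lt; exact: divr_gt0.
split; first by apply/cvg_ex; exists 0.
by apply: cvg_lim => //; exact: h.
Unshelve. all: by end_near. Qed.

Lemma CkT_flat n k m (f : 'rV[R]_n -> R) : CkT k f -> CkT k (fun x => flat m (f x)).
Proof. by move: k m f; apply: CkT_comp => m t; exact: is_derive_flat. Qed.

End flat_function.

(** * Boxes and the squared distance *)

Section boxes.
Context {R : realType} {n : nat}.
Implicit Types (f g : 'rV[R]_n -> R) (x : 'rV[R]_n) (i j : 'I_n).

(** Closed ball of the sup norm. Boxes suit coordinatewise arguments and have an explicit volume;
    supports are measured with the smooth function [sqdist] instead. *)
Definition box x0 (a : R) : set 'rV[R]_n := [set x | forall j, `|x 0 j - x0 0 j| <= a].

Definition sqdist x0 x : R := \sum_j (x 0 j - x0 0 j) ^+ 2.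

Lemma nbhs_box x0 (A : set 'rV[R]_n) : nbhs x0 A -> exists2 e : R, 0 < e & box x0 e `<=` A.
Proof.
move=> /nbhs_ballP[e /= e0 eA]; exists (e / 2); first by rewrite divr_gt0.
move=> x xb; apply: eA; rewrite /ball /=; split => // i j; rewrite (ord1 i) /ball /= distrC.
by apply: le_lt_trans (xb j) _; rewrite ltr_pdivrMr // ltr_pMr // ltr1n.
Qed.

Lemma box_le x0 a b : a <= b -> box x0 a `<=` box x0 b.
Proof. by move=> ab x xa j; apply: le_trans (xa j) ab. Qed.

Lemma sqdist_ge0 x0 x : 0 <= sqdist x0 x.
Proof. by apply: sumr_ge0 => j _; exact: sqr_ge0. Qed.

Lemma sqdist_xx x0 : sqdist x0 x0 = 0.
Proof. by apply: big1 => j _; rewrite subrr expr0n. Qed.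

Lemma coord_sqdist x0 x j : (x 0 j - x0 0 j) ^+ 2 <= sqdist x0 x.
Proof. by rewrite /sqdist (bigD1 j) //= lerDl; apply: sumr_ge0 => k _; exact: sqr_ge0. Qed.

Lemma sqdist_box x0 x a : 0 <= a -> sqdist x0 x <= a ^+ 2 -> box x0 a x.
Proof.
move=> a0 h j; rewrite -(@ler_pXn2r _ 2) ?nnegrE // real_normK ?num_real //.
exact: le_trans (coord_sqdist _ _ _) h.
Qed.

Lemma CkT_coordB k x0 j : CkT k (fun x => x 0 j - x0 0 j).
Proof. by apply: CkTB; [exact: CkT_coord|exact: CkT_cst]. Qed.

Lemma isPd_coordB x0 i j x : isPd i (fun x => x 0 j - x0 0 j) x (i == j)%:R.
Proof. by apply: isPd_eq (isPdB (isPd_coord i j x) (isPd_cst i _ x)) _; rewrite subr0. Qed.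

Lemma CkT_sqdist k x0 : CkT k (sqdist x0).
Proof. by apply: CkT_sum => j _; apply: CkTM; exact: CkT_coordB. Qed.

Lemma isPd_sqdist x0 i x : isPd i (sqdist x0) x (2 * (x 0 i - x0 0 i)).
Proof.
have h := isPd_sum (index_enum _) (fun j _ => isPdM (isPd_coordB x0 i j x) (isPd_coordB x0 i j x)).
apply: isPd_eq (h predT) _; rewrite (bigD1 i) //= eqxx big1 => [|j]; last first.
  by rewrite eq_sym => /negbTE ->; rewrite mul0r mulr0 addr0.
by rewrite !mulr1n addr0; ring.
Qed.

Lemma sqdist_continuous x0 : continuous (sqdist x0).
Proof. exact: CkT_continuous (CkT_sqdist 0 x0). Qed.

Lemma compact_sqdist_le x0 (a : R) : compact [set x | sqdist x0 x <= a].
Proof.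
apply: bounded_closed_compact; last first.
  apply: (@closed_comp _ _ (sqdist x0) [set y | y <= a]).
    by move=> x _; exact: sqdist_continuous.
  exact: closed_le.
pose b := 1 + `|a|; have b0 : 0 <= b by rewrite addr_ge0.
have ab : a <= b ^+ 2.
  have ha := ler_norm a; have ha0 := normr_ge0 a; rewrite /b; move: ha ha0.
  by move: `|a| => c; nra.
have [M Mx M1] : exists2 M, forall j, `|x0 0 j| <= M & 0 <= M.
  exists (\sum_j `|x0 0 j|) => [j|]; last exact: sumr_ge0.
  by rewrite (bigD1 j) //= lerDl; exact: sumr_ge0.
exists (b + M); split; first exact: num_real.
move=> c Mc x /= xa.
have -> : `|x| = mx_norm x by [].
have c0 : 0 <= c by apply: le_trans (ltW Mc); exact: addr_ge0.
rewrite mx_normrE; apply: bigmax_le => [//|[i j] _] /=.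
rewrite (ord1 i); apply: le_trans (ltW Mc).
rewrite -[x 0 j](subrK (x0 0 j)); apply: le_trans (ler_normD _ _) _.
by apply: lerD => //; apply: (sqdist_box b0); apply: le_trans ab.
Qed.

End boxes.

Local Opaque pd.

(** * Symmetry of second derivatives and the Taylor remainder *)

Section second_order.
Context {R : realType} {n : nat}.
Implicit Types (f g : 'rV[R]_n -> R) (x : 'rV[R]_n) (i j : 'I_n).

(* Moves from [x0] to [x] one coordinate at a time. *)
Lemma box_mean_value f (df : 'I_n -> 'rV[R]_n -> R) x0 (a C : R) :
  0 <= a -> 0 <= C -> f x0 = 0 ->
  (forall x j, box x0 a x -> isPd j f x (df j x) /\ `|df j x| <= C) ->
  forall x, box x0 a x -> `|f x| <= n%:R * (C * a).
Proof.
move=> a0 C0 f0 hf x xa.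
pose y (m : nat) : 'rV[R]_n := \row_j (if (j < m)%N then x 0 j else x0 0 j).
have yn : y n = x by apply/rowP => j; rewrite mxE ltn_ord.
have y0 : y 0%N = x0 by apply/rowP => j; rewrite mxE.
suff H m : (m <= n)%N -> `|f (y m)| <= m%:R * (C * a) by rewrite -yn; exact: H.
elim: m => [|m IH] mn; first by rewrite y0 f0 normr0 mul0r.
pose i := Ordinal mn; pose d := x 0 i - x0 0 i.
have yS : y m.+1 = y m + d *: evec R i.
  apply/rowP => j; rewrite coordE !mxE ltnS leq_eqVlt.
  have -> : (i == j) = (j == m :> nat) by rewrite eq_sym.
  case: eqP => [jm|_] /=; last by rewrite mulr0 addr0.
  rewrite jm ltnn mulr1 (_ : j = i); last exact/val_inj.
  by rewrite /d addrC subrK.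
have lineb t : `|t| <= `|d| -> box x0 a (y m + t *: evec R i).
  move=> td j; rewrite coordE mxE; case: ltnP => jm.
    have -> : (i == j) = false by apply/eqP => ij; move: jm; rewrite -ij ltnn.
    by rewrite mulr0 addr0; exact: xa.
  rewrite addrAC subrr add0r normrM; case: (i == j); last by rewrite normr0 mulr0.
  by rewrite normr1 mulr1; apply: le_trans td (xa i).
have [t /lineb tb e] := @MVT_line _ _ i f (y m) (df i) d (fun t ht => (hf _ i (lineb t ht)).1).
have -> : f (y m.+1) = f (y m) + df i (y m + t *: evec R i) * d.
  by rewrite yS -e [RHS]addrC subrK.
apply: le_trans (ler_normD _ _) _; rewrite -natr1 mulrDl mul1r.
apply: lerD; first exact/IH/ltnW.
rewrite normrM ler_pM //; first exact: (hf _ i tb).2.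
exact: xa.
Qed.

Lemma Ck2_isPd (D : set 'rV[R]_n) f x i : Ck 2 D f -> D x -> isPd i f x (pd i f x).
Proof. by move=> h Dx; apply: derivable_isPd; exact: ((h [::] isT x Dx).2 isT i). Qed.

Lemma Ck2_isPd2 (D : set 'rV[R]_n) f x i j : Ck 2 D f -> D x ->
  isPd i (pd j f) x (pd i (pd j f) x).
Proof. by move=> h Dx; apply: derivable_isPd; exact: ((h [:: j] isT x Dx).2 isT i). Qed.

Lemma Ck2_continuous (D : set 'rV[R]_n) f x : Ck 2 D f -> D x -> {for x, continuous f}.
Proof. by move=> h Dx; exact: (h [::] isT x Dx).1. Qed.

Lemma Ck2_continuous2 (D : set 'rV[R]_n) f x i j : Ck 2 D f -> D x ->
  {for x, continuous (pd i (pd j f))}.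
Proof. by move=> h Dx; exact: (h [:: i; j] isT x Dx).1. Qed.

Lemma continuous_box (f : 'rV[R]_n -> R) x0 (e : R) : {for x0, continuous f} -> 0 < e ->
  exists2 a : R, 0 < a & forall x, box x0 a x -> `|f x - f x0| < e.
Proof.
move=> cf e0; apply: nbhs_box.
have /cvgrPdist_lt /(_ _ e0) := cf.
by apply: filterS => x; rewrite distrC.
Qed.

(** The mean value theorem in direction [i] for the increment of [f] in direction [j], followed by
    the one in direction [j] for [pd i f]. *)
Lemma second_difference (D : set 'rV[R]_n) f x0 i j (a : R) : Ck 2 D f -> 0 < a ->
  box x0 (2 * a) `<=` D ->
  exists2 p, box x0 (2 * a) p &
    f (x0 + a *: evec R i + a *: evec R j) - f (x0 + a *: evec R i)
    - (f (x0 + a *: evec R j) - f x0) = pd j (pd i f) p * a * a.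
Proof.
move=> cf a0 bD.
have bx s t : `|s| <= `|a| -> `|t| <= `|a| -> box x0 (2 * a) (x0 + s *: evec R i + t *: evec R j).
  rewrite (gtr0_norm a0) => sa ta k; rewrite !coordE.
  rewrite (_ : _ - _ = s * (i == k)%:R + t * (j == k)%:R); last by ring.
  apply: le_trans (ler_normD _ _) _; rewrite mulr_natl mulr2n !normrM.
  by apply: lerD; case: (_ == k); rewrite ?normr1 ?mulr1 ?normr0 ?mulr0 // ltW.
have a00 : `|0 : R| <= `|a| by rewrite normr0.
pose F x := f (x + a *: evec R j) - f x.
pose dF x := pd i f (x + a *: evec R j) - pd i f x.
have hF t : `|t| <= `|a| -> isPd i F (x0 + t *: evec R i) (dF (x0 + t *: evec R i)).
  move=> ta; apply: isPdB.
    have := Ck2_isPd i cf (bD _ (bx _ _ ta (lexx _))).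
    rewrite /isPd; set G1 := fun t0 => _; set G2 := fun t0 => _.
    have -> // : G1 = G2 by apply/funext => u; rewrite /G1 /G2 addrAC.
  by apply: (Ck2_isPd i cf); apply: bD; have := bx _ _ ta a00; rewrite scale0r addr0.
have [t ta] := MVT_line hF.
rewrite /F /dF => ->.
have [t' ta' ->] := @MVT_line _ _ j (pd i f) (x0 + t *: evec R i) (pd j (pd i f)) a
  (fun t' ht' => Ck2_isPd2 j i cf (bD _ (bx _ _ ta ht'))).
by exists (x0 + t *: evec R i + t' *: evec R j); first exact: bx.
Qed.

Lemma dist_le_halves (e A B u v : R) :
  A = B -> `|A - u| < e / 2 -> `|B - v| < e / 2 -> `|v - u| <= e.
Proof.
move=> -> hu hv; rewrite (_ : v - u = (B - u) - (B - v)); last by ring.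
by apply: le_trans (ler_normB _ _) _; lra.
Qed.

(** The second difference is symmetric in the two directions, so the two mixed derivatives take a
    common value at two points of an arbitrarily small box; continuity at [x0] concludes. *)
Lemma pd_sym (D : set 'rV[R]_n) f x0 i j : open D -> Ck 2 D f -> D x0 ->
  pd i (pd j f) x0 = pd j (pd i f) x0.
Proof.
move=> oD cf Dx0; apply/eqP; rewrite -subr_eq0 -normr_le0; apply/ler_addgt0Pl => e e0.
have e2 : 0 < e / 2 by rewrite divr_gt0.
have [b b0 bD] : exists2 b : R, 0 < b & box x0 b `<=` D.
  by apply: nbhs_box; exact: open_nbhs_nbhs.
have [c c0 hc] := continuous_box (@Ck2_continuous2 D f x0 i j cf Dx0) e2.
have [d d0 hd] := continuous_box (@Ck2_continuous2 D f x0 j i cf Dx0) e2.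
pose a := Num.min b (Num.min c d) / 2.
have a0 : 0 < a by rewrite divr_gt0 // !lt_min b0 c0 d0.
have a2 : 2 * a = Num.min b (Num.min c d) by rewrite mulrC divfK.
have ab : box x0 (2 * a) `<=` box x0 b by apply: box_le; rewrite a2 ge_min lexx.
have ac : box x0 (2 * a) `<=` box x0 c by apply: box_le; rewrite a2 !ge_min lexx orbT.
have ad : box x0 (2 * a) `<=` box x0 d by apply: box_le; rewrite a2 !ge_min lexx !orbT.
have aD : box x0 (2 * a) `<=` D by apply: subset_trans ab bD.
have [p pb ep] := second_difference i j cf a0 aD.
have [p' pb' ep'] := second_difference j i cf a0 aD.
have E : pd j (pd i f) p = pd i (pd j f) p'.
  apply: (@mulIf _ a); first by rewrite gt_eqF.
  apply: (@mulIf _ a); first by rewrite gt_eqF.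
  apply: etrans (esym ep) _; apply: etrans ep'; rewrite (addrAC x0 (a *: evec R j)).
  move: (f (_ + _ + _)) (f (x0 + a *: evec R i)) (f (x0 + a *: evec R j)) (f x0) => u v w z.
  by ring.
have h1 := hd _ (ad _ pb); have h2 := hc _ (ac _ pb'); rewrite addr0.
exact: dist_le_halves E h1 h2.
Qed.

(** The mean value estimate used twice on the box of radius s = |x - x0|: second derivatives below d
    give first derivatives below n d s and a function below n^2 d s^2. The [+ 1] in the choice of d
    covers n = 0. *)
Lemma taylor_remainder (D : set 'rV[R]_n) f (f1 : 'I_n -> 'rV[R]_n -> R)
    (f2 : 'I_n -> 'I_n -> 'rV[R]_n -> R) x0 : open D -> D x0 ->
  (forall x i, D x -> isPd i f x (f1 i x)) ->
  (forall x i j, D x -> isPd j (f1 i) x (f2 i j x)) ->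
  (forall i j, {for x0, continuous (f2 i j)}) ->
  f x0 = 0 -> (forall i, f1 i x0 = 0) -> (forall i j, f2 i j x0 = 0) ->
  forall e : R, 0 < e -> exists2 a : R, 0 < a &
    forall x, sqdist x0 x <= a ^+ 2 -> `|f x| <= e * sqdist x0 x.
Proof.
move=> oD Dx0 df1 df2 cf2 f0 f10 f20 e e0.
pose d := e / (n%:R * n%:R + 1).
have n0 : 0 < n%:R * n%:R + 1 :> R by rewrite ltr_wpDl // mulr_ge0.
have d0 : 0 < d by rewrite divr_gt0.
have [b b0 bD] : exists2 b : R, 0 < b & box x0 b `<=` D.
  by apply: nbhs_box; exact: open_nbhs_nbhs.
have /choice [c cP] : forall ij : 'I_n * 'I_n, exists c : R, 0 < c /\
    forall x, box x0 c x -> `|f2 ij.1 ij.2 x| <= d.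
  move=> [i j]; have [c c0 hc] := continuous_box (cf2 i j) d0.
  by exists c; split => // x /hc; rewrite f20 subr0 => /ltW.
pose a := \big[Num.min/b]_ij c ij.
have a0 : 0 < a by rewrite /a; elim/big_ind: _ => // [u v|ij _]; [rewrite lt_min => -> ->|exact: (cP ij).1].
have ab : a <= b by exact: bigmin_le_id.
have ac ij : a <= c ij by exact: bigmin_le_cond.
exists a => // x xa.
pose s := Num.sqrt (sqdist x0 x).
have s0 : 0 <= s by exact: sqrtr_ge0.
have s2 : s ^+ 2 = sqdist x0 x by rewrite sqr_sqrtr // sqdist_ge0.
have sa : s <= a by rewrite -(@ler_pXn2r _ 2) ?nnegrE ?s2 // ltW.
have bs : box x0 s `<=` box x0 a by exact: box_le.
have bsD : box x0 s `<=` D by apply: subset_trans (box_le sa) (subset_trans (box_le ab) bD).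
have h1 i y : box x0 s y -> `|f1 i y| <= n%:R * (d * s).
  move: y; apply: (@box_mean_value (f1 i) (f2 i) x0 s d s0 (ltW d0) (f10 i)).
  move=> y j ys; split; first exact: df2 (bsD _ ys).
  have [_ hcij] := cP (i, j); apply: hcij.
  exact: (box_le (ac (i, j)) (bs _ ys)).
have nds : 0 <= n%:R * (d * s) by rewrite !mulr_ge0 // ltW.
have h2 := @box_mean_value f f1 x0 s _ s0 nds f0 (fun y j ys =>
  conj (df1 y j (bsD _ ys)) (h1 j y ys)) x.
apply: le_trans (h2 _) _; first by apply: sqdist_box => //; rewrite s2.
rewrite -s2 (_ : _ * _ = n%:R * n%:R * d * s ^+ 2); last by ring.
rewrite ler_wpM2r ?sqr_ge0 // /d mulrA ler_pdivrMr // mulrC ler_wpM2l ?(ltW e0) //.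
by rewrite lerDl.
Qed.

End second_order.

(** * Integration by parts *)

Section lebesgue_rV.
Context {R : realType}.

Definition lebn n : {sigma_finite_measure set (borelT R n) -> \bar R} :=
  projT1 (cid (@iint_measure R n)).

Lemma iintE n (F : 'rV[R]_n -> \bar R) : measurable_fun (setT : set (borelT R n)) F ->
  (forall x, 0 <= F x)%E -> iint F = (\int[lebn n]_x F x)%E.
Proof. exact: projT2 (cid (@iint_measure R n)) F. Qed.

Lemma integral_lebnS n (F : 'rV[R]_n.+1 -> \bar R) :
  measurable_fun (setT : set (borelT R n.+1)) F -> (forall x, 0 <= F x)%E ->
  (\int[lebn n.+1]_x F x = \int[@lebesgue_measure R]_t \int[lebn n]_y F (rV_cons t y))%E.
Proof.
move=> mF F0; rewrite -iintE //=; apply: eq_integral => t _; rewrite iintE //.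
apply: (measurableT_comp mF).
exact: (measurableT_comp (@measurable_rV_cons R n) (measurable_pair1 t)).
Qed.

Lemma integral_lebnS_swap n (F : 'rV[R]_n.+1 -> \bar R) :
  measurable_fun (setT : set (borelT R n.+1)) F -> (forall x, 0 <= F x)%E ->
  (\int[lebn n.+1]_x F x = \int[lebn n]_y \int[@lebesgue_measure R]_t F (rV_cons t y))%E.
Proof.
move=> mF F0; rewrite integral_lebnS //.
pose G (z : measurableTypeR R * borelT R n) := F (rV_cons z.1 z.2).
have mG : measurable_fun setT G by exact: (measurableT_comp mF (@measurable_rV_cons R n)).
exact: (@sfinite_Fubini _ _ _ _ R (@lebesgue_measure R) (lebn n) G (fun z => F0 _) mG).
Qed.

Lemma measurable_box n x0 (a : R) : measurable (box x0 a : set (borelT R n)).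
Proof.
have -> : box x0 a = \bigcap_(j in [set: 'I_n])
   ((fun y : borelT R n => (y : 'rV[R]_n) 0 j) @^-1` [set z | `|z - x0 0 j| <= a]).
  by apply/seteqP; split => x /= h j; [move=> _; exact: h|exact: h].
apply: fin_bigcap_measurable; first exact: finite_finset.
move=> j _; rewrite -[X in measurable X]setTI; apply: measurable_coord => //.
have -> : [set z : R | `|z - x0 0 j| <= a] = `[x0 0 j - a, x0 0 j + a]%classic.
  apply/seteqP; split => z; rewrite /= in_itv /= ler_norml.
    by move=> /andP[h1 h2]; apply/andP; split; lra.
  by move=> /andP[h1 h2]; apply/andP; split; lra.
exact: measurable_itv.
Qed.

Lemma lebn_indic n (A : set (borelT R n)) : measurable A ->
  (lebn n A = \int[lebn n]_x (\1_A x)%:E)%E.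
Proof. by move=> mA; rewrite integral_indic // setIT. Qed.

Lemma measurable_indic_box n x0 (a : R) :
  measurable_fun (setT : set (borelT R n)) (fun x => (\1_(box x0 a) x : R)%:E).
Proof. by apply/measurable_EFinP; exact: measurable_indic (measurable_box _ _). Qed.

Lemma lebn_box n (x0 : 'rV[R]_n) (a : R) : 0 < a -> lebn n (box x0 a) = ((2 * a) ^+ n)%:E.
Proof.
move=> a0; elim: n x0 => [|n IH] x0.
  rewrite (lebn_indic (measurable_box x0 a)) -iintE //=; last exact: measurable_indic_box.
  by rewrite indicE mem_set // => -[].
rewrite (lebn_indic (measurable_box x0 a)) integral_lebnS //; last exact: measurable_indic_box.
pose y0 : 'rV[R]_n := \row_j x0 0 (lift ord0 j).
have E t y : (\1_(box x0 a) (rV_cons t y))%:E =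
    ((\1_(`[x0 0 ord0 - a, x0 0 ord0 + a]%classic) t)%:E * (\1_(box y0 a) y)%:E)%E.
  rewrite -EFinM !indicE -natrM mulnb; congr (_%:R%:E); congr nat_of_bool.
  apply/idP/andP => [|[]]; rewrite !inE /= in_itv /=.
    move=> h; split.
      have := h ord0; rewrite rV_cons0 ler_norml => /andP[h1 h2]; apply/andP; split; lra.
    by move=> j; have := h (lift ord0 j); rewrite rV_consS mxE.
  move=> /andP[h1 h2] h j; case: (unliftP ord0 j) => [k|] ->.
    by have := h k; rewrite rV_consS mxE.
  rewrite rV_cons0 ler_norml; apply/andP; split; lra.
under eq_integral => t _ do under eq_integral => y _ do rewrite E.
under eq_integral => t _.
  rewrite ge0_integralZl //; last exact: measurable_indic_box.
  rewrite -(lebn_indic (measurable_box y0 a)) IH.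
  over.
rewrite ge0_integralZr //; first last.
- by rewrite lee_fin exprn_ge0 // mulr_ge0 // ltW.
- by apply/measurable_EFinP; exact: measurable_indic.
rewrite integral_indic //= setIT lebesgue_measure_itv /= lte_fin ifT; last by lra.
by rewrite -EFinB -EFinM exprS; congr (_%:E); congr (_ * _); ring.
Qed.

Definition intg n (F : 'rV[R]_n -> R) : Prop := (lebn n).-integrable setT (EFin \o F).
Definition Int n (F : 'rV[R]_n -> R) : R := (\int[lebn n]_x F x)%R.

Section linearity.
Context {n : nat}.
Implicit Types F G : 'rV[R]_n -> R.

Lemma intg_eq F G : (forall x, F x = G x) -> intg F -> intg G.
Proof. by move=> /funext ->. Qed.

Lemma Int_eq F G : (forall x, F x = G x) -> Int F = Int G.
Proof. by move=> /funext ->. Qed.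

Lemma intgD F G : intg F -> intg G -> intg (fun x => F x + G x).
Proof. by move=> hF hG; have := integrableD measurableT hF hG. Qed.

Lemma intgZ c F : intg F -> intg (fun x => c * F x).
Proof. by move=> hF; have := integrableZl measurableT c hF. Qed.

Lemma intgN F : intg F -> intg (fun x => - F x).
Proof. by move=> /(intgZ (-1)); apply: intg_eq => x; rewrite mulN1r. Qed.

Lemma intgB F G : intg F -> intg G -> intg (fun x => F x - G x).
Proof. by move=> hF hG; apply: intgD => //; exact: intgN. Qed.

Lemma IntD F G : intg F -> intg G -> Int (fun x => F x + G x) = Int F + Int G.
Proof. by move=> hF hG; rewrite /Int RintegralD. Qed.

Lemma IntZ c F : intg F -> Int (fun x => c * F x) = c * Int F.
Proof. by move=> hF; rewrite /Int RintegralZl. Qed.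

Lemma IntN F : intg F -> Int (fun x => - F x) = - Int F.
Proof.
move=> hF; rewrite -mulN1r -IntZ //; by apply: Int_eq => x; rewrite mulN1r.
Qed.

Lemma IntB F G : intg F -> intg G -> Int (fun x => F x - G x) = Int F - Int G.
Proof. by move=> hF hG; rewrite IntD ?IntN //; exact: intgN. Qed.

Lemma Int_le F G : intg F -> intg G -> (forall x, F x <= G x) -> Int F <= Int G.
Proof. by move=> hF hG FG; apply: le_Rintegral => // x _; exact: FG. Qed.

Lemma Int_ge0 F : (forall x, 0 <= F x) -> 0 <= Int F.
Proof. by move=> F0; apply: Rintegral_ge0 => x _; exact: F0. Qed.

Lemma intg0 : intg (fun _ : 'rV[R]_n => 0).
Proof. exact: integrable0. Qed.

Lemma Int0 : Int (fun _ : 'rV[R]_n => 0) = 0.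
Proof. by rewrite /Int /Rintegral integral0. Qed.

Lemma intg_sum (I : Type) (s : seq I) (P : pred I) (F : I -> 'rV[R]_n -> R) :
  (forall i, P i -> intg (F i)) -> intg (fun x => \sum_(i <- s | P i) F i x).
Proof.
move=> h; elim: s => [|i s IH].
  by apply: intg_eq intg0 => x; rewrite big_nil.
have [Pi|Pi] := boolP (P i).
  by apply: intg_eq (intgD (h i Pi) IH) => x; rewrite big_cons Pi.
by apply: intg_eq IH => x; rewrite big_cons (negbTE Pi).
Qed.

Lemma Int_sum (I : Type) (s : seq I) (P : pred I) (F : I -> 'rV[R]_n -> R) :
  (forall i, P i -> intg (F i)) ->
  Int (fun x => \sum_(i <- s | P i) F i x) = \sum_(i <- s | P i) Int (F i).
Proof.
move=> h; elim: s => [|i s IH].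
  by rewrite big_nil -[RHS]Int0; apply: Int_eq => x; rewrite big_nil.
rewrite big_cons; have [Pi|Pi] := boolP (P i).
  rewrite -IH -IntD; last exact: intg_sum.
    by apply: Int_eq => x; rewrite big_cons Pi.
  exact: h.
by rewrite -IH; apply: Int_eq => x; rewrite big_cons (negbTE Pi).
Qed.

Lemma intg_measurable F : intg F -> measurable_fun (setT : set (borelT R n)) F.
Proof. by move=> /measurable_int /measurable_EFinP. Qed.

Lemma intg_le F G : measurable_fun (setT : set (borelT R n)) F -> intg G ->
  (forall x, `|F x| <= G x) -> intg F.
Proof.
move=> mF hG FG; apply: (le_integrable measurableT _ _ hG).
  exact/measurable_EFinP.
by move=> x _; rewrite /= lee_fin (le_trans (FG x)) // ler_norm.
Qed.

Lemma iint_Int F : intg F -> (forall x, 0 <= F x) -> iint (fun x => (F x)%:E) = (Int F)%:E.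
Proof.
move=> hF F0; rewrite iintE //.
  by rewrite /Int /Rintegral fineK //; exact: integrable_fin_num hF.
by apply/measurable_EFinP; exact: intg_measurable.
Qed.

Lemma intg_iint F : measurable_fun (setT : set (borelT R n)) F -> (forall x, 0 <= F x) ->
  (iint (fun x => (F x)%:E) < +oo)%E -> intg F.
Proof.
move=> mF F0; have mF' : measurable_fun (setT : set (borelT R n)) (EFin \o F).
  exact/measurable_EFinP.
rewrite iintE // => hF; apply/integrableP; split => //.
rewrite (_ : (\int[_]_x _)%E = (\int[lebn n]_x (F x)%:E)%E) //.
by apply: eq_integral => x _ /=; rewrite ger0_norm.
Qed.

Lemma intg_box x0 (a : R) : 0 < a -> @intg n (\1_(box x0 a)).
Proof.
move=> a0; apply/integrableP; split.
  by apply/measurable_EFinP; exact: measurable_indic (measurable_box _ _).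
under eq_integral => x _ do rewrite /= ger0_norm //.
by rewrite -(lebn_indic (measurable_box x0 a)) lebn_box // ltry.
Qed.

Lemma Int_box x0 (a : R) : 0 < a -> @Int n (\1_(box x0 a)) = (2 * a) ^+ n.
Proof.
by move=> a0; rewrite /Int /Rintegral -(lebn_indic (measurable_box x0 a)) lebn_box.
Qed.

Lemma intg_bounded F x0 a C : 0 < a -> measurable_fun (setT : set (borelT R n)) F ->
  (forall x, box x0 a x -> `|F x| <= C) -> (forall x, ~ box x0 a x -> F x = 0) -> intg F.
Proof.
move=> a0 mF FC F0; apply: (intg_le mF (intgZ C (intg_box x0 a0))) => x.
rewrite indicE; have [xb|xb] := boolP (x \in box x0 a).
  by rewrite mulr1; apply: FC; rewrite inE in xb.
by rewrite mulr0 F0 ?normr0 //; move: xb; rewrite notin_setE.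
Qed.

End linearity.

Definition supp_in n (x0 : 'rV[R]_n) (a : R) (F : 'rV[R]_n -> R) : Prop :=
  forall x, a ^+ 2 < sqdist x0 x -> F x = 0.

Lemma supp_in_box n (x0 : 'rV[R]_n) a F x : 0 < a -> supp_in x0 a F -> ~ box x0 a x -> F x = 0.
Proof.
move=> a0 h xb; apply: h; rewrite ltNge; apply/negP => xa; apply: xb.
by apply: sqdist_box => //; exact: ltW.
Qed.

Lemma bounded_compact_support n (x0 : 'rV[R]_n) a F : continuous F -> supp_in x0 a F ->
  exists2 C : R, 0 < C & forall x, `|F x| <= C.
Proof.
move=> cF sF.
have [|M [_ hM]] := @compact_bounded _ _ (F @` [set x | sqdist x0 x <= a ^+ 2]).
  apply: continuous_compact; last exact: compact_sqdist_le.
  exact: continuous_subspaceT.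
have M1 : M < Num.max M 0 + 1 by rewrite ltr_pwDr // le_max lexx.
have C0 : 0 < Num.max M 0 + 1 by rewrite ltr_wpDl // le_max lexx orbT.
exists (Num.max M 0 + 1) => // x; have [xa|xa] := leP (sqdist x0 x) (a ^+ 2).
  by apply: (hM _ M1); exists x.
by rewrite sF // normr0 ltW.
Qed.

Lemma intg_compact_support n (x0 : 'rV[R]_n) a F : 0 < a -> continuous F -> supp_in x0 a F -> intg F.
Proof.
move=> a0 cF sF; have [C _ hC] := bounded_compact_support cF sF.
apply: (@intg_bounded _ _ x0 a C) => //; first exact: continuous_borel_fun.
by move=> x; exact: supp_in_box.
Qed.

Lemma supp_in_pd n (x0 : 'rV[R]_n) a F i : supp_in x0 a F -> supp_in x0 a (pd i F).
Proof.
move=> sF x xa; rewrite (@pd_near _ _ i F (fun _ => 0)); first exact/isPdE/isPd_cst.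
have : nbhs x (sqdist x0 @^-1` [set y | a ^+ 2 < y]).
  by apply: sqdist_continuous; exact: lt_nbhsr.
by apply: filterS => y; exact: sF.
Qed.

Lemma supp_inMl n (x0 : 'rV[R]_n) a F G : supp_in x0 a F -> supp_in x0 a (fun x => F x * G x).
Proof. by move=> sF x xa; rewrite sF // mul0r. Qed.

Lemma supp_inMr n (x0 : 'rV[R]_n) a F G : supp_in x0 a G -> supp_in x0 a (fun x => F x * G x).
Proof. by move=> sF x xa; rewrite sF // mulr0. Qed.

Lemma supp_inD n (x0 : 'rV[R]_n) a F G : supp_in x0 a F -> supp_in x0 a G ->
  supp_in x0 a (fun x => F x + G x).
Proof. by move=> sF sG x xa; rewrite sF // sG // addr0. Qed.

Lemma supp_in_sum n (x0 : 'rV[R]_n) a (I : Type) (s : seq I) (P : pred I) F :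
  (forall i, P i -> supp_in x0 a (F i)) -> supp_in x0 a (fun x => \sum_(i <- s | P i) F i x).
Proof. by move=> sF x xa; rewrite big1 // => i Pi; exact: sF. Qed.

Lemma rV_consDl n (t s : R) (y : 'rV[R]_n) :
  rV_cons (t + s) y = rV_cons t y + s *: evec R ord0.
Proof.
apply/rowP => j; rewrite coordE; case: (unliftP ord0 j) => [k|] ->.
  by rewrite !rV_consS (_ : (_ == _) = false) ?mulr0 ?addr0.
by rewrite !rV_cons0 eqxx mulr1.
Qed.

Lemma rV_consDr n (t s : R) (y : 'rV[R]_n) j :
  rV_cons t (y + s *: evec R j) = rV_cons t y + s *: evec R (lift ord0 j).
Proof.
apply/rowP => k; rewrite coordE; case: (unliftP ord0 k) => [k'|] ->.
  by rewrite !rV_consS coordE (inj_eq (@lift_inj _ _)).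
by rewrite !rV_cons0 (_ : (_ == _) = false) ?mulr0 ?addr0.
Qed.

Lemma continuous_rV (T : topologicalType) n (F : T -> 'rV[R]_n) :
  (forall j, continuous (fun t => F t 0 j)) -> continuous F.
Proof.
move=> cF t A [P hP PA].
have : \forall s \near t, forall j, P 0 j (F s 0 j).
  by apply: filter_forall => j; apply: (cF j t); exact: hP.
by apply: filterS => s hs; apply: PA => i j; rewrite (ord1 i).
Qed.

Lemma continuous_rV_consl n (y : 'rV[R]_n) : continuous (fun t : R => rV_cons t y).
Proof.
apply: continuous_rV => j; case: (unliftP ord0 j) => [k|] ->.
  by rewrite (_ : (fun _ => _) = fun _ => y 0 k);
    [exact: cst_continuous|apply/funext => t; rewrite rV_consS].
by rewrite (_ : (fun _ => _) = id); [move=> t; exact: cvg_id|apply/funext => t; rewrite rV_cons0].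
Qed.

Lemma continuous_rV_consr n (t : R) : continuous (fun y : 'rV[R]_n => rV_cons t y).
Proof.
apply: continuous_rV => j; case: (unliftP ord0 j) => [k|] ->.
  by rewrite (_ : (fun _ => _) = fun y : 'rV_n => y 0 k);
    [exact: coord_continuous|apply/funext => y; rewrite rV_consS].
by rewrite (_ : (fun _ => _) = fun _ => t);
  [exact: cst_continuous|apply/funext => y; rewrite rV_cons0].
Qed.

Lemma continuous_comp_consl n (V : 'rV[R]_n.+1 -> R) y :
  continuous V -> continuous (fun t => V (rV_cons t y)).
Proof. by move=> cV t; apply: continuous_comp; [exact: continuous_rV_consl|exact: cV]. Qed.

Lemma continuous_comp_consr n (V : 'rV[R]_n.+1 -> R) t :
  continuous V -> continuous (fun y => V (rV_cons t y)).
Proof. by move=> cV y; apply: continuous_comp; [exact: continuous_rV_consr|exact: cV]. Qed.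

Lemma sube_eq0_fin (x y : \bar R) : (x - y = 0)%E -> y \is a fin_num -> x = y.
Proof. by move=> h hy; rewrite -[x](subeK x hy) h add0e. Qed.

(** The fundamental theorem of calculus on an interval larger than the support. Splitting into
    positive and negative parts keeps both sides nonnegative, so that Tonelli can be applied to them
    in higher dimension. *)
Lemma integral_deriv_compact_support (v w : R -> R) (a : R) :
  (forall t, is_derive t (1:R) v (w t)) -> continuous w -> (forall t, a < `|t| -> v t = 0) ->
  (forall t, a < `|t| -> w t = 0) ->
  (\int[@lebesgue_measure R]_t (Num.max (w t) 0)%:E = \int[@lebesgue_measure R]_t (Num.max (- w t) 0)%:E)%E.
Proof.
(* [b] is positive and exceeds [a] even when [a] is negative, so [v] vanishes at both ends of
   [-b, b]. *)
move=> dv cw v0 w0; pose b := Num.max a 0 + 1.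
have b0 : 0 < b by rewrite ltr_wpDl // le_max lexx orbT.
have ab : a < b by rewrite ltr_pwDr // le_max lexx.
have cwb : {within `[- b, b], continuous w} by exact: continuous_subspaceT.
have iw : (@lebesgue_measure R).-integrable `[- b, b] (EFin \o w).
  by apply: continuous_compact_integrable => //; exact: segment_compact.
have dcv : derivable_oo_LRcontinuous v (- b) b.
  have cv : continuous v.
    move=> t; apply: differentiable_continuous; apply/derivable1_diffP.
    by have := dv t => ?; exact: ex_derive.
  split; first by move=> t _; have := dv t => ?; exact: ex_derive.
    by apply: cvg_at_right_filter; exact: cv.
  by apply: cvg_at_left_filter; exact: cv.
have := @continuous_FTC2 _ w v (- b) b _ cwb dcv _.
rewrite v0 ?gtr0_norm // v0 ?normrN ?gtr0_norm // subee // integralE => H.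
have dw : {in `]- b, b[, v^`()%classic =1 w}.
  by move=> t _; rewrite derive1E; have := dv t => ?; exact: derive_val.
have mb : measurable (`[- b, b]%classic : set (measurableTypeR R)) by exact: measurable_itv.
have E := sube_eq0_fin (H (gtrN b0) dw) (integrable_neg_fin_num mb iw).
have out (f : R -> R) : (forall t, a < `|t| -> f t = 0) ->
    (\int[@lebesgue_measure R]_t (f t)%:E = \int[@lebesgue_measure R]_(t in `[(- b)%R, b]) (f t)%:E)%E.
  move=> f0; rewrite [RHS]integral_mkcond; apply: eq_integral => t _; rewrite patchE.
  case: ifPn => //; rewrite notin_setE /= in_itv /= => /negP tb; rewrite f0 //.
  apply: lt_le_trans ab _; rewrite leNgt; apply: contra tb.
  by rewrite ltr_norml => /andP[/ltW -> /ltW ->].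
rewrite !out => [|t ta|t ta]; last 2 first.
- by rewrite w0 // oppr0 maxxx.
- by rewrite w0 // maxxx.
apply: etrans (etrans E _); last by apply: eq_integral => t _; rewrite funenegE -EFinN -EFin_max.
by apply: eq_integral => t _; rewrite funeposE -EFin_max.
Qed.

(** Induction on the dimension. For a derivative in a later coordinate the first one is frozen; for
    the first coordinate the order of integration is exchanged and the one-variable statement
    applies on every line. *)
Lemma integral_pd_posneg n i (V : 'rV[R]_n -> R) a x0 : CkT 1 V ->
  (forall x, ~ box x0 a x -> V x = 0) -> (forall x, ~ box x0 a x -> pd i V x = 0) ->
  (\int[lebn n]_x (Num.max (pd i V x) 0)%:E = \int[lebn n]_x (Num.max (- pd i V x) 0)%:E)%E.
Proof.
elim: n i V x0 => [[]//|n IH] i V x0 cV V0 W0.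
have cW : continuous (pd i V) by exact: CkT_continuous (CkT_pd i cV).
have mW : measurable_fun (setT : set (borelT R n.+1)) (pd i V) by exact: continuous_borel_fun.
have mp : measurable_fun (setT : set (borelT R n.+1)) (fun x => (Num.max (pd i V x) 0)%:E).
  by apply/measurable_EFinP; exact: measurable_maxr.
have mn : measurable_fun (setT : set (borelT R n.+1)) (fun x => (Num.max (- pd i V x) 0)%:E).
  by apply/measurable_EFinP; apply: measurable_maxr => //; exact: measurableT_comp.
have p0 x : (0 <= (Num.max (pd i V x) 0)%:E)%E by rewrite lee_fin le_max lexx orbT.
have n0 x : (0 <= (Num.max (- pd i V x) 0)%:E)%E by rewrite lee_fin le_max lexx orbT.
case: (unliftP ord0 i) mW W0 cW mp mn p0 n0 => [j|] -> mW W0 cW mp mn p0 n0.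
  rewrite (integral_lebnS mp p0) (integral_lebnS mn n0); apply: eq_integral => t _.
  pose U y := V (rV_cons t y).
  have dU y : isPd j U y (pd (lift ord0 j) V (rV_cons t y)).
    rewrite /isPd /U; under [X in is_derive _ _ X]funext do rewrite rV_consDr.
    exact: CkT_isPd cV.
  have pU : pd j U = fun y => pd (lift ord0 j) V (rV_cons t y).
    by apply/funext => y; apply: isPdE.
  have bxy y : ~ box (\row_j x0 0 (lift ord0 j)) a y -> ~ box x0 a (rV_cons t y).
    by move=> h h'; apply: h => k; have := h' (lift ord0 k); rewrite rV_consS mxE.
  have cU : CkT 1 U.
    split; last move=> k.
      exact: continuous_comp_consr (CkT_continuous cV).
    have dUk y : isPd k U y (pd (lift ord0 k) V (rV_cons t y)).
      rewrite /isPd /U; under [X in is_derive _ _ X]funext do rewrite rV_consDr.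
      exact: CkT_isPd cV.
    have pUk : pd k U = fun y => pd (lift ord0 k) V (rV_cons t y).
      by apply/funext => y; apply: isPdE.
    rewrite pUk; split => //; split => //.
    exact: continuous_comp_consr (CkT_continuous (CkT_pd (lift ord0 k) cV)).
  have := IH j U (\row_j x0 0 (lift ord0 j)) cU; rewrite pU; apply.
    by move=> y /bxy; exact: V0.
  by move=> y /bxy; exact: W0.
rewrite (integral_lebnS_swap mp p0) (integral_lebnS_swap mn n0); apply: eq_integral => y _.
apply: (@integral_deriv_compact_support (fun t => V (rV_cons t y))
   (fun t => pd ord0 V (rV_cons t y)) (`|x0 0 ord0| + a)).
- move=> t.
  have E : rV_cons t y = rV_cons 0 y + t *: evec R ord0 by rewrite -rV_consDl add0r.
  have := CkT_isPd ord0 (rV_cons t y) cV; rewrite {1}E => /isPd_line.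
  by under [X in is_derive _ _ X]funext do rewrite -rV_consDl add0r.
- exact: continuous_comp_consl.
- move=> t ta; apply: V0 => /(_ ord0); rewrite rV_cons0; apply/negP; rewrite -ltNge.
  by rewrite -(ltrD2l `|x0 0 ord0|); apply: lt_le_trans ta _; rewrite addrC -lerBlDr lerB_dist.
move=> t ta; apply: W0 => /(_ ord0); rewrite rV_cons0; apply/negP; rewrite -ltNge.
by rewrite -(ltrD2l `|x0 0 ord0|); apply: lt_le_trans ta _; rewrite addrC -lerBlDr lerB_dist.
Qed.

Lemma Int_pd n i (V : 'rV[R]_n -> R) a x0 : 0 < a -> CkT 1 V -> supp_in x0 a V ->
  Int (pd i V) = 0.
Proof.
move=> a0 cV sV; have sW := supp_in_pd i sV.
have cW : continuous (pd i V) by exact: CkT_continuous (CkT_pd i cV).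
have iW := intg_compact_support a0 cW sW.
have := @integral_pd_posneg n i V a x0 cV (fun x => supp_in_box a0 sV) (fun x => supp_in_box a0 sW).
move=> E; rewrite /Int /Rintegral integralE.
have -> : (\int[lebn n]_x (fun x => (pd i V x)%:E)^\+ x = \int[lebn n]_x (fun x => (pd i V x)%:E)^\- x)%E.
  transitivity (\int[lebn n]_x (Num.max (pd i V x) 0)%:E)%E.
    by apply: eq_integral => x _; rewrite funeposE -EFin_max.
  by rewrite E; apply: eq_integral => x _; rewrite funenegE -EFinN -EFin_max.
by rewrite subee // integrable_neg_fin_num.
Qed.

End lebesgue_rV.

(** * Algebra of bundle-valued forms *)

Section form_algebra.
Context {R : realType} {n r : nat}.
Notation form := (fform R n r).
Implicit Types (a b : form) (i j : 'I_n) (I J K : {set 'I_n}) (M : 'M[R]_r).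

Lemma fform_ext a b : (forall I t, a I t = b I t) -> a = b.
Proof. by move=> h; apply/funext => I; apply/funext => t. Qed.

(** Flat pairing over all degrees at once, so that adjointness needs no degree bookkeeping; the
    metric enters through [fib]. *)
Definition dot a b : R := \sum_I \sum_t a I t * b I t.

Lemma dotC a b : dot a b = dot b a.
Proof. by apply: eq_bigr => I _; apply: eq_bigr => t _; rewrite mulrC. Qed.

Lemma dot_sumr (T : Type) (s : seq T) (P : pred T) a (F : T -> form) :
  dot a (fun I t => \sum_(k <- s | P k) F k I t) = \sum_(k <- s | P k) dot a (F k).
Proof.
rewrite /dot [RHS]exchange_big; apply: eq_bigr => I _; rewrite [RHS]exchange_big.
by apply: eq_bigr => t _; rewrite mulr_sumr.
Qed.

Lemma dot_suml (T : Type) (s : seq T) (P : pred T) (F : T -> form) b :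
  dot (fun I t => \sum_(k <- s | P k) F k I t) b = \sum_(k <- s | P k) dot (F k) b.
Proof. by rewrite dotC dot_sumr; apply: eq_bigr => k _; rewrite dotC. Qed.

Lemma dotZr c a b : dot a (fun I t => c * b I t) = c * dot a b.
Proof.
rewrite /dot mulr_sumr; apply: eq_bigr => I _; rewrite mulr_sumr.
by apply: eq_bigr => t _; rewrite mulrCA.
Qed.

Lemma dotZl c a b : dot (fun I t => c * a I t) b = c * dot a b.
Proof. by rewrite dotC dotZr dotC. Qed.

Lemma dotDr a b c : dot a (fun I t => b I t + c I t) = dot a b + dot a c.
Proof.
rewrite /dot -big_split; apply: eq_bigr => I _; rewrite -big_split /=.
by apply: eq_bigr => t _; rewrite mulrDr.
Qed.

Lemma dotDl a b c : dot (fun I t => a I t + b I t) c = dot a c + dot b c.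
Proof. by rewrite dotC dotDr !(dotC c). Qed.

Lemma dot_fib M a b : dot a (fib M b) = \sum_I \sum_t \sum_x a I t * b I x * M t x.
Proof.
apply: eq_bigr => I _; apply: eq_bigr => t _; rewrite /fib mulr_sumr.
by apply: eq_bigr => x _; ring.
Qed.

Lemma fib_tr M a b : dot (fib M a) b = dot a (fib M^T b).
Proof.
rewrite dotC !dot_fib; apply: eq_bigr => I _; rewrite exchange_big.
by apply: eq_bigr => t _; apply: eq_bigr => x _; rewrite mxE [b I x * _]mulrC.
Qed.

Lemma fib_mul M N a : fib (M *m N) a = fib M (fib N a).
Proof.
apply: fform_ext => I t; rewrite /fib.
under eq_bigr => k _ do rewrite mxE mulr_suml.
rewrite exchange_big; apply: eq_bigr => k _; rewrite mulr_sumr.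
by apply: eq_bigr => l _; rewrite mulrA.
Qed.

Lemma fib1 a : fib 1%:M a = a.
Proof.
apply: fform_ext => I t; rewrite /fib (bigD1 t) //= mxE eqxx mul1r big1 ?addr0 // => k kt.
by rewrite mxE eq_sym (negbTE kt) mul0r.
Qed.

Lemma fib_addm M N a : fib (M + N) a = fun I t => fib M a I t + fib N a I t.
Proof.
apply: fform_ext => I t; rewrite /fib -big_split; apply: eq_bigr => k _.
by rewrite mxE mulrDl.
Qed.

Lemma fib_oppm M a : fib (- M) a = fun I t => -1 * fib M a I t.
Proof.
apply: fform_ext => I t; rewrite /fib mulN1r -sumrN; apply: eq_bigr => k _.
by rewrite mxE mulNr.
Qed.

Lemma fib_sum (T : Type) (s : seq T) (P : pred T) M (F : T -> form) :
  fib M (fun I t => \sum_(k <- s | P k) F k I t) = fun I t => \sum_(k <- s | P k) fib M (F k) I t.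
Proof.
apply: fform_ext => I t; rewrite /fib exchange_big; apply: eq_bigr => k _.
by rewrite mulr_sumr.
Qed.

Lemma fibZ M c a : fib M (fun I t => c * a I t) = fun I t => c * fib M a I t.
Proof.
by apply: fform_ext => I t; rewrite /fib mulr_sumr; apply: eq_bigr => k _; rewrite mulrCA.
Qed.

(** The case distinction becomes a numerical factor, so linearity, differentiation and [ring] apply
    uniformly. *)
Lemma wedgeE i a J t : wedge i a J t =
  (i \in J)%:R * ((-1) ^+ #|[set k in J | (k < i)%N]| * a (J :\ i) t).
Proof. by rewrite /wedge; case: ifP; rewrite ?mul1r ?mul0r. Qed.

Lemma interE i a K t : inter i a K t =
  (i \notin K)%:R * ((-1) ^+ #|[set k in K | (k < i)%N]| * a (i |: K) t).
Proof. by rewrite /inter; case: ifP; rewrite ?mul1r ?mul0r. Qed.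

Lemma wedgeZ i c a J t : wedge i (fun I s => c * a I s) J t = c * wedge i a J t.
Proof. by rewrite !wedgeE; ring. Qed.

Lemma interZ i c a J t : inter i (fun I s => c * a I s) J t = c * inter i a J t.
Proof. by rewrite !interE; ring. Qed.

Lemma wedge_sum (T : Type) (s : seq T) (P : pred T) i (F : T -> form) J t :
  wedge i (fun I t => \sum_(k <- s | P k) F k I t) J t = \sum_(k <- s | P k) wedge i (F k) J t.
Proof. by rewrite wedgeE !mulr_sumr; apply: eq_bigr => k _; rewrite wedgeE. Qed.

Lemma inter_fib i M a : inter i (fib M a) = fib M (inter i a).
Proof.
apply: fform_ext => I t; rewrite interE /fib !mulr_sumr; apply: eq_bigr => k _.
by rewrite interE; ring.
Qed.

Lemma wedge_qform q i a : is_qform q a -> is_qform q.+1 (wedge i a).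
Proof.
move=> qa J t Jq; rewrite /wedge; case: ifP => // iJ; rewrite qa ?mulr0 //.
by apply: contra Jq => /eqP <-; rewrite (cardsD1 i J) iJ.
Qed.

Lemma inter_qform q i a : is_qform q.+1 a -> is_qform q (inter i a).
Proof.
move=> qa K t Kq; rewrite /inter; case: ifP => // iK; rewrite qa ?mulr0 //.
by rewrite cardsU1 iK /= add1n eqSS.
Qed.

Lemma fib_qform q M a : is_qform q a -> is_qform q (fib M a).
Proof. by move=> qa J t Jq; rewrite /fib big1 // => k _; rewrite qa ?mulr0. Qed.

Lemma ip_dot q M a b : is_qform q a -> ip q M a b = dot a (fib M b).
Proof.
move=> qa; rewrite dot_fib /ip big_mkcond; apply: eq_bigr => I _.
case: ifPn => // Iq; rewrite big1 // => t _; rewrite big1 // => x _.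
by rewrite qa // !mul0r.
Qed.

Lemma setI_lt_D1 i J : [set k in J :\ i | (k < i)%N] = [set k in J | (k < i)%N].
Proof.
by apply/setP => k; rewrite !inE; case: (eqVneq k i) => [->|] //=; rewrite ltnn !andbF.
Qed.

(** Removing [i] is a bijection from the index sets containing [i] to those avoiding it, and it
    leaves unchanged the number of smaller elements that determines the sign. *)
Lemma dot_wedge i a b : dot (wedge i a) b = dot a (inter i b).
Proof.
rewrite /dot (bigID (fun J : {set 'I_n} => i \in J)) /= [X in _ + X]big1 ?addr0; last first.
  by move=> J iJ; rewrite big1 // => t _; rewrite wedgeE (negbTE iJ) !mul0r.
rewrite [RHS](bigID (fun J : {set 'I_n} => i \notin J)) /= [X in _ + X]big1 ?addr0; last first.
  by move=> J iJ; rewrite big1 // => t _; rewrite interE (negbTE iJ) mul0r mulr0.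
rewrite (reindex_onto (fun K => i |: K) (fun J => J :\ i)) /=; last first.
  by move=> J iJ; rewrite finset.setD1K.
apply: eq_big => [K|K /andP[_ /eqP KE]].
  rewrite setU11 /=; apply/eqP/idP => [<-|iK]; first by rewrite !inE eqxx.
  by rewrite finset.setU1K.
have iK : i \notin K by rewrite -KE !inE eqxx.
apply: eq_bigr => t _; rewrite wedgeE interE setU11 iK -setI_lt_D1 KE !mul1r.
by rewrite [RHS]mulrCA mulrA.
Qed.

(** Each of the [q] elements of [J] contributes [a J t], its two signs cancelling. This identity
    makes a scalar Hessian act as a number and makes contraction with the radial field a
    primitive. *)
Lemma sum_wedge_inter q a : is_qform q a ->
  forall J t, \sum_i wedge i (inter i a) J t = q%:R * a J t.
Proof.
move=> qa J t; have [Jq|Jq] := eqVneq #|J| q; last first.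
  rewrite qa // mulr0 big1 // => i _; rewrite wedgeE interE.
  rewrite !inE eqxx /= !mul1r; have [iJ|iJ] := boolP (i \in J); last by rewrite mul0r.
  by rewrite finset.setD1K // qa // !mulr0.
rewrite (bigID (mem J)) /= [X in _ + X]big1 ?addr0; last first.
  by move=> i iJ; rewrite wedgeE (negbTE iJ) mul0r.
rewrite -Jq mulr_natl -sumr_const; apply: eq_bigr => i iJ.
rewrite wedgeE interE iJ !inE eqxx /= !mul1r finset.setD1K // setI_lt_D1.
by rewrite mulrA -expr2 sqrr_sign mul1r.
Qed.

Lemma card_lt_D1 i j J : j \in J ->
  #|[set k in J | (k < i)%N]| = ((j < i) + #|[set k in J :\ j | (k < i)%N]|)%N.
Proof.
move=> jJ; rewrite (cardsD1 j) !inE jJ /=; congr (_ + _)%N; apply: eq_card => k.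
by rewrite !inE andbA.
Qed.

Lemma wedge_anticomm i j a J t : wedge i (wedge j a) J t = - wedge j (wedge i a) J t.
Proof.
rewrite !wedgeE !inE; have [->|ij] := eqVneq i j.
  by rewrite ?eqxx /= !mul0r !mulr0 oppr0.
have ji : (j == i) = false by rewrite eq_sym; exact/negbTE.
rewrite ?(negbTE ij) ?ji /=.
case iJ: (i \in J); case jJ: (j \in J); rewrite ?mul0r ?mulr0 ?mul0r ?mulr0 ?oppr0 // !mul1r.
rewrite (_ : J :\ j :\ i = J :\ i :\ j); last by apply/setP => k; rewrite !inE andbCA.
(* Exactly one of i < j and j < i holds, so the two orders of removal produce opposite signs. *)
rewrite (card_lt_D1 i jJ) (card_lt_D1 j iJ) !exprD.
have : (i < j)%N || (j < i)%N by rewrite -neq_ltn.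
by case: ltngtP => // _ _; rewrite ?expr0 ?expr1 ?mul1r; ring.
Qed.

Lemma sum_wedge_wedge_sym (A : 'I_n -> 'I_n -> form) : (forall i j, A i j = A j i) ->
  forall J t, \sum_i \sum_j wedge i (wedge j (A i j)) J t = 0.
Proof.
move=> symA J t; set X := (X in X = 0).
have : X = - X.
  rewrite {2}/X exchange_big /= -sumrN; apply: eq_bigr => i _; rewrite -sumrN.
  by apply: eq_bigr => j _; rewrite wedge_anticomm symA.
by move=> /eqP; rewrite -addr_eq0 -mulr2n mulrn_eq0 /= => /eqP.
Qed.

Lemma HessOp_scalar q c a : is_qform q a ->
  HessOp c%:M a = fun I t => c * q%:R * a I t.
Proof.
move=> qa; apply: fform_ext => I t; rewrite /HessOp -mulrA -(sum_wedge_inter qa) mulr_sumr.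
apply: eq_bigr => i _; rewrite (bigD1 i) //= mxE eqxx mulr1n big1 ?addr0 // => j ji.
by rewrite mxE eq_sym (negbTE ji) mul0r.
Qed.

(** [HessInv] chooses some solution: the scaled form shows that one exists, and any solution equals
    it because the operator multiplies [q]-forms by a nonzero number. *)
Lemma HessInv_scalar q c a : is_qform q a -> c * q%:R != 0 ->
  HessInv q c%:M a = fun I t => (c * q%:R)^-1 * a I t.
Proof.
move=> qa cq; have ex : exists v : fform R n r, is_qform q v /\ HessOp c%:M v = a.
  have qv : is_qform q (fun I t => (c * q%:R)^-1 * a I t) by move=> I t Iq; rewrite qa ?mulr0.
  exists (fun I t => (c * q%:R)^-1 * a I t); split => //.
  by rewrite (HessOp_scalar _ qv); apply: fform_ext => I t; rewrite mulVKf.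
have := ClassicalEpsilon.epsilon_spec (inhabits (fun _ _ => 0)) _ ex.
rewrite -/(HessInv q c%:M a); set v := HessInv _ _ _; move=> [qv hv].
by apply: fform_ext => I t; rewrite -hv (HessOp_scalar _ qv) mulKf.
Qed.

End form_algebra.

(** * Quadratic forms on the fibre *)

Section quadratic_forms.
Context {R : realType} {r : nat}.
Implicit Types (M G K : 'M[R]_r) (v w : 'I_r -> R).

Definition bil M v w : R := \sum_t \sum_x v t * w x * M t x.
Definition vdot v w : R := \sum_t v t * w t.

Lemma dot_fib_bil n M (a b : fform R n r) : dot a (fib M b) = \sum_I bil M (a I) (b I).
Proof. by rewrite dot_fib. Qed.

Lemma dot_vdot n (a b : fform R n r) : dot a b = \sum_I vdot (a I) (b I).
Proof. by []. Qed.

Lemma vdot_ge0 v : 0 <= vdot v v.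
Proof. by apply: sumr_ge0 => t _; rewrite -expr2 sqr_ge0. Qed.

Lemma bil_matrix M v w : bil M v w = ((\row_t v t) *m M *m (\row_t w t)^T) 0 0.
Proof.
rewrite mxE /bil exchange_big; apply: eq_bigr => x _; rewrite !mxE mulr_suml.
by apply: eq_bigr => t _; rewrite !mxE; ring.
Qed.

Lemma bilD M G v w : bil (M + G) v w = bil M v w + bil G v w.
Proof.
rewrite /bil -big_split; apply: eq_bigr => t _; rewrite -big_split /=.
by apply: eq_bigr => x _; rewrite mxE mulrDr.
Qed.

Lemma norm_mul_le (x y : R) : `|x * y| <= (x * x + y * y) / 2.
Proof.
rewrite ler_norml; apply/andP; split.
  by have := sqr_ge0 (x + y); rewrite expr2; lra.
by have := sqr_ge0 (x - y); rewrite expr2; lra.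
Qed.

Lemma bil_le d K v : (forall t x, `|K t x| <= d) -> `|bil K v v| <= d * r%:R * vdot v v.
Proof.
move=> Kd; rewrite /bil.
have tx t x : `|v t * v x * K t x| <= d / 2 * (v t * v t + v x * v x).
  have d0 : 0 <= d by apply: le_trans (Kd t x).
  rewrite normrM (_ : d / 2 * _ = (v t * v t + v x * v x) / 2 * d); last by ring.
  by apply: ler_pM => //; exact: norm_mul_le.
apply: le_trans (ler_norm_sum _ _ _) _.
apply: (@le_trans _ _ (\sum_t \sum_x d / 2 * (v t * v t + v x * v x))).
  by apply: ler_sum => t _; apply: le_trans (ler_norm_sum _ _ _) _; apply: ler_sum.
under eq_bigr => t _ do rewrite -mulr_sumr big_split /= sumr_const card_ord -/(vdot v v).
rewrite -mulr_sumr big_split /= sumr_const card_ord sumrMnl -/(vdot v v) -mulr_natr.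
by move: (vdot v v) => X; lra.
Qed.

Lemma mv_continuous M : continuous (fun v : 'rV[R]_r => bil M (v 0) (v 0)).
Proof.
apply: (@CkT_continuous _ _ 0); apply: CkT_sum => t _; apply: CkT_sum => x _.
by apply: CkTM; [apply: CkTM; exact: CkT_coord|exact: CkT_cst].
Qed.

Lemma bilZ M c v : bil M (fun t => c * v t) (fun t => c * v t) = c ^+ 2 * bil M v v.
Proof.
rewrite /bil mulr_sumr; apply: eq_bigr => t _; rewrite mulr_sumr; apply: eq_bigr => x _; ring.
Qed.

Lemma vdotZ c v : vdot (fun t => c * v t) (fun t => c * v t) = c ^+ 2 * vdot v v.
Proof. by rewrite /vdot mulr_sumr; apply: eq_bigr => t _; ring. Qed.

Lemma vdot_eq0 v : vdot v v = 0 -> forall t, v t = 0.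
Proof.
move=> /eqP; rewrite psumr_eq0; last by move=> t _; rewrite -expr2 sqr_ge0.
by move=> /allP h t; have := h t (mem_index_enum t); rewrite /= mulf_eq0 orbb => /eqP.
Qed.

Lemma pos_def_bil M v t : pos_def M -> v t != 0 -> 0 < bil M v v.
Proof.
move=> pM vt; rewrite bil_matrix; apply: pM; apply: contra vt => /eqP /rowP /(_ t).
by rewrite !mxE => ->.
Qed.

(** On the compact unit sphere the inverse of the quadratic form is continuous, hence bounded;
    homogeneity extends the resulting lower bound to all vectors. *)
Lemma pos_def_lower M : pos_def M ->
  exists2 c : R, 0 < c & forall v, c * vdot v v <= bil M v v.
Proof.
move=> pM; pose K : set 'rV[R]_r := [set x | sqdist 0 x = 1].
have cK : compact K.
  apply: (subclosed_compact _ (@compact_sqdist_le R r 0 1)); last by move=> x /= ->.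
  apply: (@closed_comp _ _ (sqdist 0) [set y | y = 1]).
    by move=> x _; exact: sqdist_continuous.
  exact: closed_eq.
have vdotK (x : 'rV[R]_r) : vdot (x 0) (x 0) = sqdist 0 x.
  by apply: eq_bigr => t _; rewrite mxE subr0.
have posK (x : 'rV[R]_r) : K x -> 0 < bil M (x 0) (x 0).
  move=> /= x1; case: (pickP (fun t => x 0 t != 0)) => [t xt|x0]; first exact: pos_def_bil xt.
  move: x1; rewrite /K /= -vdotK /vdot big1; first by move=> /eqP; rewrite eq_sym oner_eq0.
  by move=> t _; have := x0 t => /negbFE/eqP ->; rewrite mul0r.
have [|B [_ hB]] := @compact_bounded _ _ ((fun x : 'rV[R]_r => (bil M (x 0) (x 0))^-1) @` K).
  apply: continuous_compact => //; apply: continuous_in_subspaceT => x.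
  rewrite inE => Kx; have h0 : bil M (x 0) (x 0) != 0 by rewrite gt_eqF // posK.
  exact: (cvgV h0 (@mv_continuous M x)).
have B1 : B < Num.max B 0 + 1 by rewrite ltr_pwDr // le_max lexx.
have C0 : 0 < Num.max B 0 + 1 by rewrite ltr_wpDl // le_max lexx orbT.
exists (Num.max B 0 + 1)^-1; first by rewrite invr_gt0.
move=> v; have [v0|v0] := eqVneq (vdot v v) 0.
  rewrite v0 mulr0 /bil big1 // => t _; rewrite big1 // => x _.
  by rewrite (vdot_eq0 v0) !mul0r.
have m0 : 0 < vdot v v by rewrite lt_neqAle eq_sym v0 vdot_ge0.
pose c := (Num.sqrt (vdot v v))^-1.
have c2 : c ^+ 2 * vdot v v = 1.
  by rewrite /c exprVn sqr_sqrtr ?vdot_ge0 // mulVf // gt_eqF.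
pose x : 'rV[R]_r := \row_t (c * v t).
have xE : x 0 = fun t => c * v t by apply/funext => t; rewrite mxE.
have Kx : K x by rewrite /K /= -vdotK xE vdotZ.
have := hB _ B1 _ (ex_intro2 _ _ x Kx erefl).
rewrite /= ger0_norm; last by rewrite invr_ge0 ltW // posK.
rewrite -[X in _ <= X]invrK lef_pV2 ?posrE ?invr_gt0 ?posK // xE bilZ => h.
rewrite -(@ler_pM2l _ (c ^+ 2)).
  by rewrite mulrCA c2 mulr1.
by rewrite exprn_gt0 // invr_gt0 sqrtr_gt0.
Qed.

End quadratic_forms.

(** * Completing the square *)

Section completing_squares.
Context {R : realType} {n r : nat}.
Implicit Types (a b u p : fform R n r) (H N : 'M[R]_r).

Lemma quad_ge0 H a : (forall v, 0 <= bil H v v) -> 0 <= dot a (fib H a).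
Proof. by move=> h; rewrite dot_fib_bil; apply: sumr_ge0 => I _. Qed.

Lemma quad_le H G c a : (forall v, bil H v v <= c * bil G v v) ->
  dot a (fib H a) <= c * dot a (fib G a).
Proof. by move=> h; rewrite !dot_fib_bil mulr_sumr; apply: ler_sum. Qed.

Lemma fib_sym H a b : H^T = H -> dot a (fib H b) = dot b (fib H a).
Proof. by move=> hH; rewrite -{1}hH -fib_tr dotC. Qed.

Lemma fibD H a b : fib H (fun I t => a I t + b I t) = fun I t => fib H a I t + fib H b I t.
Proof.
apply: fform_ext => I t; rewrite /fib -big_split; apply: eq_bigr => x _.
by rewrite mulrDr.
Qed.

Lemma quadD H a b k l : H^T = H ->
  let w := fun I t => k * a I t + l * b I t in
  dot w (fib H w) = k ^+ 2 * dot a (fib H a) + 2 * k * l * dot a (fib H b)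
    + l ^+ 2 * dot b (fib H b).
Proof.
move=> hH w; rewrite /w fibD !fibZ dotDl !dotDr !dotZl !dotZr (fib_sym b a hH); ring.
Qed.

(* With [v = lam u - 2 s p] and [w = 2 s H p - b] the right-hand side is
   [v.Hv + 2 v.b + (1 + e) b.H0^-1 b], and [(1 + e) H >= H0]. *)
Lemma completed_square H H0 e lam s u p b : H^T = H -> H0^T = H0 -> H0 \in unitmx ->
  0 <= e -> (forall v, 0 <= bil H0 v v) -> (forall v, bil H0 v v <= (1 + e) * bil H v v) ->
  0 <= lam ^+ 2 * dot u (fib H u)
     - 2 * lam * dot u (fun I t => 2 * s * fib H p I t + -1 * b I t)
     + (4 * s ^+ 2 * dot p (fib H p) - 4 * s * dot p b + (1 + e) * dot b (fib (invmx H0) b)).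
Proof.
move=> hH hH0 uH0 e0 pH0 leH.
pose c := 1 + e; have c0 : 0 < c by rewrite /c ltr_wpDr.
pose v : fform R n r := fun I t => lam * u I t + (- (2 * s)) * p I t.
have vH := @quadD H u p lam (- (2 * s)) hH.
(* With c = 1 + e, expanding the [H0]-square of y = v + c H0^-1 b gives v.H0 v + 2 c v.b + c^2
   b.H0^-1 b. Bounding v.H0 v by c v.H v and dividing by c yields the claim. *)
pose y : fform R n r := fun I t => 1 * v I t + c * fib (invmx H0) b I t.
have yH0 := @quadD H0 v (fib (invmx H0) b) 1 c hH0.
have H0N : fib H0 (fib (invmx H0) b) = b by rewrite -fib_mul mulmxV // fib1.
have Nb : dot (fib (invmx H0) b) b = dot b (fib (invmx H0) b) by rewrite dotC.
have vb : dot v b = lam * dot u b + - (2 * s) * dot p b by rewrite dotDl !dotZl.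
have h1 : dot v (fib H0 v) <= c * dot v (fib H v) by exact: quad_le.
have h2 : 0 <= dot y (fib H0 y) by exact: quad_ge0.
move: vH yH0 h2; rewrite /= -/v -/y => vH yH0; rewrite yH0 H0N Nb vb => h2.
rewrite dotDr !dotZr.
move: h1 vH h2; rewrite -/c.
move: (dot v (fib H0 v)) (dot v (fib H v)) (dot u (fib H u)) (dot u (fib H p)) (dot u b) (dot p b)
  (dot p (fib H p)) (dot b (fib (invmx H0) b)) => v0 vv uu up ub pb pp bb h1 vH h2.
rewrite -(@pmulr_rge0 _ c) //.
apply: (le_trans h2); rewrite expr1n mul1r mulr1.
have : c * vv = c * (lam ^+ 2 * uu + 2 * lam * - (2 * s) * up + (- (2 * s)) ^+ 2 * pp) by rewrite vH.
move: h1; move: (c * vv) => cvv h1 E; move: h1; rewrite E => h1.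
apply: (@le_trans _ _ (c * (lam ^+ 2 * uu + 2 * lam * - (2 * s) * up + (- (2 * s)) ^+ 2 * pp)
  + 2 * c * (lam * ub + - (2 * s) * pb) + c ^+ 2 * bb)); first by lra.
by rewrite le_eqVlt; apply/orP; left; apply/eqP; ring.
Qed.

End completing_squares.

(** * Testing against a Gaussian *)

Section gaussian.
Context {R : realType} {n : nat}.
Implicit Types (F G : 'rV[R]_n -> R) (x : 'rV[R]_n).

Definition gauss x0 (s : R) x : R := expR (- (s * sqdist x0 x)).

Lemma CkT_gauss k x0 s : CkT k (gauss x0 s).
Proof. by apply: CkT_expR; apply: CkTN; apply: CkTZ; exact: CkT_sqdist. Qed.

Lemma gauss_gt0 x0 s x : 0 < gauss x0 s x.
Proof. exact: expR_gt0. Qed.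

Lemma isPd_gauss x0 s i x :
  isPd i (gauss x0 s) x (gauss x0 s x * (- (2 * s) * (x 0 i - x0 0 i))).
Proof.
have h := isPd_comp (@is_derive_expR _ _) (isPdN (isPdZ s (isPd_sqdist x0 i x))).
by apply: isPd_eq h _; rewrite -/(gauss x0 s x); ring.
Qed.

Lemma intg_gauss x0 a s F : 0 < a -> continuous F -> supp_in x0 a F ->
  intg (fun x => F x * gauss x0 s x).
Proof.
move=> a0 cF sF; apply: (@intg_compact_support _ _ x0 a) => //; last exact: supp_inMl.
by have := CkTM (conj cF I : CkT 0 F) (CkT_gauss 0 x0 s) => /CkT_continuous.
Qed.

(** The divergence of the compactly supported field [W] times the Gaussian integrates to zero, and
    differentiating the Gaussian brings down - 2 s (x - x0). *)
Lemma Int_gauss_parts x0 a s (W : 'I_n -> 'rV[R]_n -> R) : 0 < a ->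
  (forall i, CkT 1 (W i)) -> (forall i, supp_in x0 a (W i)) ->
  Int (fun x => (\sum_i pd i (W i) x) * gauss x0 s x) =
  2 * s * Int (fun x => (\sum_i (x 0 i - x0 0 i) * W i x) * gauss x0 s x).
Proof.
move=> a0 cW sW; have cWi i := CkT_continuous (cW i).
have cdW i := CkT_continuous (CkT_pd i (cW i)).
have cyW : continuous (fun x => \sum_i (x 0 i - x0 0 i) * W i x).
  apply: (@CkT_continuous _ _ 1); apply: CkT_sum => i _.
  by apply: CkTM => //; exact: CkT_coordB.
have i1 : intg (fun x => (\sum_i pd i (W i) x) * gauss x0 s x).
  apply: (@intg_gauss x0 a) => //.
    by apply: (@CkT_continuous _ _ 0); apply: CkT_sum => i _; exact: CkT_pd (cW i).
  by apply: supp_in_sum => i _; exact: supp_in_pd.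
have i2 : intg (fun x => (\sum_i (x 0 i - x0 0 i) * W i x) * gauss x0 s x).
  by apply: (@intg_gauss x0 a) => //; apply: supp_in_sum => i _; exact: supp_inMr.
apply/eqP; rewrite -subr_eq0 -IntZ // -IntB //; last exact: intgZ.
have cWE i : CkT 1 (fun x => W i x * gauss x0 s x)
  by exact: (CkTM (cW i) (CkT_gauss 1 x0 s)).
have sWE i : supp_in x0 a (fun x => W i x * gauss x0 s x) by exact: supp_inMl.
rewrite -[X in _ == X](_ : \sum_i Int (pd i (fun x => W i x * gauss x0 s x)) = 0); last first.
  by apply: big1 => i _; exact: (Int_pd i a0 (cWE i) (sWE i)).
rewrite -Int_sum; last first.
  move=> i _; apply: (@intg_compact_support _ _ x0 a) => //.
    exact: CkT_continuous (CkT_pd i (cWE i)).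
  exact: supp_in_pd.
apply/eqP; apply: Int_eq => x; rewrite !mulr_suml mulr_sumr -sumrB; apply: eq_bigr => i _.
rewrite (isPdE (isPdM (CkT_isPd i x (cW i)) (isPd_gauss x0 s i x))).
by move: (pd i (W i) x) (W i x) (gauss x0 s x) (x 0 i - x0 0 i) => u v w z; ring.
Qed.

Lemma sqdist_le_box x0 a x : box x0 a x -> sqdist x0 x <= n%:R * a ^+ 2.
Proof.
move=> xa; rewrite -[n in n%:R](card_ord n) mulr_natl -sumr_const; apply: ler_sum => j _.
by rewrite -real_normK ?num_real // lerXn2r ?nnegrE //; apply: le_trans (xa j).
Qed.

(** After exp (- s m / 4) is factored out, a decay of at least exp (- s m / 2) remains, and t^2 exp
    (- t) <= 4 shows that it beats the linear factor 1 + s. *)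
Lemma gauss_large_ratio (A B m e : R) : 0 <= A -> 0 < B -> 0 < m ->
  exists2 s : R, e < s /\ 0 < s & A * (1 + s) * expR (- (s * m)) < B * expR (- (s * (m / 4))).
Proof.
(* For s >= 1 one has 1 + s <= 2 s, and s^2 m^2 exp (- s m / 2) <= 16; hence s m^2 B > 32 A is
   enough, and this is s > k. *)
move=> A0 B0 m0; pose k := 32 * A / (m ^+ 2 * B); pose s := `|e| + 1 + k.
have k0 : 0 <= k by rewrite divr_ge0 ?mulr_ge0 // ?exprn_ge0 ltW.
have s1 : 1 <= s by have := normr_ge0 e; rewrite /s; move: k0; clear; lra.
have s0 : 0 < s by lra.
have es : e < s by have := ler_norm e; rewrite /s; lra.
exists s => //.
have m20 : 0 < m ^+ 2 by rewrite exprn_gt0.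
have ks : k < s by have := normr_ge0 e; rewrite /s; lra.
have hk : 32 * A < s * (m ^+ 2 * B) by rewrite -ltr_pdivrMr // mulr_gt0.
have sm : 0 < s * m by exact: mulr_gt0.
have E1 : expR (- (s * m)) <= expR (- (s * (m / 4))) * expR (- (s * m / 2)).
  by rewrite -expRD ler_expR; lra.
have E2 : (s * m / 2) ^+ 2 * expR (- (s * m / 2)) <= 4.
  have := @expR_ge_pow R 2 (s * m / 2); rewrite expRN => h.
  rewrite ler_pdivrMr ?expR_gt0 //; apply: le_trans (h _) _; first by lra.
  by rewrite (_ : 2%:R ^+ 2 = 4) //; ring.
move: E1 E2; have := expR_gt0 (- (s * (m / 4))); have := expR_gt0 (- (s * m / 2)).
move: (expR (- (s * m))) (expR (- (s * (m / 4)))) (expR (- (s * m / 2))) => X Y Z Z0 Y0 E1 E2.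
apply: (@le_lt_trans _ _ (A * (1 + s) * (Y * Z))).
  by rewrite ler_wpM2l // mulr_ge0 //; lra.
rewrite mulrCA mulrC ltr_pM2r //.
have E2' : s ^+ 2 * m ^+ 2 * Z <= 16 by rewrite (_ : _ * Z = 4 * ((s * m / 2) ^+ 2 * Z)); [lra|field].
have : A * (1 + s) * Z * (s * m ^+ 2) < B * (s * m ^+ 2); last by rewrite ltr_pM2r // mulr_gt0.
apply: (@le_lt_trans _ _ (2 * A * (s ^+ 2 * m ^+ 2 * Z))).
  rewrite -subr_ge0 (_ : _ - _ = A * Z * m ^+ 2 * s * (s - 1)); last by ring.
  by rewrite !mulr_ge0 ?(ltW m20) ?(ltW s0) ?(ltW Z0) //; lra.
apply: (@le_lt_trans _ _ (2 * A * 16)); first by rewrite ler_wpM2l //; lra.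
by rewrite (_ : B * _ = s * (m ^+ 2 * B)); [lra|ring].
Qed.

(* Under the weight [gauss x0 s], [s] large, the sign at the centre dominates, even against
   a linearly growing perturbation supported away from the centre. *)
Lemma gauss_concentration x0 a e F G : 0 < a -> continuous F -> continuous G ->
  supp_in x0 a F -> supp_in x0 a G -> F x0 < 0 ->
  (exists2 m : R, 0 < m & forall x, sqdist x0 x < m -> G x = 0) ->
  exists2 s : R, e < s /\ 0 < s & Int (fun x => (F x + 2 * s * G x) * gauss x0 s x) < 0.
Proof.
move=> a0 cF cG sF sG F0 [m1 m10 G0]; pose c := - F x0 / 2.
have c0 : 0 < c by rewrite /c; lra.
have [d d0 hd] := continuous_box (cF x0) c0.
have Fc x : box x0 d x -> F x <= - c.
  by move=> /hd; rewrite ltr_norml => /andP[_]; rewrite /c; lra.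
pose m := Num.min (d ^+ 2) m1.
have m0 : 0 < m by rewrite lt_min exprn_gt0.
have md x : sqdist x0 x < m -> box x0 d x.
  move=> h; apply: sqdist_box (ltW d0) _; apply: ltW (lt_le_trans h _).
  by rewrite ge_min lexx.
have mG x : sqdist x0 x < m -> G x = 0.
  by move=> h; apply: G0; apply: lt_le_trans h _; rewrite ge_min lexx orbT.
have [CF CF0 hCF] := bounded_compact_support cF sF.
have [CG CG0 hCG] := bounded_compact_support cG sG.
pose C := CF + 2 * CG; have C0 : 0 <= C by rewrite /C; lra.
(* The box of half-width [dl] lies where [sqdist] is at most m / 4, so the Gaussian is at least exp
   (- s m / 4) on it; [n.+1] keeps the quotient positive when n = 0. *)
pose dl := Num.sqrt (m / (4 * n.+1%:R)).
have n1 : 0 < n.+1%:R :> R by rewrite ltr0n.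
have dl2 : dl ^+ 2 = m / (4 * n.+1%:R) by rewrite sqr_sqrtr // divr_ge0 ?mulr_ge0 ?ltW.
have dl0 : 0 < dl by rewrite sqrtr_gt0 divr_gt0 // mulr_gt0.
have dlm x : box x0 dl x -> sqdist x0 x <= m / 4.
  move=> /sqdist_le_box h; apply: le_trans h _; rewrite dl2.
  have : n%:R <= n.+1%:R :> R by rewrite ler_nat.
  move: n1; move: (n.+1%:R) (n%:R : R) => N k N0 kN.
  have N00 : N != 0 by rewrite gt_eqF.
  rewrite (_ : k * _ = m / 4 * (k / N)); last by field.
  by rewrite ler_piMr // ?divr_ge0 ?(ltW m0) // ler_pdivrMr // mul1r.
have K10 : 0 < c * (2 * dl) ^+ n by rewrite mulr_gt0 // exprn_gt0 // mulr_gt0.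
have K20 : 0 <= C * (2 * a) ^+ n by rewrite mulr_ge0 // exprn_ge0 // mulr_ge0 // ltW.
have [s [es s0] hs] := @gauss_large_ratio _ _ m e K20 K10 m0.
exists s => //.
(* A majorant by two boxes: the negative part uses F <= - c on the small one, the positive part
   bounds everything at distance [sqdist] at least [m], where the Gaussian is at most exp (- s
   m). *)
pose U x := - (c * expR (- (s * (m / 4)))) * \1_(box x0 dl) x
  + C * (1 + s) * expR (- (s * m)) * \1_(box x0 a) x.
have iU1 := intgZ (- (c * expR (- (s * (m / 4))))) (@intg_box R n x0 dl dl0).
have iU2 := intgZ (C * (1 + s) * expR (- (s * m))) (@intg_box R n x0 a a0).
have IU : Int U = - (c * expR (- (s * (m / 4)))) * (2 * dl) ^+ n
    + C * (1 + s) * expR (- (s * m)) * (2 * a) ^+ n.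
  by rewrite /U IntD // !IntZ ?Int_box //; exact: intg_box.
apply: (@le_lt_trans _ _ (Int U)); last first.
  rewrite IU; move: hs; move: (expR _) (expR _) ((2 * dl) ^+ n) ((2 * a) ^+ n) => X Y K1 K2 hs.
  rewrite -subr_gt0 in hs; rewrite -subr_gt0.
  by rewrite (_ : 0 - _ = c * K1 * X - C * K2 * (1 + s) * Y) //; ring.
have cFG : continuous (fun x => F x + 2 * s * G x).
  exact: CkT_continuous (CkTD (conj cF I : CkT 0 F) (CkTZ (2 * s) (conj cG I : CkT 0 G))).
have sFG : supp_in x0 a (fun x => F x + 2 * s * G x).
  by apply: supp_inD => //; exact: supp_inMr.
apply: Int_le; [exact: intg_gauss cFG sFG|exact: intgD|move=> x].
have T2 : 0 <= C * (1 + s) * expR (- (s * m)) * \1_(box x0 a) x.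
  by rewrite !mulr_ge0 ?expR_ge0 ?indicE ?ler0n //; lra.
have [xm|xm] := ltP (sqdist x0 x) m.
  rewrite (mG _ xm) mulr0 addr0 /U.
  have Fx := Fc _ (md _ xm).
  apply: (@le_trans _ _ (- c * gauss x0 s x)); first by rewrite ler_pM2r // gauss_gt0.
  apply: (@le_trans _ _ (- (c * expR (- (s * (m / 4)))) * \1_(box x0 dl) x)); last by rewrite lerDl.
  rewrite !mulNr lerN2 -mulrA ler_pM2l // indicE.
  have [xb|xb] := boolP (x \in box x0 dl); last by rewrite mulr0 ltW // gauss_gt0.
  rewrite inE in xb; rewrite mulr1 /gauss ler_expR lerN2 ler_pM2l //; exact: dlm.
rewrite /U (_ : \1_(box x0 dl) x = 0); last first.
  rewrite indicE memNset // => /dlm h; have := le_trans xm h; apply/negP; rewrite -ltNge; lra.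
rewrite mulr0 add0r; have [xa|xa] := ltP (a ^+ 2) (sqdist x0 x).
  by rewrite sF // sG // mulr0 addr0 mul0r.
rewrite (_ : \1_(box x0 a) x = 1) ?mulr1; last first.
  by rewrite indicE mem_set //; apply: sqdist_box => //; exact: ltW.
have h1 : F x + 2 * s * G x <= C * (1 + s).
  have := hCF x; have := hCG x; rewrite !ler_norml /C => /andP[_ hG] /andP[_ hF].
  have h2 : s * G x <= s * CG by rewrite ler_wpM2l // ltW.
  have h3 : 0 <= s * CF by rewrite mulr_ge0 // ltW.
  rewrite (_ : 2 * s * G x = 2 * (s * G x)); last by ring.
  rewrite (_ : _ * (1 + s) = CF + 2 * CG + (s * CF + 2 * (s * CG))); last by ring.
  by move: h2 h3; lra.
apply: (@le_trans _ _ (C * (1 + s) * gauss x0 s x)); first by rewrite ler_pM2r // gauss_gt0.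
rewrite ler_wpM2l //; first by rewrite mulr_ge0 // addr_ge0 // ltW.
by rewrite /gauss ler_expR lerN2 ler_pM2l.
Qed.

End gaussian.

(** * Fields of forms: regularity and support *)

Section smooth_forms.
Context {R : realType} {n r : nat}.
Implicit Types (a b : 'rV[R]_n -> fform R n r) (H : 'rV[R]_n -> 'M[R]_r).

Definition CkF k a : Prop := forall I t, CkT k (fun x => a x I t).
Definition CkM k H : Prop := forall s t, CkT k (fun x => H x s t).
Definition suppF x0 rho a : Prop := forall I t, supp_in x0 rho (fun x => a x I t).

Lemma CkT_dot k a b : CkF k a -> CkF k b -> CkT k (fun x => dot (a x) (b x)).
Proof.
by move=> ha hb; apply: CkT_sum => I _; apply: CkT_sum => t _; exact: CkTM.
Qed.

Lemma CkF_fib k H a : CkM k H -> CkF k a -> CkF k (fun x => fib (H x) (a x)).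
Proof. by move=> hH ha I t; apply: CkT_sum => s _; exact: CkTM. Qed.

Lemma CkF_inter k i a : CkF k a -> CkF k (fun x => inter i (a x)).
Proof.
move=> ha I t; rewrite (_ : (fun _ => _) = fun x => (i \notin I)%:R *
   ((-1) ^+ #|[set k in I | (k < i)%N]| * a x (i |: I) t)).
  by apply: CkTZ; apply: CkTZ; exact: ha.
by apply/funext => x; rewrite interE.
Qed.

Lemma CkF_wedge k i a : CkF k a -> CkF k (fun x => wedge i (a x)).
Proof.
move=> ha I t; rewrite (_ : (fun _ => _) = fun x => (i \in I)%:R *
   ((-1) ^+ #|[set k in I | (k < i)%N]| * a x (I :\ i) t)).
  by apply: CkTZ; apply: CkTZ; exact: ha.
by apply/funext => x; rewrite wedgeE.
Qed.

Lemma CkF_sum k (T : Type) (s : seq T) (P : pred T) (F : T -> 'rV[R]_n -> fform R n r) :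
  (forall j, P j -> CkF k (F j)) -> CkF k (fun x I t => \sum_(j <- s | P j) F j x I t).
Proof. by move=> h I t; apply: CkT_sum => j Pj; exact: h. Qed.

Lemma CkF_scale k c a : CkT k c -> CkF k a -> CkF k (fun x I t => c x * a x I t).
Proof. by move=> hc ha I t; exact: CkTM. Qed.

Lemma CkF_pd k i a : CkF k.+1 a -> CkF k (fun x I t => pd i (fun y => a y I t) x).
Proof. by move=> ha I t; exact: CkT_pd (ha I t). Qed.

Lemma isPd_wedge i j a x : CkF 1 a -> forall I t,
  isPd i (fun y => wedge j (a y) I t) x (wedge j (fun J s => pd i (fun y => a y J s) x) I t).
Proof.
move=> ha I t; rewrite wedgeE; under [X in isPd _ X]funext do rewrite wedgeE.
by apply: isPdZ; apply: isPdZ; exact: CkT_isPd (ha _ _).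
Qed.

(** Second derivatives are symmetric while exterior multiplications anticommute. *)
Lemma extd_extd a x : CkF 2 a -> extd (extd a) x = fun _ _ => 0.
Proof.
move=> ha; apply: fform_ext => J t; rewrite /extd.
have ha1 i : CkF 1 (fun x I t => pd i (fun y => a y I t) x) by exact: CkF_pd.
have E i : (fun I s => pd i (fun y => \sum_j wedge j (fun I s => pd j (fun y => a y I s) y) I s) x)
   = fun I s => \sum_j wedge j (fun I s => pd i (pd j (fun y => a y I s)) x) I s.
  apply: fform_ext => I s; apply: isPdE; apply: isPd_sum => j _.
  exact: (isPd_wedge i j x (ha1 j)).
under eq_bigr => i _ do rewrite E wedge_sum.
apply: (@sum_wedge_wedge_sym R n r (fun i k I s => pd i (pd k (fun y => a y I s)) x)) => i j.
apply: fform_ext => I s; apply: (@pd_sym _ _ setT) => //; first exact: openT.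
by apply/CkTP; exact: ha.
Qed.

Lemma suppF_dotl x0 rho a b : suppF x0 rho a -> supp_in x0 rho (fun x => dot (a x) (b x)).
Proof.
by move=> ha; apply: supp_in_sum => I _; apply: supp_in_sum => t _; exact: supp_inMl.
Qed.

Lemma suppF_fib x0 rho H a : suppF x0 rho a -> suppF x0 rho (fun x => fib (H x) (a x)).
Proof. by move=> ha I t; apply: supp_in_sum => s _; exact: supp_inMr. Qed.

Lemma suppF_inter x0 rho i a : suppF x0 rho a -> suppF x0 rho (fun x => inter i (a x)).
Proof. by move=> ha I t x xr; rewrite interE ha // !mulr0. Qed.

Lemma suppF_wedge x0 rho i a : suppF x0 rho a -> suppF x0 rho (fun x => wedge i (a x)).
Proof. by move=> ha I t x xr; rewrite wedgeE ha // !mulr0. Qed.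

Lemma suppF_sum x0 rho (T : Type) (s : seq T) (P : pred T) (F : T -> 'rV[R]_n -> fform R n r) :
  (forall j, P j -> suppF x0 rho (F j)) -> suppF x0 rho (fun x I t => \sum_(j <- s | P j) F j x I t).
Proof. by move=> h I t; apply: supp_in_sum => j Pj; exact: h. Qed.

Lemma suppF_scale x0 rho c a : suppF x0 rho a -> suppF x0 rho (fun x I t => c x * a x I t).
Proof. by move=> ha I t; exact: supp_inMr. Qed.

Lemma suppF_pd x0 rho i a : suppF x0 rho a -> suppF x0 rho (fun x I t => pd i (fun y => a y I t) x).
Proof. by move=> ha I t; exact: supp_in_pd. Qed.

End smooth_forms.

(** * Measurability and local integrability *)

Section measurability.
Context {R : realType} {n r : nat}.

Notation mfun f := (measurable_fun (setT : set (borelT R n)) f).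

Lemma mfun_sum (T : Type) (s : seq T) (P : pred T) (F : T -> 'rV[R]_n -> R) :
  (forall j, P j -> mfun (F j)) -> mfun (fun x => \sum_(j <- s | P j) F j x).
Proof.
move=> h; elim: s => [|j s IH].
  by rewrite (_ : (fun _ => _) = fun _ => 0);
    [exact: measurable_cst|apply/funext => x; rewrite big_nil].
have [Pj|Pj] := boolP (P j).
  rewrite (_ : (fun _ => _) = fun x => F j x + \sum_(j <- s | P j) F j x).
    by apply: measurable_funD => //; exact: h.
  by apply/funext => x; rewrite big_cons Pj.
rewrite (_ : (fun _ => _) = fun x => \sum_(j <- s | P j) F j x) //.
by apply/funext => x; rewrite big_cons (negbTE Pj).
Qed.

Lemma mfun_quad (a : 'rV[R]_n -> fform R n r) (G : 'rV[R]_n -> 'M[R]_r) :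
  (forall I t, mfun (fun x => a x I t)) -> (forall s t, mfun (fun x => G x s t)) ->
  mfun (fun x => dot (a x) (fib (G x) (a x))).
Proof.
move=> ha hG; apply: mfun_sum => I _; apply: mfun_sum => t _.
by apply: measurable_funM => //; apply: mfun_sum => s _; exact: measurable_funM.
Qed.

Lemma mfun_wedge i (a : 'rV[R]_n -> fform R n r) :
  (forall I t, mfun (fun x => a x I t)) -> forall J t, mfun (fun x => wedge i (a x) J t).
Proof.
move=> ha J t; rewrite (_ : (fun _ => _) = fun x => (i \in J)%:R *
   ((-1) ^+ #|[set k in J | (k < i)%N]| * a x (J :\ i) t)).
  by apply: measurable_funM => //; exact: measurable_funM.
by apply/funext => x; rewrite wedgeE.
Qed.

Lemma wedge_sqr_le i (a : fform R n r) J t : wedge i a J t ^+ 2 <= dot a a.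
Proof.
have comp I s : a I s ^+ 2 <= dot a a.
  rewrite /dot (bigD1 I) //= (bigD1 s) //= -expr2 -addrA lerDl addr_ge0 //.
    by apply: sumr_ge0 => k _; rewrite -expr2 sqr_ge0.
  by apply: sumr_ge0 => K _; apply: sumr_ge0 => k _; rewrite -expr2 sqr_ge0.
rewrite wedgeE; case: (i \in J); rewrite ?mul1r ?mul0r.
  by rewrite exprMn sqrr_sign mul1r; exact: comp.
rewrite expr0n /=; apply: sumr_ge0 => K _; apply: sumr_ge0 => k _.
by rewrite -expr2 sqr_ge0.
Qed.

(** By Young's inequality the product is dominated by k^2 + W. In this way [u], which is only square
    integrable, can be paired with smooth compactly supported functions. *)
Lemma intg_mul_local x0 rho (k w W : 'rV[R]_n -> R) : 0 < rho -> continuous k ->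
  supp_in x0 rho k -> mfun w -> intg W -> (forall x, 0 <= W x) ->
  (forall x, sqdist x0 x <= rho ^+ 2 -> w x ^+ 2 <= W x) -> intg (fun x => k x * w x).
Proof.
move=> r0 ck sk mw iW W0 wW.
have ck2 : continuous (fun x => k x * k x).
  exact: CkT_continuous (CkTM (conj ck I : CkT 0 k) (conj ck I : CkT 0 k)).
have sk2 : supp_in x0 rho (fun x => k x * k x) by exact: supp_inMl.
have ik2 := intg_compact_support r0 ck2 sk2.
apply: (@intg_le _ _ _ (fun x => k x * k x + W x)); last 1 first.
- move=> x; have [xr|xr] := ltP (rho ^+ 2) (sqdist x0 x).
    by rewrite sk // !mul0r normr0 add0r.
  apply: le_trans (norm_mul_le _ _) _; have := wW _ xr; rewrite expr2.
  have := W0 x; have : 0 <= k x * k x by rewrite -expr2 sqr_ge0.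
  by move: (k x * k x) (w x * w x) (W x) => A B C; lra.
- by apply: measurable_funM => //; exact: continuous_borel_fun.
- exact: intgD.
Qed.

Lemma sintD_Int (D : set 'rV[R]_n) x0 rho F : [set x | sqdist x0 x <= rho ^+ 2] `<=` D ->
  supp_in x0 rho F -> intg F -> sintD D F = (Int F)%:E.
Proof.
move=> BD sF iF; rewrite /sintD /iintD.
have E : (fun x => if `[< D x >] then (Num.max (F x) 0)%:E else 0%E) = fun x => (Num.max (F x) 0)%:E.
  apply/funext => x; case: (asboolP (D x)) => // nDx; rewrite sF ?maxxx //.
  by rewrite ltNge; apply/negP => /BD.
have E' : (fun x => if `[< D x >] then (Num.max (- F x) 0)%:E else 0%E) = fun x => (Num.max (- F x) 0)%:E.
  apply/funext => x; case: (asboolP (D x)) => // nDx; rewrite sF ?oppr0 ?maxxx //.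
  by rewrite ltNge; apply/negP => /BD.
have mF := intg_measurable iF.
have mp : mfun (fun x => (Num.max (F x) 0)%:E).
  by apply/measurable_EFinP; apply: measurable_maxr => //; exact: measurable_cst.
have mn : mfun (fun x => (Num.max (- F x) 0)%:E).
  apply/measurable_EFinP; apply: measurable_maxr; last exact: measurable_cst.
  exact: intg_measurable (intgN iF).
have p0 x : (0 <= (Num.max (F x) 0)%:E)%E by rewrite lee_fin le_max lexx orbT.
have n0 x : (0 <= (Num.max (- F x) 0)%:E)%E by rewrite lee_fin le_max lexx orbT.
rewrite E E' (iintE mp p0) (iintE mn n0).
rewrite /Int /Rintegral fineK; last exact: integrable_fin_num iF.
rewrite [RHS]integralE; congr (_ - _)%E; apply: eq_integral => x _.
  by rewrite funeposE -EFin_max.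
by rewrite funenegE -EFinN -EFin_max.
Qed.

End measurability.

Lemma dot0 {R : realType} {n r : nat} (b : fform R n r) :
  dot (fun _ _ => 0) b = 0.
Proof. by rewrite /dot big1 // => I _; rewrite big1 // => t _; rewrite mul0r. Qed.

Lemma fib0 {R : realType} {n r : nat} (M : 'M[R]_r) :
  fib M (fun _ _ => 0) = (fun _ _ => 0) :> fform R n r.
Proof. by apply: fform_ext => I t; rewrite /fib big1 // => s _; rewrite mulr0. Qed.

(** * The integral inequality satisfied by the test form *)

Section test_form.
Context {R : realType} {n r q : nat}.
Variables (x0 : 'rV[R]_n) (rho : R) (H : 'rV[R]_n -> 'M[R]_r) (f : 'rV[R]_n -> fform R n r).
Hypotheses (rho0 : 0 < rho) (smH : forall k, CkM k H) (smf : forall k, CkF k f).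
Hypotheses (sf : suppF x0 rho f) (symH : forall x, (H x)^T = H x) (qf : forall x, is_qform q (f x)).

(* With [p = radial], [b = codiff], [y = x - x0] and [E = gauss x0 s], integration by parts
   trades a factor [2 s y] for a divergence: [Phi], [Ups], [Gam] arise in this way from
   [2 s p.Hp E], [2 s p.b E] and [2 s |y|^2 energy E]. *)
Definition Hf x := fib (H x) (f x).
Definition radial (x : 'rV[R]_n) : fform R n r := fun I t => \sum_j (x 0 j - x0 0 j) * inter j (f x) I t.
Definition codiff x : fform R n r :=
  fun I t => \sum_i inter i (fun J s => pd i (fun y => Hf y J s) x) I t.
Definition energy x := dot (f x) (Hf x).
Definition Phi x := \sum_i pd i (fun y => dot (inter i (f y)) (fib (H y) (radial y))) x.
Definition Psi x := dot (radial x) (codiff x).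
Definition Ups x := \sum_i pd i (fun y => dot (inter i (f y)) (codiff y)) x.
Definition Gam x := \sum_i pd i (fun y => (y 0 i - x0 0 i) * energy y) x.
Definition tested s x : fform R n r := fun I t => 2 * s * fib (H x) (radial x) I t + -1 * codiff x I t.
Lemma smHf k : CkF k Hf. Proof. exact: CkF_fib. Qed.
Lemma sHf : suppF x0 rho Hf. Proof. exact: suppF_fib. Qed.

Lemma smradial k : CkF k radial.
Proof. by apply: CkF_sum => j _; apply: CkF_scale; [exact: CkT_coordB|exact: CkF_inter]. Qed.
Lemma sradial : suppF x0 rho radial.
Proof. by apply: suppF_sum => j _; apply: suppF_scale; exact: suppF_inter. Qed.

Lemma smcodiff k : CkF k codiff.
Proof. by apply: CkF_sum => i _; exact: (CkF_inter i (CkF_pd i (smHf k.+1))). Qed.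
Lemma scodiff : suppF x0 rho codiff.
Proof. by apply: suppF_sum => i _; exact: (suppF_inter i (suppF_pd i sHf)). Qed.

Lemma smenergy k : CkT k energy. Proof. by apply: CkT_dot => //; exact: smHf. Qed.
Lemma senergy : supp_in x0 rho energy. Proof. exact: suppF_dotl. Qed.

(** The formal adjoint of d applied to the test form: derivatives of the Gaussian produce the
    [radial] part of [tested], derivatives of [Hf] the [codiff] part, and adjointness moves [wedge]
    off [u]. *)
Lemma test_pointwise (u : fform R n r) s x :
  \sum_J \sum_t \sum_i pd i (fun y => Hf y J t * gauss x0 s y) x * wedge i u J t =
  - (dot u (tested s x) * gauss x0 s x).
Proof.
pose K i : fform R n r := fun J t => pd i (fun y => Hf y J t * gauss x0 s y) x.
have KE i : K i = fun J t => gauss x0 s x * (pd i (fun y => Hf y J t) x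
    + (- (2 * s) * (x 0 i - x0 0 i)) * Hf x J t).
  apply: fform_ext => J t; apply: isPdE; apply: isPd_eq.
    exact: isPdM (CkT_isPd i x (smHf 1 J t)) (isPd_gauss x0 s i x).
  by move: (pd i _ x) (Hf x J t) (gauss x0 s x) (x 0 i - x0 0 i) => A B C y; ring.
transitivity (\sum_i dot (wedge i u) (K i)).
  rewrite [RHS]exchange_big; apply: eq_bigr => J _ /=; rewrite [RHS]exchange_big.
  by apply: eq_bigr => t _; apply: eq_bigr => i _; rewrite mulrC.
have E i : dot (wedge i u) (K i) = gauss x0 s x *
  (dot u (inter i (fun J t => pd i (fun y => Hf y J t) x))
   - (2 * s) * ((x 0 i - x0 0 i) * dot u (fib (H x) (inter i (f x))))).
  have -> : dot (wedge i u) (K i) = dot u (fun J t => gauss x0 s x *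
      (inter i (fun J t => pd i (fun y => Hf y J t) x) J t
       + (- (2 * s) * (x 0 i - x0 0 i)) * fib (H x) (inter i (f x)) J t)).
    rewrite dot_wedge KE; congr dot; apply: fform_ext => J t; rewrite interZ -inter_fib.
    congr (_ * _); rewrite !interE -/(Hf x).
    by move: (pd i _ x) (Hf x _ _) (x 0 i - x0 0 i) => A B y; ring.
  rewrite dotZr dotDr dotZr.
  by move: (dot u _) (dot u _) (gauss x0 s x) (x 0 i - x0 0 i) => A B C y; ring.
under eq_bigr => i _ do rewrite E.
rewrite -mulr_sumr sumrB -mulr_sumr -dot_sumr -/(codiff x).
have -> : \sum_i (x 0 i - x0 0 i) * dot u (fib (H x) (inter i (f x))) = dot u (fib (H x) (radial x)).
  rewrite /radial fib_sum dot_sumr; apply: eq_bigr => i _.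
  by rewrite fibZ dotZr.
by rewrite /tested dotDr !dotZr; ring.
Qed.

(** [weak_d] tests one coefficient at a time, so each coefficient of the test form serves as a
    scalar test function and the equations are summed. [W] is an integrable majorant of |u|^2 on the
    ball. *)
Lemma tested_equation (D : set 'rV[R]_n) (u : 'rV[R]_n -> fform R n r) W s :
  [set x | sqdist x0 x <= rho ^+ 2] `<=` D ->
  (forall I t, measurable_fun (setT : set (borelT R n)) (fun x => u x I t)) ->
  intg W -> (forall x, 0 <= W x) ->
  (forall x, sqdist x0 x <= rho ^+ 2 -> dot (u x) (u x) <= W x) ->
  weak_d D u f ->
  intg (fun x => dot (u x) (tested s x) * gauss x0 s x) /\
  Int (fun x => energy x * gauss x0 s x) = Int (fun x => dot (u x) (tested s x) * gauss x0 s x).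
Proof.
move=> BD mu iW W0 uW wd.
pose chi J t y := Hf y J t * gauss x0 s y.
have cchi k J t : CkT k (chi J t) by apply: CkTM; [exact: smHf|exact: CkT_gauss].
have schi J t : supp_in x0 rho (chi J t) by apply: supp_inMl; exact: sHf.
have ik J t i : intg (fun x => pd i (chi J t) x * wedge i (u x) J t).
  apply: (@intg_mul_local _ _ x0 rho _ _ W) => //.
  - exact: CkT_continuous (CkT_pd i (cchi 1 J t)).
  - exact: supp_in_pd.
  - exact: mfun_wedge.
  - by move=> x /uW; apply: le_trans; exact: wedge_sqr_le.
have iF2 J t : intg (fun x => \sum_i pd i (chi J t) x * wedge i (u x) J t).
  by apply: intg_sum.
have cfchi J t : continuous (fun x => f x J t * chi J t x).
  exact: CkT_continuous (CkTM (smf 0 J t) (cchi 0 J t)).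
have sfchi J t : supp_in x0 rho (fun x => f x J t * chi J t x) by exact: supp_inMl.
have iF1 J t : intg (fun x => f x J t * chi J t x)
  by exact: (intg_compact_support rho0 (cfchi J t) (sfchi J t)).
have eqJ J t : Int (fun x => f x J t * chi J t x) =
    - Int (fun x => \sum_i pd i (chi J t) x * wedge i (u x) J t).
  have sm : smooth_on setT (chi J t) by move=> k; apply/CkTP.
  have cs : compact_support_in D (chi J t).
    exists [set x | sqdist x0 x <= rho ^+ 2]; split => //; first exact: compact_sqdist_le.
    by move=> x /= /negP; rewrite -ltNge; exact: schi.
  have := wd (chi J t) sm cs J t.
  rewrite (sintD_Int BD (sfchi J t) (iF1 J t)).
  have -> : (fun x => \sum_i wedge i (fun I s => u x I s * pd i (chi J t) x) J t) =
      fun x => \sum_i pd i (chi J t) x * wedge i (u x) J t.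
    apply/funext => x; apply: eq_bigr => i _; rewrite -wedgeZ.
    by congr wedge; apply: fform_ext => I t'; rewrite mulrC.
  rewrite (sintD_Int BD _ (iF2 J t)); first by rewrite -EFinN => -[].
  by apply: supp_in_sum => i _; apply: supp_inMl; exact: supp_in_pd.
have PW x := test_pointwise (u x) s x.
have iS : intg (fun x => \sum_J \sum_t \sum_i pd i (chi J t) x * wedge i (u x) J t).
  by apply: intg_sum => J _; apply: intg_sum => t _.
have iN : intg (fun x => dot (u x) (tested s x) * gauss x0 s x).
  by apply: intg_eq (intgN iS) => x; rewrite PW opprK.
split=> //.
transitivity (\sum_J \sum_t Int (fun x => f x J t * chi J t x)).
  under [RHS]eq_bigr => J _ do rewrite -Int_sum //.
  rewrite -Int_sum; last by move=> J _; apply: intg_sum.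
  apply: Int_eq => x; rewrite /energy /dot mulr_suml; apply: eq_bigr => J _.
  by rewrite mulr_suml; apply: eq_bigr => t _; rewrite /chi mulrA.
under eq_bigr => J _ do (under eq_bigr => t _ do rewrite eqJ; rewrite sumrN -Int_sum //).
rewrite sumrN -Int_sum; last by move=> J _; apply: intg_sum.
by rewrite -IntN //; apply: Int_eq => x; rewrite PW opprK.
Qed.

Lemma radial_dot (x : 'rV[R]_n) (b : fform R n r) :
  \sum_i (x 0 i - x0 0 i) * dot (inter i (f x)) b = dot (radial x) b.
Proof. by rewrite /radial dot_suml; apply: eq_bigr => i _; rewrite dotZl. Qed.

Lemma Int_Phi s : Int (fun x => Phi x * gauss x0 s x) =
  2 * s * Int (fun x => dot (radial x) (fib (H x) (radial x)) * gauss x0 s x).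
Proof.
rewrite /Phi (Int_gauss_parts s rho0); first by congr (_ * _); apply: Int_eq => x; rewrite radial_dot.
  by move=> i; apply: CkT_dot; [exact: CkF_inter|apply: CkF_fib => //; exact: smradial].
by move=> i; apply: suppF_dotl; exact: suppF_inter.
Qed.

Lemma Int_Ups s : Int (fun x => Ups x * gauss x0 s x) =
  2 * s * Int (fun x => Psi x * gauss x0 s x).
Proof.
rewrite /Ups (Int_gauss_parts s rho0); first by congr (_ * _); apply: Int_eq => x; rewrite radial_dot.
  by move=> i; apply: CkT_dot; [exact: CkF_inter|exact: smcodiff].
by move=> i; apply: suppF_dotl; exact: suppF_inter.
Qed.

Lemma Int_Gam s : Int (fun x => Gam x * gauss x0 s x) =
  2 * s * Int (fun x => sqdist x0 x * energy x * gauss x0 s x).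
Proof.
rewrite /Gam (Int_gauss_parts s rho0).
- congr (_ * _); apply: Int_eq => x; congr (_ * _); rewrite /sqdist mulr_suml.
  by apply: eq_bigr => i _; rewrite expr2 mulrA.
- by move=> i; apply: CkTM; [exact: CkT_coordB|exact: smenergy].
- by move=> i; apply: supp_inMr; exact: senergy.
Qed.

Lemma smPhi : CkT 0 Phi.
Proof.
apply: CkT_sum => i _; apply: CkT_pd.
by apply: CkT_dot; [exact: CkF_inter|apply: CkF_fib => //; exact: smradial].
Qed.

Lemma smUps : CkT 0 Ups.
Proof.
apply: CkT_sum => i _; apply: CkT_pd.
by apply: CkT_dot; [exact: CkF_inter|exact: smcodiff].
Qed.

Lemma smGam : CkT 0 Gam.
Proof.
by apply: CkT_sum => i _; apply: CkT_pd; apply: CkTM; [exact: CkT_coordB|exact: smenergy].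
Qed.

Lemma smPsi : CkT 0 Psi.
Proof. by apply: CkT_dot; [exact: smradial|exact: smcodiff]. Qed.

Lemma smcodiff_sq N : CkT 0 (fun x => dot (codiff x) (fib N (codiff x))).
Proof.
apply: CkT_dot; first exact: smcodiff.
by apply: (@CkF_fib _ _ _ 0 (fun _ => N)); [move=> i j; exact: CkT_cst|exact: smcodiff].
Qed.

Lemma sPhi : supp_in x0 rho Phi.
Proof.
by apply: supp_in_sum => i _; apply: supp_in_pd; apply: suppF_dotl; exact: suppF_inter.
Qed.

Lemma sUps : supp_in x0 rho Ups.
Proof.
by apply: supp_in_sum => i _; apply: supp_in_pd; apply: suppF_dotl; exact: suppF_inter.
Qed.

Lemma sGam : supp_in x0 rho Gam.
Proof.
by apply: supp_in_sum => i _; apply: supp_in_pd; apply: supp_inMr; exact: senergy.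
Qed.

Lemma sPsi : supp_in x0 rho Psi.
Proof. by apply: suppF_dotl; exact: sradial. Qed.

Lemma scodiff_sq N : supp_in x0 rho (fun x => dot (codiff x) (fib N (codiff x))).
Proof. by apply: suppF_dotl; exact: scodiff. Qed.

(** The coefficient of 2 s. The cross term - 4 s [Psi] of the square is split evenly: one half stays
    here and cancels against [Phi], the other becomes - [Ups] by parts. Likewise - 2 (s - e) q
    [energy] leaves 2 e q [energy] to [bochner]. *)
Definition excess x := Phi x - q%:R * energy x - Psi x.
Definition bochner e N x := - Ups x + (1 + e) * dot (codiff x) (fib N (codiff x))
  + 2 * e * q%:R * energy x + 4 * e * q%:R * Gam x.

Lemma smexcess : CkT 0 excess.
Proof.
apply: CkTB; last exact: smPsi; apply: CkTB; first exact: smPhi.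
by apply: CkTZ; exact: smenergy.
Qed.

Lemma sexcess : supp_in x0 rho excess.
Proof. by move=> x xr; rewrite /excess sPhi // senergy // sPsi // mulr0 !subr0. Qed.

Lemma smbochner e N : CkT 0 (bochner e N).
Proof.
apply: CkTD; last by apply: CkTZ; exact: smGam.
apply: CkTD; last by apply: CkTZ; exact: smenergy.
apply: CkTD; first by apply: CkTN; exact: smUps.
by apply: CkTZ; exact: smcodiff_sq.
Qed.

Lemma sbochner e N : supp_in x0 rho (bochner e N).
Proof.
by move=> x xr; rewrite /bochner sUps // scodiff_sq // senergy // sGam // !mulr0 oppr0 !addr0.
Qed.

(** The letters stand for integrals: [a] of the energy, [A2] of |y|^2 times the energy, [g2] of the
    weighted square of [u]. By the L^2 estimate lam^2 g2 - 2 lam a is at most - lam a + 4 e lam A2,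
    and substituting [lam] discards only the nonnegative 8 e^2 k A2. *)
Lemma test_arith (lam s e k a g2 A2 php psi bnb : R) : 0 < lam -> lam = 2 * (s - e) * k ->
  0 < e -> 0 <= k -> 0 <= A2 -> g2 <= lam^-1 * (a + 4 * e * A2) ->
  0 <= lam ^+ 2 * g2 - 2 * lam * a + (4 * s ^+ 2 * php - 4 * s * psi + (1 + e) * bnb) ->
  0 <= - (2 * s * psi) + (1 + e) * bnb + 2 * e * k * a + 4 * e * k * (2 * s * A2)
    + 2 * s * (2 * s * php - k * a - psi).
Proof.
move=> l0 lE e0 k0 A20 hg h.
have h1 : lam ^+ 2 * g2 <= lam * (a + 4 * e * A2).
  by rewrite expr2 -mulrA ler_pM2l // -ler_pdivlMl.
have h2 : 0 <= e * e * k * A2 by rewrite !mulr_ge0 // ltW.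
move: h h1; rewrite lE; move: h2; clear => h2 h h1.
move: (le_trans h (lerD (lerD h1 (lexx _)) (lexx _))) => {h h1} h.
apply: (le_trans h); rewrite -subr_ge0.
rewrite (_ : _ - _ = 8 * (e * e * k * A2)); last by ring.
by rewrite mulr_ge0.
Qed.

(** From 1 - y <= exp (- y), since (1 - y) (1 + 2 y) >= 1 on this interval. *)
Lemma expR_le_1D2 (y : R) : 0 <= y -> y <= 1 / 2 -> expR y <= 1 + 2 * y.
Proof.
move=> y0 y2; have h := expR_ge1Dx (- y); rewrite expRN in h.
have := expR_gt0 y; move: (expR y) h => E h E0.
have h' : (1 - y) * E <= 1 by rewrite -ler_pdivlMr // mul1r.
have : 0 <= (1 + 2 * y) * (1 - (1 - y) * E) by rewrite mulr_ge0 //; lra.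
have : 0 <= y * (1 - 2 * y) * E by rewrite !mulr_ge0 //; lra.
by lra.
Qed.

(* To be used with [G] the metric extended by zero outside [D], [H] its Taylor polynomial at
   [x0], and [H0] its value there. *)
Lemma test_inequality (D : set 'rV[R]_n) (G : 'rV[R]_n -> 'M[R]_r) (u : 'rV[R]_n -> fform R n r)
    (H0 : 'M[R]_r) (s e c : R) :
  [set x | sqdist x0 x <= rho ^+ 2] `<=` D ->
  (forall I t, measurable_fun (setT : set (borelT R n)) (fun x => u x I t)) ->
  (forall a b, measurable_fun (setT : set (borelT R n)) (fun x => G x a b)) ->
  (forall x v, 0 <= bil (G x) v v) -> 0 < c ->
  (forall x, sqdist x0 x <= rho ^+ 2 -> forall v, c * vdot v v <= bil (G x) v v) ->
  (forall x, sqdist x0 x <= rho ^+ 2 ->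
     forall v, bil (H x) v v <= (1 + e * sqdist x0 x) * bil (G x) v v) ->
  (forall x, sqdist x0 x <= rho ^+ 2 ->
     forall v, bil (G x) v v <= (1 + e * sqdist x0 x) * bil (H x) v v) ->
  H0^T = H0 -> H0 \in unitmx -> (forall v, 0 <= bil H0 v v) ->
  (forall x, sqdist x0 x <= rho ^+ 2 -> forall v, bil H0 v v <= (1 + e) * bil (H x) v v) ->
  (0 < q)%N -> 0 < e -> e < s -> e * rho ^+ 2 <= 1 / 2 -> weak_d D u f ->
  (iint (fun x => (dot (u x) (fib (G x) (u x)))%:E) < +oo)%E ->
  (iint (fun x => (dot (u x) (fib (G x) (u x)) * gauss x0 (s - e) x)%:E) <=
   iint (fun x => ((2 * (s - e) * q%:R)^-1 * dot (f x) (fib (G x) (f x)) * gauss x0 (s - e) x)%:E))%E ->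
  0 <= Int (fun x => (bochner e (invmx H0) x + 2 * s * excess x) * gauss x0 s x).
Proof.
move=> BD mu mG psd c0 lowG HG GH symH0 uH0 psd0 H0H q0 e0 es er wd fin ineq.
pose N := invmx H0; pose lam := 2 * (s - e) * q%:R; pose E := gauss x0 s.
have se0 : 0 < s - e by rewrite subr_gt0.
have qR0 : 0 < q%:R :> R by rewrite ltr0n.
have lam0 : 0 < lam by rewrite !mulr_gt0.
have E0 x : 0 < E x by exact: gauss_gt0.
have gE x : gauss x0 (s - e) x = E x * expR (e * sqdist x0 x).
  by rewrite /E /gauss -expRD; congr expR; ring.
have psdH x v : sqdist x0 x <= rho ^+ 2 -> 0 <= bil (H x) v v.
  move=> xr; have := le_trans (psd0 v) (H0H _ xr v).
  by rewrite pmulr_rge0 // addr_gt0.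
have quadG (a : fform R n r) x : 0 <= dot a (fib (G x) a) by exact: quad_ge0.
have f_off x : rho ^+ 2 < sqdist x0 x -> f x = fun _ _ => 0.
  by move=> xr; apply: fform_ext => I t; exact: sf.
have en0 x : 0 <= energy x.
  have [xr|xr] := ltP (rho ^+ 2) (sqdist x0 x); first by rewrite senergy.
  by apply: quad_ge0 => v; exact: psdH.
have ce := CkT_continuous (smenergy 0).
have i_en : intg (fun x => energy x * E x) by exact: intg_gauss rho0 ce senergy.
have i_sqen : intg (fun x => sqdist x0 x * energy x * E x).
  apply: (intg_gauss _ rho0); last by apply: supp_inMr; exact: senergy.
  exact: CkT_continuous (CkTM (CkT_sqdist 0 x0) (smenergy 0)).
pose Bf x := energy x * E x + 4 * e * (sqdist x0 x * energy x * E x).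
have i_Bf : intg Bf by apply: intgD => //; exact: intgZ.
pose G1 x := lam^-1 * dot (f x) (fib (G x) (f x)) * gauss x0 (s - e) x.
have G10 x : 0 <= G1 x by rewrite !mulr_ge0 ?invr_ge0 ?(ltW lam0) // ltW // gauss_gt0.
have mgauss k : measurable_fun (setT : set (borelT R n)) (gauss x0 k).
  by apply: continuous_borel_fun; exact: CkT_continuous (CkT_gauss 0 x0 k).
have mf I t : measurable_fun (setT : set (borelT R n)) (fun x => f x I t).
  by apply: continuous_borel_fun; exact: CkT_continuous (smf 0 I t).
(* On the side of [f] the change of metric and of weight costs (1 + y) (1 + 2 y) with y = e |x -
   x0|^2 <= 1 / 2, hence at most 1 + 4 y; this is the source of the factor 4 e. *)
have G1B x : G1 x <= lam^-1 * Bf x.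
  have [xr|xr] := ltP (rho ^+ 2) (sqdist x0 x).
    by rewrite /G1 /Bf senergy // f_off // dot0 !(mul0r, mulr0, addr0).
  rewrite /G1 -mulrA ler_pM2l ?invr_gt0 // gE.
  have y0 : 0 <= e * sqdist x0 x by rewrite mulr_ge0 ?sqdist_ge0 // ltW.
  have y2 : e * sqdist x0 x <= 1 / 2 by apply: le_trans er; rewrite ler_pM2l.
  have h1 : dot (f x) (fib (G x) (f x)) <= (1 + e * sqdist x0 x) * energy x.
    by apply: quad_le => v; exact: GH.
  have h2 := expR_le_1D2 y0 y2.
  rewrite /Bf (_ : _ + _ = (1 + 4 * (e * sqdist x0 x)) * energy x * E x); last by ring.
  rewrite mulrCA [X in _ <= X]mulrC ler_pM2l //.
  apply: (le_trans (ler_pM (quadG _ _) (expR_ge0 _) h1 h2)).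
  rewrite mulrAC ler_wpM2r //; move: y0 y2; move: (e * sqdist x0 x) => y y0 y2.
  have : 0 <= y * (1 - 2 * y) by rewrite mulr_ge0 //; lra.
  by lra.
have i_G1 : intg G1.
  apply: (intg_le _ (intgZ lam^-1 i_Bf)); last by move=> x; rewrite ger0_norm.
  apply: measurable_funM => //; apply: measurable_funM; first exact: measurable_cst.
  exact: mfun_quad.
pose G2 x := dot (u x) (fib (G x) (u x)) * gauss x0 (s - e) x.
have G20 x : 0 <= G2 x by rewrite mulr_ge0 // ltW // gauss_gt0.
have mquad : measurable_fun (setT : set (borelT R n)) (fun x => dot (u x) (fib (G x) (u x))).
  exact: mfun_quad.
have mG2 : measurable_fun (setT : set (borelT R n)) G2 by exact: measurable_funM.
have ineq' : (iint (fun x => (G2 x)%:E) <= (Int G1)%:E)%E.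
  by rewrite -(iint_Int i_G1 G10); exact: ineq.
have i_G2 : intg G2 by apply: (intg_iint mG2 G20); apply: le_lt_trans ineq' _; exact: ltry.
have IG2 : Int G2 <= Int G1 by move: ineq'; rewrite (iint_Int i_G2 G20) lee_fin.
have IG2' : Int G2 <= lam^-1 * (Int (fun x => energy x * E x)
     + 4 * e * Int (fun x => sqdist x0 x * energy x * E x)).
  rewrite -(IntZ _ i_sqen) -IntD //; last exact: intgZ.
  rewrite -IntZ //; apply: le_trans IG2 _; apply: Int_le => //; exact: intgZ.
have i_U := intg_iint mquad (fun x => quadG (u x) x) fin.
(* Coercivity of [G] on the ball turns the finite unweighted norm of [u] into the integrable
   majorant required for pairing. *)
have [] := @tested_equation D u (fun x => c^-1 * dot (u x) (fib (G x) (u x))) s BD mu (intgZ c^-1 i_U) _ _ wd.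
- by move=> x; rewrite mulr_ge0 // invr_ge0 ltW.
- move=> x xr; rewrite ler_pdivlMl // dot_fib_bil dot_vdot mulr_sumr.
  by apply: ler_sum => I _; exact: lowG.
rewrite -/E => i_T eq_T.
have i_php : intg (fun x => dot (radial x) (fib (H x) (radial x)) * E x).
  apply: (intg_gauss _ rho0); last by apply: suppF_dotl; exact: sradial.
  apply: CkT_continuous; apply: (@CkT_dot _ _ _ 0); first exact: smradial.
  by apply: CkF_fib => //; exact: smradial.
have i_Psi : intg (fun x => Psi x * E x) by exact: intg_gauss rho0 (CkT_continuous smPsi) sPsi.
have i_bnb : intg (fun x => dot (codiff x) (fib N (codiff x)) * E x).
  exact: intg_gauss rho0 (CkT_continuous (smcodiff_sq N)) (scodiff_sq N).
have i_Phi : intg (fun x => Phi x * E x) by exact: intg_gauss rho0 (CkT_continuous smPhi) sPhi.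
have i_Ups : intg (fun x => Ups x * E x) by exact: intg_gauss rho0 (CkT_continuous smUps) sUps.
have i_Gam : intg (fun x => Gam x * E x) by exact: intg_gauss rho0 (CkT_continuous smGam) sGam.
pose T x := lam ^+ 2 * G2 x - 2 * lam * (dot (u x) (tested s x) * E x)
  + (4 * s ^+ 2 * (dot (radial x) (fib (H x) (radial x)) * E x) - 4 * s * (Psi x * E x)
     + (1 + e) * (dot (codiff x) (fib N (codiff x)) * E x)).
have T0 x : 0 <= T x.
  (* Outside the ball only lam^2 [G2] survives, which is why semidefiniteness of [G] suffices
     there. *)
  have [xr|xr] := ltP (rho ^+ 2) (sqdist x0 x).
    have rad0 : radial x = fun _ _ => 0 by apply: fform_ext => I t; exact: sradial.
    have cod0 : codiff x = fun _ _ => 0 by apply: fform_ext => I t; exact: scodiff.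
    have tst0 : dot (u x) (tested s x) = 0.
      by rewrite dotC /tested rad0 cod0 dotDl !dotZl fib0 !dot0 !(mulr0, addr0).
    rewrite /T tst0 /Psi rad0 cod0 !dot0 !(mul0r, mulr0, subr0, addr0).
    by rewrite mulr_ge0 // exprn_ge0 // ltW.
  have h := completed_square lam s (u x) (radial x) (codiff x) (symH x) symH0 uH0 (ltW e0) psd0
    (H0H x xr).
  (* The spare factor is spent here: passing from [H] to [G] costs 1 + e |x - x0|^2, and [G2]
     carries exp (e |x - x0|^2) more than [E]. *)
  have h1 : dot (u x) (fib (H x) (u x)) * E x <= G2 x.
    have y0 : 0 <= e * sqdist x0 x by rewrite mulr_ge0 ?sqdist_ge0 // ltW.
    have h2 : dot (u x) (fib (H x) (u x)) <= (1 + e * sqdist x0 x) * dot (u x) (fib (G x) (u x)).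
      by apply: quad_le => v; exact: HG.
    rewrite /G2 gE mulrCA mulrC ler_pM2l // mulrC; apply: le_trans h2 _.
    by rewrite ler_wpM2r // expR_ge1Dx.
  have h3 := mulr_ge0 h (ltW (E0 x)).
  have h4 : lam ^+ 2 * (dot (u x) (fib (H x) (u x)) * E x) <= lam ^+ 2 * G2 x.
    by rewrite ler_wpM2l // exprn_ge0 // ltW.
  rewrite -subr_ge0 in h4; apply: (le_trans (addr_ge0 h3 h4)).
  rewrite /T /Psi -/N -/(tested s x).
  clear; move: (dot (u x) (fib (H x) (u x))) (dot (u x) (tested s x))
    (dot (radial x) (fib (H x) (radial x))) (dot (radial x) (codiff x))
    (dot (codiff x) (fib N (codiff x))) (G2 x) (E x) => *.
  by rewrite le_eqVlt; apply/orP; left; apply/eqP; ring.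
have IT : 0 <= lam ^+ 2 * Int G2 - 2 * lam * Int (fun x => energy x * E x)
  + (4 * s ^+ 2 * Int (fun x => dot (radial x) (fib (H x) (radial x)) * E x)
     - 4 * s * Int (fun x => Psi x * E x)
     + (1 + e) * Int (fun x => dot (codiff x) (fib N (codiff x)) * E x)).
  have := Int_ge0 T0.
  have j1 := intgZ (lam ^+ 2) i_G2; have j2 := intgZ (2 * lam) i_T.
  have j3 := intgZ (4 * s ^+ 2) i_php; have j4 := intgZ (4 * s) i_Psi; have j5 := intgZ (1 + e) i_bnb.
  rewrite /T (IntD (intgB j1 j2) (intgD (intgB j3 j4) j5)) (IntB j1 j2).
  rewrite (IntD (intgB j3 j4) j5) (IntB j3 j4).
  by rewrite (IntZ _ i_G2) (IntZ _ i_T) (IntZ _ i_php) (IntZ _ i_Psi) (IntZ _ i_bnb) -eq_T.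
have A20 : 0 <= Int (fun x => sqdist x0 x * energy x * E x).
  by apply: Int_ge0 => x; rewrite !mulr_ge0 ?sqdist_ge0 // ltW.
have := test_arith lam0 erefl e0 (ltW qR0) A20 IG2' IT.
rewrite -Int_Phi -Int_Ups -Int_Gam -/E.
have j1 := intgN i_Ups; have j2 := intgZ (1 + e) i_bnb; have j3 := intgZ (2 * e * q%:R) i_en.
have j4 := intgZ (4 * e * q%:R) i_Gam; have j5 := intgZ q%:R i_en.
have j6 := intgB (intgB i_Phi j5) i_Psi; have j7 := intgZ (2 * s) j6.
have j12 := intgD j1 j2; have j123 := intgD j12 j3; have j1234 := intgD j123 j4.
have <- : Int (fun x => - (Ups x * E x) + (1 + e) * (dot (codiff x) (fib N (codiff x)) * E x)
    + 2 * e * q%:R * (energy x * E x) + 4 * e * q%:R * (Gam x * E x)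
    + 2 * s * (Phi x * E x - q%:R * (energy x * E x) - Psi x * E x)) =
  - Int (fun x => Ups x * E x) + (1 + e) * Int (fun x => dot (codiff x) (fib N (codiff x)) * E x)
    + 2 * e * q%:R * Int (fun x => energy x * E x) + 4 * e * q%:R * Int (fun x => Gam x * E x)
    + 2 * s * (Int (fun x => Phi x * E x) - q%:R * Int (fun x => energy x * E x)
      - Int (fun x => Psi x * E x)).
  rewrite (IntD j1234 j7) (IntD j123 j4) (IntD j12 j3) (IntD j1 j2) (IntN i_Ups) (IntZ _ i_bnb).
  by rewrite (IntZ _ i_en) (IntZ _ i_Gam) (IntZ _ j6) (IntB (intgB i_Phi j5) i_Psi) (IntB i_Phi j5)
    (IntZ _ i_en).
congr (0 <= _); apply: Int_eq => x; rewrite /bochner /excess -/N -/E.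
clear; move: (Ups x) (dot (codiff x) (fib N (codiff x))) (energy x) (Gam x) (Phi x) (Psi x) (E x) => *.
by ring.
Qed.

End test_form.

(** * The test form and the model metric near the centre *)

Section cutoff.
Context {R : realType} {n r : nat}.

Lemma flat0_pos (t : R) : 0 < t -> 0 < flat 0 t.
Proof. by move=> t0; rewrite /flat t0 expr0 mul1r expR_gt0. Qed.

Lemma flat_npos k (t : R) : t <= 0 -> flat k t = 0.
Proof. by move=> t0; rewrite /flat ltNge t0. Qed.

Lemma flat0_le (s t : R) : 0 < s -> s <= t -> flat 0 s <= flat 0 t.
Proof.
move=> s0 st; have t0 := lt_le_trans s0 st.
by rewrite /flat s0 t0 !expr0 !mul1r ler_expR lerN2 lef_pV2 ?posrE.
Qed.

(* [flat] of a difference of [flat]s is locally constant where the inner one vanishes,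
   which gives a plateau without dividing by smooth functions. *)
Definition cutoff (x0 : 'rV[R]_n) (rho : R) (x : 'rV[R]_n) : R :=
  (flat 0 (flat 0 (1 / 2)))^-1 *
  flat 0 (flat 0 (1 / 2) - flat 0 (rho ^- 2 * sqdist x0 x - 1 / 2)).

Lemma CkT_cutoff k x0 rho : CkT k (cutoff x0 rho).
Proof.
apply: CkTZ; apply: CkT_flat; apply: CkTB; first exact: CkT_cst.
apply: CkT_flat; apply: CkTB; last exact: CkT_cst.
by apply: CkTZ; exact: CkT_sqdist.
Qed.

Lemma cutoff1 x0 rho x : 0 < rho -> sqdist x0 x < rho ^+ 2 / 2 -> cutoff x0 rho x = 1.
Proof.
move=> r0 xr; have r2 : 0 < rho ^+ 2 by rewrite exprn_gt0.
rewrite /cutoff (@flat_npos 0 (_ - 1 / 2)); last first.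
  by rewrite subr_le0 ler_pdivrMl // mulrA mulr1 ltW.
by rewrite subr0 mulVf // gt_eqF // !flat0_pos.
Qed.

Lemma supp_cutoff x0 rho : 0 < rho -> supp_in x0 rho (cutoff x0 rho).
Proof.
move=> r0 x xr; have r2 : 0 < rho ^+ 2 by rewrite exprn_gt0.
rewrite /cutoff (@flat_npos 0 (_ - flat 0 _)) ?mulr0 // subr_le0.
apply: flat0_le => //.
have h1 : 1 <= rho ^- 2 * sqdist x0 x by rewrite ler_pdivlMl // mulr1 ltW.
by move: (rho ^- 2 * sqdist x0 x) h1 => y; lra.
Qed.

Variables (q : nat) (x0 : 'rV[R]_n) (rho : R) (xi : fform R n r).
Hypotheses (rho0 : 0 < rho) (qxi : is_qform q.+1 xi).

(** The Poincare homotopy for a constant form: d of the contraction of [xi] with x - x0 is [q.+1]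
    times [xi]. The cutoff multiplies the primitive and not the form, so that d of the product is
    closed everywhere. *)
Definition primitive (x : 'rV[R]_n) : fform R n r :=
  fun I t => q.+1%:R^-1 * cutoff x0 rho x * \sum_j (x 0 j - x0 0 j) * inter j xi I t.

Definition closed_form : 'rV[R]_n -> fform R n r := extd primitive.

Lemma CkF_primitive k : CkF k primitive.
Proof.
move=> I t; apply: CkTM; first by apply: CkTZ; exact: CkT_cutoff.
by apply: CkT_sum => j _; apply: CkTM; [exact: CkT_coordB|exact: CkT_cst].
Qed.

Lemma CkF_closed_form k : CkF k closed_form.
Proof.
apply: CkF_sum => i _.
exact: (CkF_wedge i (CkF_pd i (CkF_primitive k.+1))).
Qed.

Lemma suppF_closed_form : suppF x0 rho closed_form.
Proof.
have sp : suppF x0 rho primitive.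
  by move=> I t; apply: supp_inMl; apply: supp_inMr; exact: supp_cutoff.
by apply: suppF_sum => i _; exact: (suppF_wedge i (suppF_pd i sp)).
Qed.

Lemma closed_form_qform x : is_qform q.+1 (closed_form x).
Proof.
move=> J t Jq; apply: big1 => i _; apply: (@wedge_qform _ _ _ q) => // I s Iq.
have -> : (fun y => primitive y I s) = fun _ => 0; last exact: isPdE (isPd_cst i 0 x).
apply/funext => y; rewrite /primitive big1 ?mulr0 // => j _.
by rewrite (inter_qform j qxi) ?mulr0.
Qed.

Lemma closed_form_closed x : extd closed_form x = fun _ _ => 0.
Proof. exact: extd_extd (CkF_primitive 2). Qed.

Lemma near_sqdist_lt x m : sqdist x0 x < m -> \forall y \near x, sqdist x0 y < m.
Proof.
move=> xm; have : nbhs x (sqdist x0 @^-1` [set y | y < m]); last by [].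
by apply: sqdist_continuous; exact: lt_nbhsl.
Qed.

Lemma closed_form_const x : sqdist x0 x < rho ^+ 2 / 2 -> closed_form x = xi.
Proof.
move=> xr; apply: fform_ext => J t; rewrite /closed_form /extd.
have E i : (fun I s => pd i (fun y => primitive y I s) x) = fun I s => q.+1%:R^-1 * inter i xi I s.
  apply: fform_ext => I s; apply: isPdE.
  apply: (@isPd_near _ _ i (fun y => q.+1%:R^-1 * \sum_j (y 0 j - x0 0 j) * inter j xi I s)).
    apply: filterS (near_sqdist_lt xr) => y yr.
    by rewrite /primitive (cutoff1 rho0 yr) mulr1.
  apply: isPdZ.
  have := isPd_sum (index_enum _) (P := predT) (fun j _ =>
    isPdM (isPd_coordB x0 i j x) (isPd_cst i (inter j xi I s) x)).
  move=> /isPd_eq; apply; rewrite (bigD1 i) //= eqxx mul1r mulr0 addr0 big1 ?addr0 // => j.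
  by rewrite eq_sym => /negbTE ->; rewrite mul0r mulr0 addr0.
under eq_bigr => i _ do rewrite E wedgeZ.
by rewrite -mulr_sumr (sum_wedge_inter qxi) mulKf // pnatr_eq0.
Qed.

End cutoff.

(** * Derivatives of determinants and inverse matrices *)

Section matrix_derivatives.
Context {R : realType} {n : nat}.
Implicit Types (x : 'rV[R]_n) (i : 'I_n).

Lemma isPd_prod_ex (I : Type) (s : seq I) i (F : I -> 'rV[R]_n -> R) x :
  (forall k, exists d, isPd i (F k) x d) -> exists d, isPd i (fun y => \prod_(k <- s) F k y) x d.
Proof.
move=> h; elim: s => [|k s [d hd]].
  exists 0; under [X in isPd _ X]funext do rewrite big_nil; exact: isPd_cst.
have [dk hk] := h k; exists (dk * (\prod_(j <- s) F j x) + F k x * d).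
by under [X in isPd _ X]funext do rewrite big_cons; exact: isPdM.
Qed.

Lemma isPd_sum_ex (I : Type) (s : seq I) i (F : I -> 'rV[R]_n -> R) x :
  (forall k, exists d, isPd i (F k) x d) -> exists d, isPd i (fun y => \sum_(k <- s) F k y) x d.
Proof. by move=> /choice [d hd]; exists (\sum_(k <- s) d k); exact: isPd_sum. Qed.

Lemma isPd_det_ex m i (A : 'rV[R]_n -> 'M[R]_m) x :
  (forall a b, exists d, isPd i (fun y => A y a b) x d) ->
  exists d, isPd i (fun y => \det (A y)) x d.
Proof.
move=> h; rewrite /determinant; apply: isPd_sum_ex => s.
have [d hd] := @isPd_prod_ex _ (index_enum _) i (fun k y => A y k (perm.fun_of_perm s k)) x (fun k => h k (perm.fun_of_perm s k)).
by exists ((-1) ^+ perm.odd_perm s * d); exact: isPdZ.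
Qed.

Lemma isPdV i (f : 'rV[R]_n -> R) x d : f x != 0 -> isPd i f x d ->
  isPd i (fun y => (f y)^-1) x (- (f x) ^- 2 * d).
Proof.
move=> fx hf; apply: (@isPd_comp _ _ i (fun t : R => t^-1)) => //.
have := @is_deriveV R id (f x) 1 1 fx (is_derive_id _ _).
by move=> /is_derive_eq; apply; rewrite /GRing.scale /= mulr1.
Qed.

(** Cramer's rule gives differentiability; the value is left open because it is determined
    afterwards. *)
Lemma isPd_invmx_ex m i (A : 'rV[R]_n -> 'M[R]_m) x :
  (\forall y \near x, A y \in unitmx) ->
  (forall a b, exists d, isPd i (fun y => A y a b) x d) ->
  forall a b, exists d, isPd i (fun y => invmx (A y) a b) x d.
Proof.
move=> uA h a b; have [d hd] := isPd_det_ex h.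
have [d' hd'] : exists d, isPd i (fun y => cofactor (A y) b a) x d.
  have hrc k l : exists d, isPd i (fun y => (row' b (col' a (A y))) k l) x d.
    have [d' hd'] := h (lift b k) (lift a l).
    by exists d'; under [X in isPd _ X]funext do rewrite !mxE.
  have [d' hd'] := isPd_det_ex hrc.
  by exists ((-1) ^+ (b + a) * d'); exact: isPdZ.
have ux : \det (A x) != 0.
  by have := nbhs_singleton uA; rewrite unitmxE unitfE.
exists (- (\det (A x)) ^- 2 * d * cofactor (A x) b a + (\det (A x))^-1 * d').
apply: (@isPd_near _ _ i (fun y => (\det (A y))^-1 * cofactor (A y) b a)); last first.
  exact: isPdM (isPdV ux hd) hd'.
by apply: filterS uA => y uy; rewrite /invmx uy !mxE.
Qed.

(** Once the inverse is known to be differentiable, the Leibniz rule applied to A^-1 A = 1 forces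
    its derivative. *)
Lemma isPd_invmx m i (A : 'rV[R]_n -> 'M[R]_m) (dA : 'M[R]_m) x :
  (\forall y \near x, A y \in unitmx) ->
  (forall a b, isPd i (fun y => A y a b) x (dA a b)) ->
  forall a b, isPd i (fun y => invmx (A y) a b) x ((- (invmx (A x) *m dA *m invmx (A x))) a b).
Proof.
move=> uA h; have ux : A x \in unitmx by exact: nbhs_singleton uA.
have hex := isPd_invmx_ex uA (fun a b => ex_intro _ _ (h a b)).
have /choice [d0 hd0] : forall ab : 'I_m * 'I_m, exists d, isPd i (fun y => invmx (A y) ab.1 ab.2) x d.
  by move=> [a b]; exact: hex.
pose d : 'M[R]_m := \matrix_(a, b) d0 (a, b).
have hd a b : isPd i (fun y => invmx (A y) a b) x (d a b).
  by rewrite mxE; exact: (hd0 (a, b)).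
have E : d *m A x + invmx (A x) *m dA = 0.
  apply/matrixP => a b.
  have h1 : isPd i (fun y => (invmx (A y) *m A y) a b) x ((d *m A x + invmx (A x) *m dA) a b).
    under [X in isPd _ X]funext do rewrite mxE.
    apply: isPd_eq; first by apply: isPd_sum => k _; exact: isPdM (hd a k) (h k b).
    by rewrite big_split /= !mxE.
  have h2 : isPd i (fun y => (invmx (A y) *m A y) a b) x 0.
    apply: (@isPd_near _ _ i (fun _ => (1%:M : 'M[R]_m) a b)); last exact: isPd_cst.
    by apply: filterS uA => y uy; rewrite mulVmx.
  by rewrite -(isPdE h1) (isPdE h2) mxE.
have -> : - (invmx (A x) *m dA *m invmx (A x)) = d.
  have := congr1 (fun M => M *m invmx (A x)) E.
  rewrite mulmxDl mul0mx mulmxK // => /eqP; rewrite addr_eq0 => /eqP ->.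
  by [].
exact: hd.
Qed.

Lemma pos_def_unitmx m (M : 'M[R]_m) : pos_def M -> M \in unitmx.
Proof.
move=> pM; rewrite -row_free_unit; apply: inj_row_free => v vM.
apply/eqP/negPn/negP => /pM; by rewrite vM mul0mx mxE ltxx.
Qed.

End matrix_derivatives.

(** * The second order model of the metric *)

Section local_model.
Context {R : realType} {n r : nat}.
Variables (D : set 'rV[R]_n) (g : 'rV[R]_n -> 'M[R]_r) (x0 : 'rV[R]_n).
Hypotheses (oD : open D) (Dx0 : D x0) (cg : forall a b : 'I_r, Ck 2 D (fun x => g x a b)).
Hypothesis (symg : forall x, D x -> (g x)^T = g x).

Definition ddg i j : 'M[R]_r := \matrix_(a, b) pd i (pd j (fun y => g y a b)) x0.

Definition taylor2 (x : 'rV[R]_n) : 'M[R]_r := \matrix_(a, b)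
  (g x0 a b + \sum_i (x 0 i - x0 0 i) * pdM i g x0 a b
   + 1 / 2 * \sum_i \sum_j (x 0 i - x0 0 i) * ((x 0 j - x0 0 j) * ddg i j a b)).

Lemma sum_delta (i : 'I_n) (F : 'I_n -> R) : \sum_j (i == j)%:R * F j = F i.
Proof.
rewrite (bigD1 i) //= eqxx mul1r big1 ?addr0 // => j.
by rewrite eq_sym => /negbTE ->; rewrite mul0r.
Qed.

Lemma near_D y : D y -> nbhs y D.
Proof. by move=> Dy; exact: open_nbhs_nbhs. Qed.

Lemma g_sym y a b : D y -> g y a b = g y b a.
Proof. by move=> /symg E; rewrite -{1}E mxE. Qed.

Lemma pd_g_sym j y a b : D y -> pd j (fun y => g y a b) y = pd j (fun y => g y b a) y.
Proof.
by move=> Dy; apply: pd_near; apply: filterS (near_D Dy) => z; exact: g_sym.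
Qed.

Lemma pdM_sym i : (pdM i g x0)^T = pdM i g x0.
Proof. by apply/matrixP => a b; rewrite !mxE; exact: pd_g_sym. Qed.

Lemma ddg_tr i j : (ddg i j)^T = ddg i j.
Proof.
apply/matrixP => a b; rewrite !mxE; apply: pd_near.
by apply: filterS (near_D Dx0) => z; exact: pd_g_sym.
Qed.

Lemma ddg_sym i j : ddg i j = ddg j i.
Proof.
apply/matrixP => a b; rewrite [LHS]mxE [RHS]mxE.
exact (@pd_sym R n D (fun y => g y a b) x0 i j oD (cg a b) Dx0).
Qed.

Lemma taylor2_sym x : (taylor2 x)^T = taylor2 x.
Proof.
apply/matrixP => a b; rewrite [LHS]mxE /taylor2 !mxE g_sym //; congr (_ + _ + _ * _).
  by apply: eq_bigr => i _; congr (_ * _); rewrite -[in RHS]pdM_sym [in RHS]mxE.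
apply: eq_bigr => i _; apply: eq_bigr => j _; congr (_ * (_ * _)).
by rewrite -[in RHS]ddg_tr [in RHS]mxE.
Qed.

Lemma CkM_taylor2 k : CkM k taylor2.
Proof.
move=> a b; rewrite /taylor2; under [X in CkT _ X]funext do rewrite mxE.
apply: CkTD; first apply: CkTD; first exact: CkT_cst.
  by apply: CkT_sum => i _; apply: CkTM; [exact: CkT_coordB|exact: CkT_cst].
apply: CkTZ; apply: CkT_sum => i _; apply: CkT_sum => j _.
by apply: CkTM; [exact: CkT_coordB|apply: CkTM; [exact: CkT_coordB|exact: CkT_cst]].
Qed.

Lemma isPd_linear i (c : 'I_n -> R) x :
  isPd i (fun y => \sum_j (y 0 j - x0 0 j) * c j) x (c i).
Proof.
have := isPd_sum (index_enum _) (P := predT) (fun j _ =>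
    isPdM (isPd_coordB x0 i j x) (isPd_cst i (c j) x)).
move=> /isPd_eq; apply; rewrite -[RHS](sum_delta i c); apply: eq_bigr => j _.
by rewrite mulr0 addr0.
Qed.

Lemma isPd_taylor2 i x a b : isPd i (fun y => taylor2 y a b) x
  (pdM i g x0 a b + \sum_j (x 0 j - x0 0 j) * ddg i j a b).
Proof.
rewrite /taylor2; under [X in isPd _ X]funext do rewrite mxE.
have h1 : isPd i (fun y : 'rV[R]_n => g x0 a b + \sum_i (y 0 i - x0 0 i) * pdM i g x0 a b) x
    (pdM i g x0 a b).
  by apply: isPd_eq; [apply: isPdD (isPd_cst i _ x) (isPd_linear i (fun i => pdM i g x0 a b) x)|rewrite add0r].
apply: isPd_eq; first apply: isPdD h1 _.
  apply: isPdZ; apply: isPd_sum => k _; apply: isPd_sum => j _.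
  exact: isPdM (isPd_coordB x0 i k x) (isPdM (isPd_coordB x0 i j x) (isPd_cst i (ddg k j a b) x)).
congr (_ + _).
set S := \sum_j (x 0 j - x0 0 j) * ddg i j a b.
(* Differentiating either coordinate factor gives the same sum [S], by symmetry of [ddg]; this
   cancels the factor 1 / 2. *)
have -> : \sum_k \sum_j ((i == k)%:R * ((x 0 j - x0 0 j) * ddg k j a b)
    + (x 0 k - x0 0 k) * ((i == j)%:R * ddg k j a b + (x 0 j - x0 0 j) * 0)) = S + S.
  under eq_bigr => k _ do rewrite big_split /=.
  rewrite big_split /=; congr (_ + _).
    under eq_bigr => k _ do rewrite -mulr_sumr.
    by rewrite (sum_delta i (fun k => \sum_j (x 0 j - x0 0 j) * ddg k j a b)).
  apply: eq_bigr => k _; rewrite -mulr_sumr; congr (_ * _).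
  under eq_bigr => j _ do rewrite mulr0 addr0.
  by rewrite (sum_delta i (fun j => ddg k j a b)) ddg_sym.
by field.
Qed.

Lemma pdM_taylor2 i : pdM i taylor2 x0 = pdM i g x0.
Proof.
apply/matrixP => a b; rewrite [LHS]mxE (isPdE (isPd_taylor2 i x0 a b)).
by rewrite big1 ?addr0 // => j _; rewrite subrr mul0r.
Qed.

Lemma pdM2_taylor2 i j : pdM i (fun y => pdM j taylor2 y) x0 = ddg i j.
Proof.
apply/matrixP => a b; rewrite [LHS]mxE.
have -> : (fun y => pdM j taylor2 y a b) =
    fun y => pdM j g x0 a b + \sum_k (y 0 k - x0 0 k) * ddg j k a b.
  by apply/funext => y; rewrite mxE; exact: isPdE (isPd_taylor2 j y a b).
apply: isPdE; apply: isPd_eq; first exact: isPdD (isPd_cst i _ x0) (isPd_linear i (fun k => ddg j k a b) x0).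
by rewrite add0r ddg_sym.
Qed.

Lemma taylor2_x0 : taylor2 x0 = g x0.
Proof.
apply/matrixP => a b; rewrite mxE big1 => [|i _]; last by rewrite subrr mul0r.
rewrite big1 => [|i _]; first by rewrite mulr0 !addr0.
by rewrite big1 // => j _; rewrite subrr mul0r.
Qed.

Lemma taylor2_remainder (d : R) a b : 0 < d -> exists2 e : R, 0 < e &
  forall x, sqdist x0 x <= e ^+ 2 -> `|g x a b - taylor2 x a b| <= d * sqdist x0 x.
Proof.
move=> d0; pose k x := g x a b - taylor2 x a b.
pose k1 i x := pd i (fun y => g y a b) x - (pdM i g x0 a b + \sum_j (x 0 j - x0 0 j) * ddg i j a b).
pose k2 i j x := pd j (pd i (fun y => g y a b)) x - ddg i j a b.
apply: (@taylor_remainder _ _ D k k1 k2) => //.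
- by move=> x i Dx; apply: isPdB; [exact: Ck2_isPd (cg a b) Dx|exact: isPd_taylor2].
- move=> x i j Dx; apply: isPdB; first exact: Ck2_isPd2 (cg a b) Dx.
  apply: isPd_eq; first exact: isPdD (isPd_cst j _ x) (isPd_linear j (fun k => ddg i k a b) x).
  by rewrite add0r.
- move=> i j; have h := @Ck2_continuous2 _ _ D _ x0 j i (cg a b) Dx0.
  exact: (cvgB h (cvg_cst (ddg i j a b))).
- by rewrite /k taylor2_x0 subrr.
- by move=> i; rewrite /k1 big1 ?addr0 ?mxE ?subrr // => j _; rewrite subrr mul0r.
- by move=> i j; rewrite /k2 ddg_sym mxE subrr.
Qed.

(** Entrywise closeness bounds the difference of the forms by d r |v|^2, which the coercivity of [N]
    converts into a relative error. *)
Lemma bil_perturb (M N : 'M[R]_r) (d c : R) v : (forall a b, `|M a b - N a b| <= d) ->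
  0 < c -> c * vdot v v <= bil N v v -> bil M v v <= (1 + d * r%:R / c) * bil N v v.
Proof.
move=> MN c0 h.
have hd : `|bil (M - N) v v| <= d * r%:R * vdot v v.
  by apply: bil_le => a b; rewrite !mxE; exact: MN.
have E : bil M v v = bil N v v + bil (M - N) v v by rewrite -bilD addrC subrK.
rewrite E mulrDl mul1r lerD2l; apply: le_trans (ler_norm _) _; apply: le_trans hd _.
have d0 : 0 <= d * r%:R.
  have [->|r0] := posnP r; first by rewrite mulr0.
  by rewrite mulr_ge0 // (le_trans _ (MN (Ordinal r0) (Ordinal r0))).
by rewrite -(mulrA (d * r%:R)) ler_wpM2l // ler_pdivlMl.
Qed.

Lemma bil_perturb_lower (M N : 'M[R]_r) (d c : R) v : (forall a b, `|M a b - N a b| <= d) ->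
  c * vdot v v <= bil N v v -> (c - d * r%:R) * vdot v v <= bil M v v.
Proof.
move=> MN h.
have hd : `|bil (M - N) v v| <= d * r%:R * vdot v v.
  by apply: bil_le => a b; rewrite !mxE; exact: MN.
have E : bil M v v = bil N v v + bil (M - N) v v by rewrite -bilD addrC subrK.
move: hd; rewrite ler_norml E => /andP[hd _].
by rewrite mulrBl; move: h hd; move: (c * vdot v v) (d * r%:R * vdot v v) (bil N v v) (bil _ v v) => *; lra.
Qed.

Lemma nbhs_sqdist_le (a : R) : 0 < a -> \forall x \near x0, sqdist x0 x <= a ^+ 2.
Proof.
move=> a0; apply: filterS (@near_sqdist_lt R n x0 x0 (a ^+ 2) _); first by move=> y /ltW.
by rewrite sqdist_xx exprn_gt0.
Qed.

Lemma near_entries (P : 'I_r -> 'I_r -> set 'rV[R]_n) (x : 'rV[R]_n) :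
  (forall a b, nbhs x (P a b)) -> nbhs x [set y | forall a b, P a b y].
Proof.
move=> h; have h1 a := filter_forall (nbhs_filter x) (h a).
exact: filter_forall (nbhs_filter x) h1.
Qed.

Lemma model_bounds (e : R) : pos_def (g x0) -> 0 < e -> e <= 1 ->
  exists rho c : R, [/\ 0 < rho, 0 < c, e * rho ^+ 2 <= 1 / 2 &
    forall x, sqdist x0 x <= rho ^+ 2 -> D x /\ forall v,
    [/\ c * vdot v v <= bil (g x) v v,
        bil (taylor2 x) v v <= (1 + e * sqdist x0 x) * bil (g x) v v,
        bil (g x) v v <= (1 + e * sqdist x0 x) * bil (taylor2 x) v v &
        bil (g x0) v v <= (1 + e) * bil (taylor2 x) v v]].
Proof.
move=> pg e0 e1; have [c0 c00 hc0] := pos_def_lower pg.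
pose c := c0 / 2; have cc : 0 < c by rewrite divr_gt0.
(* This choice gives d r <= e c <= c: an entrywise error [d] lowers the coercivity constant from
   [c0] to no less than c0 / 2, and is a relative error of at most [e]. The successor of [r] avoids
   division by zero. *)
pose d := e * c / r.+1%:R.
have r1 : 0 < r.+1%:R :> R by rewrite ltr0n.
have d0 : 0 < d by rewrite !divr_gt0 // mulr_gt0.
have dr : d * r%:R <= e * c.
  rewrite /d -mulrA ler_piMr //; first by rewrite mulr_ge0 // ltW.
  by rewrite mulrC ler_pdivrMr // mul1r ler_nat.
have nT : \forall x \near x0, forall a b, `|g x a b - taylor2 x a b| <= d * sqdist x0 x.
  apply: near_entries => a b; have [a0 a00 ha] := taylor2_remainder a b d0.
  by apply: filterS (nbhs_sqdist_le a00) => x; exact: ha.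
have ng : \forall x \near x0, forall a b, `|g x a b - g x0 a b| <= d.
  apply: near_entries => a b.
  have /cvgrPdist_le /(_ _ d0) := Ck2_continuous (cg a b) Dx0.
  by apply: filterS => x; rewrite distrC.
have nH : \forall x \near x0, forall a b, `|taylor2 x a b - g x0 a b| <= d.
  apply: near_entries => a b.
  have cT : continuous (fun x => taylor2 x a b) by exact: CkT_continuous (CkM_taylor2 0 a b).
  have /cvgrPdist_le /(_ _ d0) := cT x0.
  by apply: filterS => x; rewrite taylor2_x0 distrC.
have [a a0 ha] := nbhs_box (filterI (near_D Dx0) (filterI nT (filterI ng nH))).
pose rho := Num.min a (1 / 2).
have rho0 : 0 < rho by rewrite lt_min a0 divr_gt0.
exists rho, c; split=> //.
  have h2 : rho <= 1 / 2 by rewrite ge_min lexx orbT.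
  have h3 : rho ^+ 2 <= 1 / 2 * (1 / 2) by rewrite expr2 ler_pM // ltW.
  apply: (@le_trans _ _ (rho ^+ 2)); first by rewrite ler_piMl // sqr_ge0.
  by apply: le_trans h3 _; lra.
move=> x xr; have xa : box x0 a x.
  apply: (@box_le _ _ x0 rho a); first by rewrite ge_min lexx.
  by apply: sqdist_box => //; exact: ltW.
have [Dx [hT [hg hH]]] := ha _ xa; split=> // v.
have ec : e * c <= c by rewrite ler_piMl // ltW.
have low (M : 'M[R]_r) : (forall a b, `|M a b - g x0 a b| <= d) ->
    c * vdot v v <= bil M v v.
  move=> hM; have := @bil_perturb_lower M (g x0) d c0 v hM (hc0 v).
  apply: le_trans; rewrite ler_wpM2r ?vdot_ge0 //; move: dr ec; rewrite /c.
  by move: (d * r%:R) => *; lra.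
have lg := low _ hg; have lH := low _ hH.
have pert (M N : 'M[R]_r) (y : R) : 0 <= y -> (forall a b, `|M a b - N a b| <= d * y) ->
    c * vdot v v <= bil N v v -> bil M v v <= (1 + e * y) * bil N v v.
  move=> y0 hMN lN; have := bil_perturb hMN cc lN; move/le_trans; apply.
  have bN : 0 <= bil N v v by apply: le_trans lN; rewrite mulr_ge0 ?vdot_ge0 // ltW.
  rewrite ler_wpM2r // lerD2l ler_pdivrMr // mulrAC [leRHS]mulrAC.
  by rewrite ler_wpM2r.
split=> //.
- apply: pert => //; first exact: sqdist_ge0.
  by move=> i j; rewrite distrC; exact: hT.
- by apply: pert => //; exact: sqdist_ge0.
- have := @pert (g x0) (taylor2 x) 1 ler01; rewrite !mulr1; apply => // i j.
  by rewrite distrC; exact: hH.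
Qed.

End local_model.

(** * Explicit values where the form is constant *)

Section centre.
Context {R : realType} {n r : nat}.

Lemma isPd_quad i (a b : fform R n r) (H : 'rV[R]_n -> 'M[R]_r) x : CkM 1 H ->
  isPd i (fun y => dot a (fib (H y) b)) x (dot a (fib (pdM i H x) b)).
Proof.
move=> cH; rewrite dot_fib; under [X in isPd _ X]funext do rewrite dot_fib.
apply: isPd_sum => I _; apply: isPd_sum => s _; apply: isPd_sum => t _.
by rewrite mxE; apply: isPdZ; exact: CkT_isPd (cH s t).
Qed.

Variables (q : nat) (x0 : 'rV[R]_n) (m : R) (H : 'rV[R]_n -> 'M[R]_r).
Variables (f : 'rV[R]_n -> fform R n r) (xi : fform R n r).
Hypotheses (smH : forall k, CkM k H) (smf : forall k, CkF k f) (symH : forall x, (H x)^T = H x).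
Hypotheses (fxi : forall x, sqdist x0 x < m -> f x = xi) (qxi : is_qform q xi) (m0 : 0 < m).

Lemma pdM_CkM i k : CkM k (pdM i H).
Proof.
move=> a b; under [X in CkT _ X]funext do rewrite mxE.
exact: CkT_pd (smH k.+1 a b).
Qed.

Lemma pdM_tr i x : (pdM i H x)^T = pdM i H x.
Proof.
apply/matrixP => a b; rewrite !mxE; congr (pd i _ x); apply/funext => y.
by rewrite -[in LHS]symH mxE.
Qed.

Lemma codiff_const x : sqdist x0 x < m ->
  codiff H f x = fun I t => \sum_i fib (pdM i H x) (inter i xi) I t.
Proof.
move=> xm; apply: fform_ext => I t; apply: eq_bigr => i _; rewrite -inter_fib.
congr (inter i _ I t); apply: fform_ext => J s; apply: isPdE.
apply: (@isPd_near _ _ i (fun y => fib (H y) xi J s)).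
  by apply: filterS (near_sqdist_lt xm) => y ym; rewrite /Hf fxi.
apply: isPd_sum => k _; rewrite mxE.
have := isPdM (CkT_isPd i x (smH 1 s k)) (isPd_cst i (xi J k) x).
by move=> /isPd_eq; apply; rewrite mulr0 addr0.
Qed.

Lemma sum_inter_energy x : \sum_i dot (inter i xi) (fib (H x) (inter i xi)) = q%:R * dot xi (fib (H x) xi).
Proof.
under eq_bigr => i _ do rewrite -inter_fib -dot_wedge.
rewrite -dot_suml -dotZl; congr dot; apply: fform_ext => J t.
exact: sum_wedge_inter.
Qed.

(** The derivative falls either on the coordinate factor, which sums to [q] times the energy, or on
    [H], which reproduces the sum in [Psi_const]. This is the cancellation behind [excess_const]. *)
Lemma Phi_const x : sqdist x0 x < m -> Phi x0 H f x = q%:R * dot xi (fib (H x) xi)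
  + \sum_i \sum_j (x 0 j - x0 0 j) * dot (inter i xi) (fib (pdM i H x) (inter j xi)).
Proof.
move=> xm; rewrite -sum_inter_energy -big_split; apply: eq_bigr => i _; apply: isPdE.
apply: (@isPd_near _ _ i (fun y : 'rV[R]_n => \sum_j (y 0 j - x0 0 j) * dot (inter i xi) (fib (H y) (inter j xi)))).
  apply: filterS (near_sqdist_lt xm) => y ym; rewrite /radial fxi // fib_sum dot_sumr.
  by apply: eq_bigr => j _; rewrite fibZ dotZr.
apply: isPd_eq; first by apply: isPd_sum => j _; exact: isPdM (isPd_coordB x0 i j x) (isPd_quad i _ _ x (smH 1)).
by rewrite big_split /= (sum_delta i (fun j => dot (inter i xi) (fib (H x) (inter j xi)))).
Qed.

Lemma Psi_const x : sqdist x0 x < m -> Psi x0 H f x =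
  \sum_i \sum_j (x 0 j - x0 0 j) * dot (inter i xi) (fib (pdM i H x) (inter j xi)).
Proof.
move=> xm; rewrite /Psi codiff_const // /radial fxi // dot_sumr; apply: eq_bigr => i _.
rewrite dot_suml; apply: eq_bigr => j _; rewrite dotZl; congr (_ * _).
exact: fib_sym (pdM_tr i x).
Qed.

Lemma excess_const x : sqdist x0 x < m -> @excess R n r q x0 H f x = 0.
Proof.
move=> xm; rewrite /excess Phi_const // Psi_const // /energy /Hf fxi //.
by rewrite -addrA -opprD subrr.
Qed.

Lemma Ups_const : Ups H f x0 =
  \sum_i \sum_j dot (inter i xi) (fib (pdM i (fun y => pdM j H y) x0) (inter j xi)).
Proof.
have x0m : sqdist x0 x0 < m by rewrite sqdist_xx.
apply: eq_bigr => i _; apply: isPdE.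
apply: (@isPd_near _ _ i (fun y => \sum_j dot (inter i xi) (fib (pdM j H y) (inter j xi)))).
  by apply: filterS (near_sqdist_lt x0m) => y ym; rewrite codiff_const // fxi // dot_sumr.
by apply: isPd_sum => j _; apply: isPd_quad; exact: pdM_CkM.
Qed.

(** At the centre the coordinate factors vanish, so only their derivatives contribute, once per
    direction. *)
Lemma Gam_const : Gam x0 H f x0 = n%:R * dot xi (fib (H x0) xi).
Proof.
rewrite -[in n%:R](card_ord n) mulr_natl -sumr_const; apply: eq_bigr => i _; apply: isPdE.
have := isPdM (isPd_coordB x0 i i x0) (CkT_isPd i x0 (smenergy smH smf 1)).
move=> /isPd_eq; apply; rewrite eqxx mul1r subrr mul0r addr0 /energy /Hf fxi //.
by rewrite sqdist_xx.
Qed.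

Lemma bochner_const e N :
  let C : fform R n r := fun I t => \sum_i fib (pdM i H x0) (inter i xi) I t in
  @bochner R n r q x0 H f e N x0 =
  - (\sum_i \sum_j dot (inter i xi) (fib (pdM i (fun y => pdM j H y) x0) (inter j xi)))
  + dot C (fib N C)
  + e * (dot C (fib N C) + 2 * q%:R * (1 + 2 * n%:R) * dot xi (fib (H x0) xi)).
Proof.
have x0m : sqdist x0 x0 < m by rewrite sqdist_xx.
move=> C; rewrite /bochner Ups_const codiff_const // -/C Gam_const /energy /Hf fxi //.
move: (\sum_i _) (dot C _) (dot xi _) => A B F; ring.
Qed.

End centre.

(** * The curvature form at the centre *)

Section curvature.
Context {R : realType} {n r : nat}.
Variables (D : set 'rV[R]_n) (g : 'rV[R]_n -> 'M[R]_r) (x0 : 'rV[R]_n).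
Hypotheses (oD : open D) (Dx0 : D x0) (cg : forall a b : 'I_r, Ck 2 D (fun x => g x a b)).
Hypothesis (symg : forall x, D x -> (g x)^T = g x).
Hypothesis (pg : forall x, D x -> pos_def (g x)).

(** Leibniz rule with the derivative of the inverse; the metric on the left, which the inner product
    supplies, clears one inverse. *)
Lemma pdM_connection i j : g x0 *m pdM i (fun y => invmx (g y) *m pdM j g y) x0 =
  - (pdM i g x0 *m (invmx (g x0) *m pdM j g x0)) + ddg g x0 i j.
Proof.
have ug : \forall y \near x0, g y \in unitmx.
  by apply: filterS (near_D oD Dx0) => y Dy; apply: pos_def_unitmx; exact: pg.
have dg a b : isPd i (fun y => g y a b) x0 (pdM i g x0 a b).
  by rewrite mxE; exact: Ck2_isPd (cg a b) Dx0.
have E : pdM i (fun y => invmx (g y) *m pdM j g y) x0 =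
    - (invmx (g x0) *m pdM i g x0 *m invmx (g x0)) *m pdM j g x0 + invmx (g x0) *m ddg g x0 i j.
  apply/matrixP => a b; rewrite [LHS]mxE; apply: isPdE.
  under [X in isPd _ X]funext do rewrite mxE.
  apply: isPd_eq.
    apply: isPd_sum => k _; apply: isPdM (isPd_invmx ug dg a k) _.
    under [X in isPd _ X]funext do rewrite mxE.
    exact: (Ck2_isPd2 i j (cg k b) Dx0).
  rewrite big_split /= [RHS]mxE; congr (_ + _); rewrite [RHS]mxE; first by [].
  by apply: eq_bigr => k _; rewrite [in RHS]mxE.
have u0 : g x0 \in unitmx by exact: nbhs_singleton ug.
by rewrite E mulmxDr mulNmx mulmxN !mulmxA mulmxV // !mul1mx.
Qed.

(** [wedge] passes to the other factor as [inter], and symmetry of the first derivatives lets the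
    terms quadratic in them assemble into one square in [C]. The result is the [e]-free part of
    [bochner_const]. *)
Lemma ip_Theta q (xi : fform R n r) : is_qform q.+1 xi ->
  let C : fform R n r := fun I t => \sum_i fib (pdM i g x0) (inter i xi) I t in
  ip q.+1 (g x0) (Theta g x0 xi) xi =
  - (\sum_i \sum_j dot (inter i xi) (fib (ddg g x0 i j) (inter j xi)))
  + dot C (fib (invmx (g x0)) C).
Proof.
move=> qxi C; pose A i j := pdM i (fun y => invmx (g y) *m pdM j g y) x0.
have ThE : Theta g x0 xi = fun I s => -1 * \sum_i \sum_j wedge i (inter j (fib (A i j) xi)) I s.
  by apply: fform_ext => I s; rewrite mulN1r.
have qTh : is_qform q.+1 (Theta g x0 xi).
  move=> I s Iq; rewrite ThE big1 ?mulr0 // => i _; rewrite big1 // => j _.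
  by apply: (@wedge_qform _ _ _ q) => //; apply: inter_qform; exact: fib_qform.
rewrite (ip_dot _ _ qTh) ThE dotZl dot_suml mulN1r.
have E i j : dot (wedge i (inter j (fib (A i j) xi))) (fib (g x0) xi) =
    - dot (fib (pdM i g x0) (inter i xi)) (fib (invmx (g x0)) (fib (pdM j g x0) (inter j xi)))
    + dot (inter i xi) (fib (ddg g x0 i j) (inter j xi)).
  rewrite dot_wedge !inter_fib dotC fib_tr symg // -fib_mul pdM_connection fib_addm fib_oppm.
  rewrite dotDr dotZr mulN1r; congr (- _ + _).
  by rewrite !fib_mul fib_tr (pdM_sym oD Dx0 symg).
have -> : \sum_i dot (fun I s => \sum_j wedge i (inter j (fib (A i j) xi)) I s) (fib (g x0) xi) =
   \sum_i \sum_j (- dot (fib (pdM i g x0) (inter i xi)) (fib (invmx (g x0)) (fib (pdM j g x0) (inter j xi)))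
    + dot (inter i xi) (fib (ddg g x0 i j) (inter j xi))).
  by apply: eq_bigr => i _; rewrite dot_suml; apply: eq_bigr => j _; exact: E.
have -> : dot C (fib (invmx (g x0)) C) =
   \sum_i \sum_j dot (fib (pdM i g x0) (inter i xi)) (fib (invmx (g x0)) (fib (pdM j g x0) (inter j xi))).
  by rewrite /C fib_sum dot_suml; apply: eq_bigr => i _; rewrite dot_sumr.
under eq_bigr => i _ do rewrite big_split /= sumrN.
by rewrite big_split /= sumrN opprD opprK addrC.
Qed.

End curvature.

(** * The quadratic weight and its Hessian *)

Section radial_weight.
Context {R : realType} {n : nat}.

Lemma pos_def_scalar (c : R) : 0 < c -> pos_def (c%:M : 'M[R]_n).
Proof.
move=> c0 v v0; rewrite mul_mx_scalar -scalemxAl mxE pmulr_rgt0 // mxE.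
have E j : v 0 j * v^T j 0 = v 0 j ^+ 2 by rewrite mxE expr2.
rewrite lt_neqAle; apply/andP; split; last first.
  by apply: sumr_ge0 => j _; rewrite E sqr_ge0.
apply: contra v0 => /eqP/esym/eqP; rewrite psumr_eq0; last by move=> j _; rewrite E sqr_ge0.
move=> /allP h; apply/eqP/rowP => j; rewrite mxE.
by have := h j (mem_index_enum j); rewrite E /= sqrf_eq0 => /eqP.
Qed.

Lemma hessM_sqdist (c : R) x0 (x : 'rV[R]_n) :
  hessM (fun y => c * sqdist x0 y) x = (2 * c)%:M.
Proof.
apply/matrixP => i j; rewrite !mxE.
have -> : pd j (fun y => c * sqdist x0 y) = fun y => 2 * c * (y 0 j - x0 0 j).
  apply/funext => y; rewrite (isPdE (isPdZ c (isPd_sqdist x0 j y))).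
  by rewrite mulrCA mulrA.
by rewrite (isPdE (isPdZ (2 * c) (isPd_coordB x0 i j x))) mulr_natr.
Qed.

End radial_weight.

(** * The metric extended by zero *)

Section patched_metric.
Context {R : realType} {n r : nat}.
Variables (D : set 'rV[R]_n) (g : 'rV[R]_n -> 'M[R]_r).
Hypotheses (oD : open D) (cg : forall a b : 'I_r, Ck 2 D (fun x => g x a b)).
Hypothesis (pg : forall x, D x -> pos_def (g x)).

(** Extending by zero turns integrals over [D] into integrals over the whole space and keeps the
    form semidefinite. *)
Definition patch (x : 'rV[R]_n) : 'M[R]_r := if `[< D x >] then g x else 0.

Lemma patch_in x : D x -> patch x = g x.
Proof. by move=> Dx; rewrite /patch asboolT. Qed.

Lemma measurable_patch a b : measurable_fun (setT : set (borelT R n)) (fun x => patch x a b).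
Proof.
have -> : (fun x => patch x a b) = fun x => if `[< D x >] then g x a b else 0.
  by apply/funext => x; rewrite /patch; case: ifP => // _; rewrite mxE.
by apply: continuous_patch_borel_fun => // x Dx; exact: Ck2_continuous (cg a b) Dx.
Qed.

Lemma patch_psd x v : 0 <= bil (patch x) v v.
Proof.
rewrite /patch; case: asboolP => [Dx|_]; last first.
  by rewrite /bil big1 // => t _; rewrite big1 // => s _; rewrite mxE mulr0.
have [c c0 h] := pos_def_lower (pg Dx).
by apply: le_trans (h v); rewrite mulr_ge0 ?vdot_ge0 // ltW.
Qed.

Lemma dot_patch x (a b : fform R n r) :
  dot a (fib (patch x) b) = if `[< D x >] then dot a (fib (g x) b) else 0.
Proof.
rewrite /patch; case: ifP => // _; rewrite dot_fib big1 // => I _.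
by rewrite big1 // => t _; rewrite big1 // => s _; rewrite mxE mulr0.
Qed.

Lemma iintD_ip q (a b : 'rV[R]_n -> fform R n r) (w : 'rV[R]_n -> R) :
  (forall x, is_qform q (a x)) ->
  iintD D (fun x => (ip q (g x) (a x) (b x) * w x)%:E) =
  iint (fun x => (dot (a x) (fib (patch x) (b x)) * w x)%:E).
Proof.
move=> qa; congr iint; apply/funext => x; rewrite dot_patch.
by case: ifP => _; rewrite ?mul0r // (ip_dot _ _ (qa x)).
Qed.

(** Verifies that the right-hand side of the L^2 estimate is finite: the integrand is measurable and
    dominated by a continuous function with compact support built from the model energy. *)
Lemma iint_energy_lty x0 rho (H : 'rV[R]_n -> 'M[R]_r) f (c e s : R) : 0 < rho ->
  (forall k, CkM k H) -> (forall k, CkF k f) -> suppF x0 rho f -> 0 <= c ->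
  (forall x, sqdist x0 x <= rho ^+ 2 -> forall v, bil (patch x) v v <= e * bil (H x) v v) ->
  (iint (fun x => (c * dot (f x) (fib (patch x) (f x)) * gauss x0 s x)%:E) < +oo)%E.
Proof.
move=> rho0 smH smf sf c0 gH.
have quad0 x : 0 <= dot (f x) (fib (patch x) (f x)) by apply: quad_ge0 => v; exact: patch_psd.
have W0 x : 0 <= c * dot (f x) (fib (patch x) (f x)) * gauss x0 s x.
  by rewrite !mulr_ge0 // ltW // gauss_gt0.
have iB : intg (fun x => c * e * energy H f x * gauss x0 s x).
  apply: (@intg_gauss _ _ x0 rho) => //; last by apply: supp_inMr; exact: senergy.
  apply: (@CkT_continuous _ _ 0); apply: CkTZ; exact: smenergy.
rewrite iint_Int ?ltry //; apply: intg_le iB _.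
  apply: measurable_funM; last exact: continuous_borel_fun (CkT_continuous (CkT_gauss 0 x0 s)).
  apply: measurable_funM; first exact: measurable_cst.
  apply: mfun_quad => *; last exact: measurable_patch.
  exact: continuous_borel_fun (CkT_continuous (smf 0 _ _)).
move=> x; rewrite ger0_norm // ler_pM2r ?gauss_gt0 // -mulrA ler_wpM2l //.
have [xr|xr] := ltP (rho ^+ 2) (sqdist x0 x); last by apply: quad_le => v; exact: gH.
have f0 : f x = fun _ _ => 0 by apply: fform_ext => I t; exact: sf.
by rewrite /energy f0 !dot0 mulr0.
Qed.

End patched_metric.

(** * The contradiction *)

Lemma small_perturbation (R : realType) (th K : R) : th < 0 ->
  exists e : R, [/\ 0 < e, e <= 1 & th + e * K < 0].
Proof.
move=> th0; have K0 := normr_ge0 K; have K1 : 0 < 2 * (`|K| + 1) by lra.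
pose e := Num.min 1 (- th / (2 * (`|K| + 1))).
have e0 : 0 < e by rewrite lt_min ltr01 divr_gt0 // oppr_gt0.
exists e; split=> //; first by rewrite ge_min lexx.
have h1 : e * (2 * (`|K| + 1)) <= - th by rewrite -ler_pdivlMr // ge_min lexx orbT.
have h2 : e * K <= e * `|K| by rewrite ler_pM2l // ler_norm.
have h3 : 0 <= e * `|K| by rewrite mulr_ge0 // ltW.
by rewrite (_ : e * _ = 2 * (e * `|K|) + 2 * e) in h1; [lra|ring].
Qed.

Unset Implicit Arguments.

Theorem theorem1p1 (R : realType) (n r q : nat) (D : set 'rV[R]_n)
  (g : 'rV[R]_n -> 'M[R]_r) :
  open D -> connected D ->
  (forall a b : 'I_r, Ck 2 D (fun x => g x a b)) ->
  (forall x, D x -> (g x)^T = g x /\ pos_def (g x)) ->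
  (1 <= q <= n)%N ->
  (forall (psi : 'rV[R]_n -> R), smooth_on setT psi ->
     (forall x, pos_def (hessM psi x)) ->
   forall (f : 'rV[R]_n -> fform R n r),
     (forall x, is_qform q (f x)) ->
     (forall I t, smooth_on D (fun x => f x I t)) ->
     (forall I t, compact_support_in D (fun x => f x I t)) ->
     (forall x, D x -> extd f x = (fun _ _ => 0)) ->
     (iintD D (fun x => (ip q (g x) (HessInv q (hessM psi x) (f x)) (f x)
                         * expR (- psi x))%:E) < +oo)%E ->
   exists u : 'rV[R]_n -> fform R n r,
     [/\ forall x, is_qform q.-1 (u x),
         forall I t, borel_meas (fun x => u x I t),
         (iintD D (fun x => (ip q.-1 (g x) (u x) (u x))%:E) < +oo)%E,
         weak_d D u f &
         (iintD D (fun x => (ip q.-1 (g x) (u x) (u x) * expR (- psi x))%:E)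
          <= iintD D (fun x => (ip q (g x) (HessInv q (hessM psi x) (f x)) (f x)
                               * expR (- psi x))%:E))%E]) ->
  nakano_q_semipositive q D g.
Proof.
move=> oD _ cg gD /andP[q1 _] hyp x0 Dx0 xi; case: q q1 hyp => // q _ hyp qxi.
have symg x : D x -> (g x)^T = g x by move=> /gD [].
have pg x : D x -> pos_def (g x) by move=> /gD [].
rewrite leNgt; apply/negP; rewrite (ip_Theta oD Dx0 cg symg pg qxi).
set C : fform R n r := fun I t => _.
(* The constant is the coefficient of [e] in [bochner_const] when [H x0] is [g x0], so this [e]
   keeps [bochner] negative at the centre. *)
move=> /(@small_perturbation R _ (dot C (fib (invmx (g x0)) C)
  + 2 * q.+1%:R * (1 + 2 * n%:R) * dot xi (fib (g x0) xi))) [e [e0 e1 neg]].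
have [rho [c [rho0 c0 erho hb]]] := model_bounds oD Dx0 cg (pg x0 Dx0) e0 e1.
pose H := taylor2 g x0; pose f := closed_form q x0 rho xi.
have smH k : CkM k H by exact: CkM_taylor2.
have symH x : (H x)^T = H x by exact: taylor2_sym oD Dx0 symg x.
have smf k : CkF k f by exact: CkF_closed_form.
have sf : suppF x0 rho f by exact: suppF_closed_form.
have qf x : is_qform q.+1 (f x) by exact: closed_form_qform.
have m0 : 0 < rho ^+ 2 / 2 by rewrite divr_gt0 // exprn_gt0.
have fxi x : sqdist x0 x < rho ^+ 2 / 2 -> f x = xi by exact: closed_form_const.
have neg0 : @bochner R n r q.+1 x0 H f e (invmx (g x0)) x0 < 0.
  have Hx0 : H x0 = g x0 by exact: taylor2_x0.
  rewrite (bochner_const q.+1 smH smf fxi m0) Hx0.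
  have -> : (fun I t => \sum_i fib (pdM i H x0) (inter i xi) I t) = C.
    by apply: fform_ext => I t; apply: eq_bigr => i _; rewrite (pdM_taylor2 oD Dx0 cg).
  rewrite (_ : \sum_i \sum_j _ =
    \sum_i \sum_j dot (inter i xi) (fib (ddg g x0 i j) (inter j xi))) //.
  by apply: eq_bigr => i _; apply: eq_bigr => j _; rewrite (pdM2_taylor2 oD Dx0 cg).
have cB : continuous (@bochner R n r q.+1 x0 H f e (invmx (g x0))).
  by apply: (@CkT_continuous _ _ 0); exact: smbochner.
have cE : continuous (@excess R n r q.+1 x0 H f).
  by apply: (@CkT_continuous _ _ 0); exact: smexcess.
have sB : supp_in x0 rho (@bochner R n r q.+1 x0 H f e (invmx (g x0))) by exact: sbochner.
have sE : supp_in x0 rho (@excess R n r q.+1 x0 H f) by exact: sexcess.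
have E0 : exists2 m : R, 0 < m & forall x, sqdist x0 x < m -> @excess R n r q.+1 x0 H f x = 0.
  by exists (rho ^+ 2 / 2) => // x; exact: (excess_const smH symH fxi qxi).
(* [s] may depend on [e], [rho] and [f] since none of them involves the weight; s > e makes the
   weight strictly convex. *)
have [s [es s0] Ineg] := gauss_concentration e rho0 cB cE sB sE neg0 E0.
have BD : [set x | sqdist x0 x <= rho ^+ 2] `<=` D by move=> x /hb [].
have se : 0 < s - e by rewrite subr_gt0.
pose psi x := (s - e) * sqdist x0 x.
have psiH x : hessM psi x = (2 * (s - e))%:M by exact: hessM_sqdist.
have qR : 2 * (s - e) * q.+1%:R != 0 by rewrite !mulf_neq0 ?pnatr_eq0 // gt_eqF.
have rhsE : iintD D (fun x => (ip q.+1 (g x) (HessInv q.+1 (hessM psi x) (f x)) (f x)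
      * expR (- psi x))%:E) =
    iint (fun x => ((2 * (s - e) * q.+1%:R)^-1 * dot (f x) (fib (patch D g x) (f x))
      * gauss x0 (s - e) x)%:E).
  have E x : HessInv q.+1 (hessM psi x) (f x) = fun I t => (2 * (s - e) * q.+1%:R)^-1 * f x I t.
    by rewrite psiH; exact: HessInv_scalar.
  rewrite iintD_ip => [|x I t Iq]; last by rewrite E qf ?mulr0.
  by congr iint; apply/funext => x; rewrite E dotZl.
have cS : 0 <= (2 * (s - e) * q.+1%:R)^-1 by rewrite invr_ge0 !mulr_ge0 // ltW.
(* A crude comparison, used only for finiteness: 1 + e |x - x0|^2 is at most 3 / 2 on the ball. *)
have gH x : sqdist x0 x <= rho ^+ 2 -> forall v, bil (patch D g x) v v <= 2 * bil (H x) v v.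
  move=> xr v; have [Dx /(_ v) [b1 _ b2 _]] := hb _ xr; rewrite patch_in //.
  have y1 : 0 < 1 + e * sqdist x0 x by rewrite ltr_pwDl // mulr_ge0 ?sqdist_ge0 // ltW.
  have b0 : 0 <= bil (g x) v v by apply: le_trans b1; rewrite mulr_ge0 ?vdot_ge0 // ltW.
  have bH : 0 <= bil (H x) v v by rewrite -(pmulr_rge0 _ y1); exact: le_trans b2.
  apply: le_trans b2 _; rewrite ler_wpM2r //.
  have : e * sqdist x0 x <= e * rho ^+ 2 by rewrite ler_pM2l.
  by move: (sqdist x0 x) erho => y; lra.
have smD (h : 'rV[R]_n -> R) A : (forall k, CkT k h) -> smooth_on A h.
  by move=> ch k t tk x Ax; exact: (proj2 (CkTP k h) (ch k)).
have [||||||u [qu mu u_fin du u_le]] := hyp psi _ _ f qf.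
- by apply: smD => k; apply: CkTZ; exact: CkT_sqdist.
- by move=> x; rewrite psiH; apply: pos_def_scalar; rewrite mulr_gt0.
- by move=> I t; apply: smD => k; exact: smf.
- move=> I t; exists [set x | sqdist x0 x <= rho ^+ 2]; split => //; first exact: compact_sqdist_le.
  by move=> x /negP; rewrite -ltNge; exact: sf.
- by move=> x _; exact: closed_form_closed.
- by rewrite rhsE; exact: iint_energy_lty rho0 smH smf sf cS gH.
have mu' I t := borel_measP (mu I t).
have u_fin' : (iint (fun x => (dot (u x) (fib (patch D g x) (u x)))%:E) < +oo)%E.
  have := u_fin; rewrite (_ : (fun x => _) = fun x => (ip q (g x) (u x) (u x) * 1)%:E).
    rewrite (iintD_ip D g u (fun=> 1) qu); apply: le_lt_trans.
    by rewrite le_eqVlt; apply/orP; left; apply/eqP; congr iint; apply/funext => x; rewrite mulr1.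
  by apply/funext => x; rewrite mulr1.
have u_le' : (iint (fun x => (dot (u x) (fib (patch D g x) (u x)) * gauss x0 (s - e) x)%:E) <=
    iint (fun x => ((2 * (s - e) * q.+1%:R)^-1 * dot (f x) (fib (patch D g x) (f x))
      * gauss x0 (s - e) x)%:E))%E.
  by rewrite -rhsE -(iintD_ip D g u _ qu).
have u0 := pos_def_unitmx (pg x0 Dx0).
have p0 v : 0 <= bil (g x0) v v.
  by have := patch_psd pg x0 v; rewrite patch_in.
have T := @test_inequality R n r q.+1 x0 rho H f rho0 smH smf sf symH D (patch D g) u (g x0) s e c
  BD mu' (measurable_patch oD cg) (patch_psd pg) c0.
move: Ineg; rewrite ltNge => /negP; apply; apply: T => //.
- by move=> x xr v; have [Dx /(_ v) []] := hb _ xr; rewrite patch_in.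
- by move=> x xr v; have [Dx /(_ v) []] := hb _ xr; rewrite patch_in.
- by move=> x xr v; have [Dx /(_ v) []] := hb _ xr; rewrite patch_in.
- exact: symg.
- by move=> x xr v; have [Dx /(_ v) []] := hb _ xr.
Qed.
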